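(* Consider the Markovian Hawkes-fed infinite-server queue with parameters $\lambda_\infty,r,\mu>0$ and mark $B$, with $\Lambda(0)=\lambda_\infty$ and $N(0)=0$. Let $b_1:=\mathbb{E}B$, $b_2:=\mathbb{E}B^2<\infty$ and $r_0:=r-b_1$. If $r_0\neq0$, then for all $t\geqslant0$, $$\mathbb{E}\Lambda^2(t)=\frac{\lambda_\infty r(b_2+2\lambda_\infty r)}{2r_0^2}-\frac{\lambda_\infty b_1(b_2+2\lambda_\infty r)}{r_0^2}e^{-r_0t}+D_1e^{-2r_0t},$$ $$\begin{aligned}\mathbb{E}\Lambda(t)N(t)={}&\frac{\lambda_\infty r}{r_0(\mu+r_0)}\left(\frac{b_2+2\lambda_\infty r}{2r_0}+\frac{\lambda_\infty r+\mu b_1}{\mu}\right)-\frac{\lambda_\infty^2\,r\,(r-\mu)}{\mu r_0(\mu-r_0)}e^{-\mu t}\\&-\frac{\lambda_\infty b_1}{\mu r_0}\left(b_1+\frac{b_2+2\lambda_\infty r}{r_0}+\frac{\lambda_\infty r}{\mu-r_0}\right)e^{-r_0t}+\frac{D_1}{\mu-r_0}e^{-2r_0t}+D_2e^{-(\mu+r_0)t},\end{aligned}$$ $$\begin{aligned}\mathbb{E}N^2(t)={}&\frac{\lambda_\infty r}{\mu r_0(\mu+r_0)}\left(\frac{b_2+2\lambda_\infty r}{2r_0}+\frac{\mu(\mu+r)+\lambda_\infty r}{\mu}\right)-\frac{\lambda_\infty(r-\mu)(\mu r_0+2\lambda_\infty r)}{\mu^2r_0(\mu-r_0)}e^{-\mu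 t}\\&-\frac{2\lambda_\infty b_1}{\mu r_0(2\mu-r_0)}\left(b_1+\frac{b_2+2\lambda_\infty r}{r_0}+\frac{\lambda_\infty r}{\mu-r_0}+\frac{\mu}{2}\,\frac{2\mu-r_0}{\mu-r_0}\right)e^{-r_0t}\\&+\frac{D_1}{(\mu-r_0)^2}e^{-2r_0t}+\frac{2D_2}{\mu-r_0}e^{-(\mu+r_0)t}+D_3e^{-2\mu t},\end{aligned}$$ where the constants $D_1$, $D_2$ and $D_3$ follow from the initial conditions, i.e., the requirements that $\mathbb{E}N^2(0)=0$, $\mathbb{E}\Lambda(0)N(0)=0$, and $\mathbb{E}\Lambda^2(0)=\lambda_\infty^2$.
   Context: Markovian Hawkes-fed infinite-server queue: fix $\lambda_\infty>0$, $r>0$, $\mu>0$ and a random variable $B$ with $\mathbb{P}(B>0)=1$; let $B_1,B_2,\dots$ be i.i.d. copies of $B$. The arrival process $(M(t))_{t\geqslant0}$ is a Hawkes process: a counting process with arrival epochs $t_1<t_2<\cdots$ and associated filtration $\mathscr{F}(t)$ such that, as $\Delta t\downarrow0$, $\mathbb{P}(M(t+\Delta t)-M(t)=1\mid\mathscr{F}(t))=\Lambda(t)\Delta t+o(\Delta t)$, the conditional probability of more than one arrival is $o(\Delta t)$, and that of no arrival is $1-\Lambda(t)\Delta t+o(\Delta t)$, where $\Lambda(t)=\lambda_\infty+\sum_{t_i<t}B_ie^{-r(t-t_i)}$; in particular $\Lambda(0)=\lambda_\infty$. Each arrival is a customer taken into service immediately; service requirements are i.i.d. exponential with rate $\mu$,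 independent of everything else. $N(t)$ is the number of customers in the system at time $t$, with $N(0)=0$.
   Formalization: The e^{-μt} terms in EΛ(t)N(t) and EN²(t) carry a plus sign instead of the printed minus, which is false whenever r≠μ; each formula assumes its denominators (μ−r₀, μ+r₀, 2μ−r₀) are nonzero, and the o(Δt) remainders are read in L¹. *)

(* Defs.v *)
From HB Require Import structures.
From mathcomp Require Import all_boot all_order all_algebra finmap.
From mathcomp Require Import all_classical all_reals all_analysis.

Set Implicit Arguments.
Unset Strict Implicit.
Unset Printing Implicit Defensive.

Import Order.TTheory GRing.Theory Num.Theory.
Import numFieldNormedType.Exports.

Local Open Scope classical_set_scope.
Local Open Scope ring_scope.

(* 0 when A is infinite; only used below for index sets that are finite because
   the arrival epochs tend to infinity. *)
Definition count (A : set nat) : nat := #|` fset_set A|.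

Definition sigma_of (T : Type) (R : realType) (F : set (T -> R)) : set (set T) :=
  <<s \bigcup_(X in F) preimage_set_system setT X (@measurable _ R) >>.

Definition independent_of d (T : measurableType d) (R : realType)
    (P : probability T R) (X : T -> R) (G : set (set T)) : Prop :=
  forall (A : set T) (C : set R), G A -> measurable C ->
    P (A `&` X @^-1` C) = (P A * P (X @^-1` C))%E.

(* Y is a version of the conditional probability P(E | G). *)
Definition is_cond_prob d (T : measurableType d) (R : realType)
    (P : probability T R) (G : set (set T)) (E : set T) (Y : T -> R) : Prop :=
  [/\ forall C : set R, measurable C -> G (Y @^-1` C),
      P.-integrable setT (EFin \o Y)
    & forall A, G A -> (\int[P]_(w in A) (Y w)%:E)%E = P (A `&` E)].

(* As h decreases to 0, P(E h | G) = Q h + o(h).  Conditional probabilities are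
   only defined almost surely, separately for each h, so the remainder o(h) is
   taken in L^1(P).  (With a merely almost sure remainder at each fixed time,
   the intensity would not determine the law of a point process: a singular
   hazard started at a continuously distributed epoch would go unnoticed.) *)
Definition cond_prob_expansion d (T : measurableType d) (R : realType)
    (P : probability T R) (G : set (set T)) (E : R -> set T)
    (Q : R -> T -> R) : Prop :=
  exists2 p : R -> T -> R,
    forall h, 0 < h -> is_cond_prob P G (E h) (p h) &
    (fun h : R => (h^-1)%:E * 'E_P[fun w => (`|p h w - Q h w|)%R])%E @ 0^'+ --> 0%E.

(* The arrival epochs t_1 < t_2 < ... and the marks B_1, B_2, ... are indexed
   from 0: tau n is t_(n+1) and mk n is B_(n+1). *)
Definition arrivals (T : Type) (R : realType) (tau : nat -> T -> R)
    (t : R) (w : T) : nat :=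
  count [set n | tau n w <= t].

Definition intensity (T : Type) (R : realType) (lam r : R)
    (tau mk : nat -> T -> R) (t : R) (w : T) : R :=
  lam + \sum_(n \in [set n | tau n w < t]) mk n w * expR (- r * (t - tau n w)).

Definition customers (T : Type) (R : realType) (tau srv : nat -> T -> R)
    (t : R) (w : T) : nat :=
  count [set n | tau n w <= t < tau n w + srv n w].

(* Internal history F(t) of the marked point process: the arrivals up to time t
   together with their marks. *)
Definition history (T : Type) (R : realType) (tau mk : nat -> T -> R) (t : R) :
    set (set T) :=
  <<s [set A | exists n s (C : set R), [/\ s <= t, measurable C
         & A = [set w | tau n w <= s /\ C (mk n w)]]] >>.

Record markovian_hawkes d (T : measurableType d) (R : realType)
    (P : probability T R) (lam r : R) (B : {RV P >-> R})
    (tau mk : nat -> {RV P >-> R}) : Prop := MarkovianHawkes {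
  epochs_pos : forall w, 0 < tau 0%N w ;
  epochs_increasing : forall n w, tau n w < tau n.+1 w ;
  epochs_unbounded : forall w t, exists n, t < tau n w ;
  marks_law : forall (n : nat) (C : set R), measurable C ->
    distribution P (mk n) C = distribution P B C ;
  (* Independence of the marks among themselves is included. *)
  marks_independent : forall n,
    independent_of P (mk n)
      (sigma_of ([set (tau k : T -> R) | k in `I_n.+1] `|`
                 [set (mk k : T -> R) | k in `I_n])) ;
  one_arrival : forall t, 0 <= t ->
    cond_prob_expansion P (history tau mk t)
      (fun h => [set w | (arrivals tau (t + h) w - arrivals tau t w = 1)%N])
      (fun h w => intensity lam r tau mk t w * h) ;
  more_arrivals : forall t, 0 <= t ->
    cond_prob_expansion P (history tau mk t)
      (fun h => [set w | (1 < arrivals tau (t + h) w - arrivals tau t w)%N])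
      (fun _ _ => 0) ;
  no_arrival : forall t, 0 <= t ->
    cond_prob_expansion P (history tau mk t)
      (fun h => [set w | (arrivals tau (t + h) w - arrivals tau t w = 0)%N])
      (fun h w => 1 - intensity lam r tau mk t w * h)
}.

Record hawkes_infinite_server d (T : measurableType d) (R : realType)
    (P : probability T R) (lam r mu : R) (B : {RV P >-> R})
    (tau mk srv : nat -> {RV P >-> R}) : Prop := HawkesInfiniteServer {
  hawkes_arrivals : markovian_hawkes lam r B tau mk ;
  services_law : forall (n : nat) (C : set R), measurable C ->
    distribution P (srv n) C = exponential_prob mu C ;
  services_independent : forall n,
    independent_of P (srv n)
      (sigma_of (range (fun k => tau k : T -> R) `|`
                 range (fun k => mk k : T -> R) `|`
                 [set (srv k : T -> R) | k in `I_n]))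
}.

Definition moment_LL (R : realType) (lam r b1 b2 D1 t : R) : R :=
  let r0 := r - b1 in
  lam * r * (b2 + 2 * lam * r) / (2 * r0 ^+ 2)
  - lam * b1 * (b2 + 2 * lam * r) / r0 ^+ 2 * expR (- r0 * t)
  + D1 * expR (- 2 * r0 * t).

(* In moment_LN and moment_NN the exp(- mu t) term has the sign forced by
     d/dt E(Lambda N) = lam r E N + E Lambda^2 + b1 E Lambda - (mu + r0) E(Lambda N),
     d/dt E N^2 = 2 E(Lambda N) + E Lambda + mu E N - 2 mu E N^2,
   in which E N has exp(- mu t) coefficient lam (r - mu) / (mu (mu - r0)).
   The source prints these two terms with a minus sign, which contradicts these
   equations whenever r <> mu. *)
Definition moment_LN (R : realType) (lam r mu b1 b2 D1 D2 t : R) : R :=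
  let r0 := r - b1 in
  lam * r / (r0 * (mu + r0))
    * ((b2 + 2 * lam * r) / (2 * r0) + (lam * r + mu * b1) / mu)
  + lam ^+ 2 * r * (r - mu) / (mu * r0 * (mu - r0)) * expR (- mu * t)
  - lam * b1 / (mu * r0)
    * (b1 + (b2 + 2 * lam * r) / r0 + lam * r / (mu - r0)) * expR (- r0 * t)
  + D1 / (mu - r0) * expR (- 2 * r0 * t)
  + D2 * expR (- (mu + r0) * t).

Definition moment_NN (R : realType) (lam r mu b1 b2 D1 D2 D3 t : R) : R :=
  let r0 := r - b1 in
  lam * r / (mu * r0 * (mu + r0))
    * ((b2 + 2 * lam * r) / (2 * r0) + (mu * (mu + r) + lam * r) / mu)
  + lam * (r - mu) * (mu * r0 + 2 * lam * r) / (mu ^+ 2 * r0 * (mu - r0))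
    * expR (- mu * t)
  - 2 * lam * b1 / (mu * r0 * (2 * mu - r0))
    * (b1 + (b2 + 2 * lam * r) / r0 + lam * r / (mu - r0)
       + mu / 2 * ((2 * mu - r0) / (mu - r0))) * expR (- r0 * t)
  + D1 / (mu - r0) ^+ 2 * expR (- 2 * r0 * t)
  + 2 * D2 / (mu - r0) * expR (- (mu + r0) * t)
  + D3 * expR (- 2 * mu * t).

(* Main.v *)
(* With A the event that the n-th epoch is at the fixed time t, the expansions
   at t and at times u > t near t measure the same small probability, that of a
   further epoch just after t: by the intensity at t, which ignores the mark of
   that epoch, and by the limit of the intensity from the right, which counts it.
   Hence the positive mark has integral 0 over A, and A is null.  Comparing the
   right derivatives of two functions of time then turns the expansions into the
   compensator identity E(H; tau_n < t) = int_0^t E(H rate_n(u)) du for H known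
   from the first n epochs and marks.

   The noise of the intensity and the sums of exp(- c (t - tau_n)) over past
   epochs are shot noises.  Adding the arrivals one at a time, the compensator
   identity yields a closed system of linear Volterra equations for the second
   moments of shot noises.  They grow at most exponentially, by comparison with
   a shot noise without decay, so the equations have unique solutions.

   Given arrivals and marks, the customers are still present independently with
   probabilities p_n = exp(- mu (t - tau_n)).  Hence E(Lambda N) = E(Lambda K)
   and E N^2 + E K' = E K^2 + E K, where K = sum p_n and K' = sum p_n^2 are the
   shot noises with decay rates mu and 2 mu. *)
Require Import Defs.
From HB Require Import structures.
From mathcomp Require Import all_boot all_order all_algebra finmap.
From mathcomp Require Import all_classical all_reals all_analysis.
From mathcomp Require Import measurable_realfun ring lra.

Set Implicit Arguments.
Unset Strict Implicit.
Unset Printing Implicit Defensive.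

Import Order.TTheory GRing.Theory Num.Theory.
Import numFieldNormedType.Exports.
Local Open Scope classical_set_scope.
Local Open Scope ring_scope.

(** * Comparison and independence lemmas *)

(** The expansions hold at each fixed time, with a remainder that is not uniform in time, and they
    look forward only. The law of an epoch thus gets right derivatives and nothing more, so the
    comparison lemmas combine a right derivative with one-sided control on the left. The absence of
    atoms supplies this left control for the compensator; it also makes the mean rate continuous in
    time and lets strict and weak inequalities between epochs and a fixed time be exchanged.

    An expansion given F(t) can be integrated only over events of F(t). An event determined by the
    first n epochs and marks becomes one when cut down to the paths with exactly n epochs up to t;
    this is why the argument runs epoch by epoch.

    No second moment is known to be finite at the outset. The product identities are therefore
    proved between nonnegative extended integrals for the first n epochs and passed to the limit
    monotonically; only then does a dominating noise make the moments real functions, to which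
    uniqueness for linear equations applies. *)

Lemma dini_le (R : realType) (D : R -> R) (a b : R) : a <= b ->
  (forall x, a < x <= b -> forall e : R, 0 < e ->
     exists2 dl, 0 < dl & forall y, x - dl < y < x -> a <= y -> D y <= D x + e) ->
  (forall x, a <= x < b -> forall e : R, 0 < e ->
     exists2 dl, 0 < dl & forall y, x < y < x + dl -> D x <= D y + e * (y - x)) ->
  D a <= D b.
Proof.
move=> ab Dl Dr; apply/ler_addgt0Pr => e0 e0_gt0.
have [->|neab] := eqVneq a b; first by rewrite lerDl ltW.
have ltab : a < b by rewrite lt_neqAle neab.
pose e := e0 / (b - a).
have e_gt0 : 0 < e by rewrite divr_gt0// subr_gt0.
suff : D a <= D b + e * (b - a) by rewrite /e divfK// gt_eqF// subr_gt0.
(* S collects the points up to which the defect stays below slope e. Its supremum belongs to S by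
   the left condition; if it were less than b, the right condition would extend S past it. *)
pose S := [set x | a <= x <= b /\ D a <= D x + e * (x - a)].
have Sa : S a by rewrite /S/= lexx ab subrr mulr0 addr0.
have supS : has_sup S by split; [exists a|exists b => x [/andP[]]].
set s := sup S.
have as_ : a <= s by apply: ub_le_sup => //; case: supS.
have sb : s <= b by apply: ge_sup; [exists a|move=> x [/andP[]]].
have Ss : S s.
  split; first by rewrite as_.
  have [<-|nas] := eqVneq a s; first by rewrite subrr mulr0 addr0.
  have las : a < s by rewrite lt_neqAle nas.
  apply/ler_addgt0Pr => eta eta0.
  have [|dl dl0 H] := Dl s _ _ eta0; first by rewrite las.
  have [x Sx xs] := sup_adherent dl0 supS.
  have xles : x <= s by apply: ub_le_sup => //; case: supS.
  case: Sx => /andP[ax xb] Dx.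
  have [eqxs|nxs] := eqVneq x s; first by rewrite -eqxs (le_trans Dx)// lerDl ltW.
  apply: (le_trans Dx).
  have := H x; rewrite xs lt_neqAle nxs xles/= => /(_ isT ax) Dxs.
  have : e * (x - a) <= e * (s - a) by rewrite ler_pM2l// lerD2r.
  lra.
have [<-|nsb] := eqVneq s b; first by case: Ss.
have lsb : s < b by rewrite lt_neqAle nsb.
have [|dl dl0 H] := Dr s _ _ e_gt0; first by rewrite as_.
pose y := Num.min b (s + dl / 2).
have sy : s < y by rewrite lt_min lsb ltrDl divr_gt0.
have yb : y <= b by rewrite ge_min lexx.
have ysd : y < s + dl by rewrite gt_min ltrD2l ltr_pdivrMr// ltr_pMr// ltr1n orbT.
have := H y; rewrite sy ysd => /(_ isT) Dsy.
have Sy : S y.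
  split; first by rewrite yb (le_trans as_ (ltW sy)).
  case: Ss => _ Ds; have -> : e * (y - a) = e * (y - s) + e * (s - a) by ring.
  lra.
have := ub_le_sup (proj2 supS) Sy; rewrite -/s leNgt sy; done.
Qed.

Section comp_unique.
Import HBNNSimple.

(** The images under V1 and V2 of the measures with densities f1 and f2 agree on measurable sets,
    hence on simple functions and, by monotone approximation, on h. *)
Lemma ge0_integral_comp_unique d1 d2 d' (T1 : measurableType d1)
    (T2 : measurableType d2) (S : measurableType d') (R : realType)
    (m1 : {measure set T1 -> \bar R}) (m2 : {measure set T2 -> \bar R})
    (V1 : T1 -> S) (V2 : T2 -> S) (f1 : T1 -> R) (f2 : T2 -> R) :
  measurable_fun setT V1 -> measurable_fun setT V2 ->
  measurable_fun setT f1 -> measurable_fun setT f2 ->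
  (forall x, 0 <= f1 x) -> (forall x, 0 <= f2 x) ->
  (forall C, measurable C ->
     (\int[m1]_(x in V1 @^-1` C) (f1 x)%:E = \int[m2]_(x in V2 @^-1` C) (f2 x)%:E)%E) ->
  forall h : S -> \bar R, measurable_fun setT h -> (forall y, 0 <= h y)%E ->
  (\int[m1]_x (h (V1 x) * (f1 x)%:E) = \int[m2]_x (h (V2 x) * (f2 x)%:E))%E.
Proof.
move=> mV1 mV2 mf1 mf2 f10 f20 f12 h mh h0.
pose g := nnsfun_approx measurableT mh.
have gh (y : S) : (fun n => (g n y)%:E) @ \oo --> h y.
  by apply: (cvg_nnsfun_approx measurableT mh) => // ? _; exact: h0.
have g0 n (y : S) : (0 <= (g n y)%:E)%E by rewrite lee_fin.
have ndg (y : S) n m : (n <= m)%N -> ((g n y)%:E <= (g m y)%:E)%E.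
  by move=> nm; rewrite lee_fin; have /lefP := nd_nnsfun_approx measurableT mh nm; exact.
have gen d0 (T0 : measurableType d0) (m0 : {measure set T0 -> \bar R}) (V : T0 -> S)
    (f : T0 -> R) : measurable_fun setT V -> measurable_fun setT f ->
    (forall x, 0 <= f x) ->
    (\int[m0]_x (h (V x) * (f x)%:E) = limn (fun n => \int[m0]_x ((g n (V x))%:E * (f x)%:E)))%E /\
    forall n, (\int[m0]_x ((g n (V x))%:E * (f x)%:E) =
      \sum_(y \in range (g n)) (y%:E * \int[m0]_(x in V @^-1` (g n @^-1` [set y])) (f x)%:E))%E.
  move=> mV mf f0.
  have mgn n : measurable_fun setT (fun x => (g n (V x))%:E).
    by apply/measurable_EFinP; apply: measurableT_comp.
  have mfE : measurable_fun setT (EFin \o f) by exact/measurable_EFinP.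
  split.
    rewrite -monotone_convergence//; last 3 first.
    - by move=> n; exact: emeasurable_funM.
    - by move=> n x _; rewrite mule_ge0// lee_fin.
    - by move=> x _ n m nm; rewrite lee_wpmul2r ?lee_fin// -lee_fin ndg.
    apply: eq_integral => x _; apply/esym/cvg_lim => //.
    by apply: cvgeZr => //; exact: gh.
  move=> n.
  under eq_integral => x _.
    rewrite (fimfunE (g n) (V x)) -fsumEFin// ge0_mule_fsuml; last first.
      by move=> y; exact: nnfun_muleindic_ge0.
    over.
  rewrite /= ge0_integral_fsum//; first last.
  - by move=> y x _; rewrite mule_ge0 ?lee_fin//; exact: nnfun_muleindic_ge0.
  - move=> y; apply: emeasurable_funM => //; apply/measurable_EFinP.
    by apply: measurable_funM => //; apply: measurableT_comp.
  apply: eq_fsbigr => y /set_mem[z _ <-].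
  have mV1' : measurable (V @^-1` (g n @^-1` [set g n z])).
    by rewrite -[X in measurable X]setTI; apply: mV => //; exact: measurable_sfunP.
  rewrite [in RHS]integral_mkcond -ge0_integralZl//; last 2 first.
  - by apply/(measurable_restrictT _ mV1').1; exact: measurable_funTS.
  - by move=> x _; apply: erestrict_ge0 => ? _; rewrite lee_fin.
  apply: eq_integral => x _; rewrite patchE indicE EFinM -muleA.
  rewrite [in RHS](_ : (x \in V @^-1` (g n @^-1` [set g n z])) =
     (V x \in g n @^-1` [set g n z]))//.
  by case: ifPn => _; rewrite ?mul1e ?mul0e.
have [E1 F1] := gen _ _ m1 V1 f1 mV1 mf1 f10.
have [E2 F2] := gen _ _ m2 V2 f2 mV2 mf2 f20.
rewrite E1 E2; congr (limn _); apply/funext => n; rewrite F1 F2.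
by apply: eq_fsbigr => y _; rewrite f12//; exact: measurable_sfunP.
Qed.

End comp_unique.

(** Freezing: independence makes the joint law of X and the identity a product, and Tonelli
    integrates X out with w fixed. *)
Lemma ge0_integral_independent d (T : measurableType d) (R : realType)
    (P : probability T R) (X : {RV P >-> R}) (G : set (set T)) :
  <<s G>> `<=` measurable -> independent_of P X <<s G>> ->
  forall F : R * g_sigma_algebraType G -> \bar R,
    measurable_fun setT F -> (forall z, 0 <= F z)%E ->
  (\int[P]_w F (X w, w) = \int[P]_w \int[distribution P X]_x F (x, w))%E.
Proof.
move=> GT iX F mF F0.
(* The identity into T with the smaller sigma-algebra is the random element that carries all the
   information in G. *)
have mi : measurable_fun setT (idfun : T -> g_sigma_algebraType G).
  by move=> _ Y mY; rewrite setTI; exact: GT.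
pose hi := isMeasurableFun.Build _ _ _ _ (idfun : T -> g_sigma_algebraType G) mi.
pose i : {mfun T >-> g_sigma_algebraType G} := HB.pack (idfun : T -> g_sigma_algebraType G) hi.
have mj : measurable_fun setT (fun w : T => (X w, (w : g_sigma_algebraType G))).
  by apply/measurable_fun_pairP; split => //=.
pose hj := isMeasurableFun.Build _ _ _ _ _ mj.
pose j : {mfun T >-> (R * g_sigma_algebraType G)%type} := HB.pack (fun w : T => (X w, (w : g_sigma_algebraType G))) hj.
have prod C : measurable C ->
    (distribution P X \x distribution P i)%E C = distribution P j C.
  apply: product_measure_unique => A B mA mB.
  rewrite /distribution /pushforward muleC -iX//; congr (P _).
  by apply/seteqP; split => w [].
rewrite -[LHS](@ge0_integral_pushforward _ _ T _ R j _ P setT F)//; last first.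
rewrite (eq_measure_integral (distribution P X \x distribution P i)%E); last first.
  by move=> A mA _; exact/esym/prod.
rewrite (fubini_tonelli2 _ mF)//.
rewrite ge0_integral_pushforward//; first last.
  by move=> w _; apply: integral_ge0.
  exact: measurable_fun_fubini_tonelli_G.
Qed.

(** * Epochs and histories *)

Section epochs.
Context (T : Type) (R : realType) (tau : nat -> T -> R).
Hypothesis tau_incr : forall n w, tau n w < tau n.+1 w.
Hypothesis tau_unbounded : forall w t, exists n, t < tau n w.

Lemma tau_ltW w m n : (m < n)%N -> tau m w < tau n w.
Proof. by apply: (@homo_ltn _ (tau ^~ w) <%R) => [x y z|k]; [exact: lt_trans|exact: tau_incr]. Qed.

Lemma tau_leW w m n : (m <= n)%N -> tau m w <= tau n w.
Proof. by rewrite leq_eqVlt => /predU1P[->//|/(tau_ltW w)/ltW]. Qed.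

Lemma epoch_index t w : exists n, (forall k, (tau k w <= t) = (k < n)%N).
Proof.
have [n tn nmin] := find_ex_minn (tau_unbounded w t).
exists n => k; case: (ltnP k n) => [kn|nk].
  by rewrite leNgt; apply/negP => /nmin; rewrite leqNgt kn.
by apply/negbTE; rewrite -ltNge (lt_le_trans tn)// tau_leW.
Qed.

Lemma epoch_index_strict t w : exists n, (forall k, (tau k w < t) = (k < n)%N).
Proof.
have [n nE] := epoch_index t w.
case: n nE => [|n] nE.
  by exists 0%N => k; rewrite ltn0; apply/negbTE; rewrite -leNgt ltW// ltNge nE.
(* Of the n.+1 epochs up to t only the last one, [tau n w], can equal t. *)
have [tn|tn] := ltP (tau n w) t.
  exists n.+1 => k; case: (ltnP k n.+1) => kn; first by rewrite (le_lt_trans _ tn)// tau_leW.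
  by apply/negbTE; rewrite -leNgt ltW// ltNge nE -leqNgt.
exists n => k; case: (ltnP k n) => kn; first by rewrite (lt_le_trans (tau_ltW w kn))// nE.
by apply/negbTE; rewrite -leNgt (le_trans tn)// tau_leW.
Qed.

Lemma set_index (p : nat -> bool) n : (forall k, p k = (k < n)%N) -> [set k | p k] = `I_n.
Proof. by move=> pn; apply/seteqP; split => k /=; rewrite pn. Qed.

Lemma arrivals_eq n t w : (forall k, (tau k w <= t) = (k < n)%N) -> arrivals tau t w = n.
Proof. by move=> nE; rewrite /arrivals /Defs.count (set_index nE); apply: card_fset_set; exact: card_eqxx. Qed.

Lemma arrivals_gt n t w : (n < arrivals tau t w)%N = (tau n w <= t).
Proof. by have [m mE] := epoch_index t w; rewrite (arrivals_eq mE) mE. Qed.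

Lemma fsum_index (p : nat -> bool) n (F : nat -> R) : (forall k, p k = (k < n)%N) ->
  \sum_(k \in [set k | p k]) F k = \sum_(k < n) F k.
Proof. by move=> /set_index ->; rewrite -fsbig_ord. Qed.

Lemma intensity_eq lam r mk n t w : (forall k, (tau k w < t) = (k < n)%N) ->
  intensity lam r tau mk t w = lam + \sum_(k < n) mk k w * expR (- r * (t - tau k w)).
Proof. by move=> nE; rewrite /intensity (fsum_index _ nE). Qed.

Lemma customers_eq srv n t w : (forall k, (tau k w <= t) = (k < n)%N) ->
  (customers tau srv t w = \sum_(k < n) (t < tau k w + srv k w)%R)%N.
Proof.
move=> nE; rewrite /customers /Defs.count.
pose p k := (t < tau k w + srv k w)%R.
pose A : {fset nat} := [fset k in [seq k <- iota 0 n | p k]]%fset.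
have -> : [set k | tau k w <= t < tau k w + srv k w] = [set` A].
  apply/seteqP; split => k /=; rewrite !inE/= mem_filter mem_iota/= add0n nE;
    by case/andP => ? ?; apply/andP.
rewrite set_fsetK /A card_fseq undup_id ?filter_uniq ?iota_uniq// size_filter.
rewrite -sum1_count big_mkcond/=.
have -> : iota 0 n = index_iota 0 n by rewrite /index_iota subn0.
rewrite big_mkord; apply: eq_bigr => k _; rewrite -/(p k); by case: (p k).
Qed.

(* Holds for exactly one n, the number of epochs before u. *)
Definition upcoming n (u : R) w : bool :=
  (if n is m.+1 then tau m w < u else true) && (u <= tau n w).

Lemma upcomingP n u w : upcoming n u w <-> (forall k, (tau k w < u) = (k < n)%N).
Proof.
split => [/andP[un nu] k|nE].
  case: (ltnP k n) => kn.
    by case: n un nu kn => // n un nu kn; rewrite (le_lt_trans _ un)// tau_leW.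
  by apply/negbTE; rewrite -leNgt (le_trans nu)// tau_leW.
rewrite /upcoming leNgt nE ltnn andbT.
by case: n nE => // n ->.
Qed.

End epochs.

Section indicators.
Context d (T : measurableType d) (R : realType).

Lemma measurable_boolR (D : set T) (b : T -> bool) :
  measurable_fun D b -> measurable_fun D (fun x => (b x)%:R : R).
Proof.
move=> mb; apply: (measurableT_comp (f := fun c : bool => c%:R : R)) => //.
Qed.

Lemma measurable_bool_set (b : T -> bool) :
  measurable_fun setT b -> measurable [set x | b x].
Proof.
move=> mb; rewrite -[X in measurable X]setTI.
rewrite (_ : [set x | b x] = b @^-1` [set true]); last by apply/seteqP; split.
exact: mb.
Qed.

End indicators.

Section history.
Context d (T : measurableType d) (R : realType) (P : probability T R)
  (tau mk : nat -> {RV P >-> R}).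

(** Epochs and marks are counted separately: [early_sets n n] is what precedes the epoch of index n,
    and [early_sets n.+1 n] adds this epoch without its mark, which gives the sigma-algebra that
    [mk n] is independent of. *)
Definition early_sets p q : set (set T) :=
  \bigcup_(X in ([set (tau k : T -> R) | k in `I_p] `|` [set (mk k : T -> R) | k in `I_q]))
    preimage_set_system setT X (@measurable _ R).

Lemma early_sets_measurable p q : <<s early_sets p q >> `<=` measurable.
Proof.
apply: smallest_sub; first exact: sigma_algebra_measurable.
by move=> _ [_ [[k _ <-]|[k _ <-]] [C mC <-]]; rewrite setTI; exact: measurable_funPTI.
Qed.

Lemma early_measurable_fun p q d' (S : measurableType d') (f : T -> S) :
  measurable_fun setT (f : g_sigma_algebraType (early_sets p q) -> S) -> measurable_fun setT f.
Proof. by move=> mf mT Y mY; apply: (@early_sets_measurable p q); exact: mf. Qed.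

Lemma early_measurable_epoch p q k : (k < p)%N ->
  measurable_fun setT (tau k : g_sigma_algebraType (early_sets p q) -> R).
Proof.
move=> kp _ Y mY; apply: sub_sigma_algebra; exists (tau k); first by left; exists k.
by exists Y.
Qed.

Lemma early_measurable_mark p q k : (k < q)%N ->
  measurable_fun setT (mk k : g_sigma_algebraType (early_sets p q) -> R).
Proof.
move=> kq _ Y mY; apply: sub_sigma_algebra; exists (mk k); first by right; exists k.
by exists Y.
Qed.

(** The generator of [history], named so that [g_sigma_algebraType] can turn the history into a
    measurable space. *)
Definition history_sets (t : R) : set (set T) := [set A | exists n s (C : set R),
  [/\ s <= t, measurable C & A = [set w | tau n w <= s /\ C (mk n w)]]].

Lemma history_measurable t : history tau mk t `<=` measurable.
Proof.
apply: smallest_sub; first exact: sigma_algebra_measurable.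
move=> _ [n [s [C [_ mC ->]]]]; apply: measurableI; last exact: measurable_funPTI.
by apply: measurable_bool_set; exact: measurable_fun_ler.
Qed.

(** The events whose trace on [bef] lies in the history form a sigma-algebra, so generators suffice.
    On [bef] the first n epochs are at most t, so their values are observed by time t and their
    marks belong to the history. *)
Lemma history_before n t A : <<s early_sets n n >> A ->
  history tau mk t (A `&` [set w | forall k, (k < n)%N -> tau k w <= t]).
Proof.
set bef := [set w | _].
pose H : measurableType _ := g_sigma_algebraType (history_sets t).
have mtau s k : s <= t -> measurable ([set w | tau k w <= s] : set H).
  move=> st; apply: sub_sigma_algebra; exists k, s, setT; split => //.
  by apply/seteqP; split => w //= [].
have mbef : measurable (bef : set H).
  rewrite (_ : bef = \bigcap_(k in `I_n) [set w | tau k w <= t]); last first.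
    by apply/seteqP; split.
  by apply: bigcap_measurableType => k _; exact: mtau.
suff : <<s early_sets n n >> `<=` [set A | measurable (A `&` bef : set H)] by exact.
apply: smallest_sub.
  split => [|C mC|C mC] /=.
  - by rewrite set0I.
  - rewrite (_ : _ `&` bef = bef `\` (C `&` bef)); first exact: measurableD.
    apply/seteqP; split => w /=; first by move=> [[_ nC] b]; split => // -[].
    by move=> [b nCb]; split => //; split => // Cw; apply: nCb.
  - by rewrite setI_bigcupl; exact: bigcupT_measurable.
move=> _ [_ [[k kn <-]|[k kn <-]] [C mC <-]]; rewrite setTI /=.
  have mf : measurable_fun (bef : set H) (tau k : H -> R).
    apply: (measurability _ (RGenOInfty.measurableE R)) => _ [_ [x ->] <-].
    (* For x up to t the ray from x is the complement of a generator; for x above t it misses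
       [bef]. *)
    have [xt|tx] := leP x t.
      rewrite (_ : _ `&` _ = bef `\` [set w | tau k w <= x]).
        exact: (measurableD mbef (mtau x k xt)).
      apply/seteqP; split => w /= [b]; rewrite in_itv/= andbT => xk; split => //.
        by apply/negP; rewrite -ltNge.
      by rewrite ltNge; apply/negP.

    rewrite (_ : _ `&` _ = set0)//.
    by apply/seteqP; split => w //= [b]; rewrite in_itv/= andbT ltNge (le_trans (b _ kn))// ltW.
  by have := mf mbef _ mC; rewrite setIC.
rewrite (_ : _ `&` bef = [set w | tau k w <= t /\ C (mk k w)] `&` bef).
  apply: measurableI => //; apply: sub_sigma_algebra.
  by exists k, t, C; split.
by apply/seteqP; split => w /= [+ b] => [Cw|[]//]; split => //; split => //; exact: b.
Qed.

End history.

Lemma little_o_bound (R : realType) (F : R -> \bar R) :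
  (fun h => (h^-1)%:E * F h)%E @ 0^'+ --> 0%E -> forall e : R, 0 < e ->
  exists2 dl, 0 < dl & forall h, 0 < h < dl -> (F h <= (e * h)%:E)%E.
Proof.
move=> F0 e e0.
have e0E : (0%E < e%:E :> \bar R)%E by rewrite lte_fin.
have : nbhs (0%E : \bar R) [set y | (y < e%:E)%E].
  by apply: open_nbhs_nbhs; split => //; exact: open_ereal_lt_ereal.
move=> /F0 [dl /= dl0 H]; exists dl => // h /andP[h0 hdl].
have := H h; rewrite /ball_/= sub0r normrN gtr0_norm// => /(_ hdl h0) Hh.
by rewrite EFinM -lee_pdivrMr// muleC ltW.
Qed.

(** * One-step expansion of the law of an epoch *)

Section point_process.
Context d (T : measurableType d) (R : realType) (P : probability T R) (lam r : R)
  (B : {RV P >-> R}) (tau mk : nat -> {RV P >-> R}).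
Hypothesis hawkes : markovian_hawkes lam r B tau mk.

Let tau_incr := epochs_increasing hawkes.
Let tau_unb := epochs_unbounded hawkes.

Lemma intensity_measurable (t : R) : measurable_fun setT (intensity lam r tau mk t).
Proof.
pose G k w : R := (tau k w < t)%R%:R * (mk k w * expR (- r * (t - tau k w))).
pose F n w : R := lam + \sum_(k < n) G k w.
apply: (measurable_fun_cvg (h := F)) => //.
  move=> n; apply: measurable_funD => //; apply: measurable_sum => k.
  apply: measurable_funM; first by apply: measurable_boolR; exact: measurable_fun_ltr.
  apply: measurable_funM => //; apply: measurableT_comp => //.
  by apply: measurable_funM => //; exact: measurable_funB.
move=> w _; have [n nE] := epoch_index_strict tau_incr tau_unb t w.
rewrite (intensity_eq _ _ _ nE); apply: cvg_near_cst; exists n => // m /= nm.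
rewrite /F; congr (_ + _).
rewrite -(big_mkord xpredT (G ^~ w)).
rewrite (big_cat_nat (leq0n n) nm)//= big_mkord [X in _ + X]big_nat_cond [X in _ + X]big1 ?addr0.
  by apply: eq_bigr => k _; rewrite /G nE ltn_ord mul1r.
by move=> k /andP[/andP[nk _] _]; rewrite /G nE ltnNge nk mul0r.
Qed.

(** Extracted from the no-arrival expansion: for one small h the remainder has a finite L^1 norm and
    the conditional probability is integrable, hence so is [1 - L t * h]. *)
Lemma intensity_integrable (t : R) : 0 <= t -> P.-integrable setT (EFin \o intensity lam r tau mk t).
Proof.
move=> t0; have [p pE plim] := no_arrival hawkes t0.
have [dl dl0 H] := little_o_bound plim ltr01.
pose h := dl / 2.
have h0 : 0 < h by rewrite divr_gt0.
have hdl : 0 < h < dl by rewrite h0 /h ltr_pdivrMr// ltr_pMr// ltr1n.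
have [_ ip _] := pE h h0.
have mL := intensity_measurable t.
have mp : measurable_fun setT (p h) by apply/measurable_EFinP; exact: (measurable_int P).
have ipL : P.-integrable setT (EFin \o (fun w => p h w - (1 - intensity lam r tau mk t w * h))).
  apply/integrableP; split.
    apply/measurable_EFinP; apply: measurable_funB => //; apply: measurable_funB => //.
    exact: measurable_funM.
  by apply: le_lt_trans (ltry (1 * h)); have := H h hdl; rewrite expectation.unlock.
have i2 := integrableB measurableT ipL ip.
have i3 := integrableD measurableT i2 (finite_measure_integrable_cst P 1 measurableT).
have i4 := integrableZl measurableT h^-1 i3.
apply: eq_integrable i4 => //= w _.
by rewrite -EFinB -EFinD -EFinM; congr (_%:E); field; rewrite gt_eqF.
Qed.

Local Notation L := (intensity lam r tau mk).

Definition index_is n (t : R) : set T := [set w | forall k, (tau k w <= t) = (k < n)%N].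

Lemma index_isE n t : index_is n t =
  [set w | forall k, (k < n)%N -> tau k w <= t] `&` [set w | t < tau n w].
Proof.
apply/seteqP; split => w /=.
  by move=> nE; split => [k kn|]; rewrite ?ltNge nE// ltnn.
move=> [bn tn] k; case: (ltnP k n) => [/bn ->//|nk].
by apply/negbTE; rewrite -ltNge (lt_le_trans tn)// (tau_leW tau_incr).
Qed.

Lemma history_index n t A : <<s early_sets tau mk n n >> A -> history tau mk t (A `&` index_is n t).
Proof.
move=> GA; rewrite index_isE setIA.
pose H : measurableType _ := g_sigma_algebraType (history_sets tau mk t).
apply: (@measurableI _ H); first exact: history_before.
rewrite (_ : [set w | t < tau n w] = ~` [set w | tau n w <= t]).
  apply: (@measurableC _ H); apply: sub_sigma_algebra; exists n, t, setT; split => //.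
  by apply/seteqP; split => w //= [].
by apply/seteqP; split => w /=; rewrite ltNge => /negP.
Qed.

(** On the paths with exactly n epochs up to t, the event [tau n <= t + h] is the complement of no
    arrival in (t, t + h], so the intensity governs its probability. Every other path with [tau n]
    in (t, t + h] has an earlier epoch there as well, hence two arrivals, and these paths have
    probability o(h). *)
Lemma arrival_step (t : R) n A : 0 <= t -> <<s early_sets tau mk n n >> A ->
  forall e : R, 0 < e -> exists2 dl, 0 < dl & forall h, 0 < h < dl ->
  `|fine (P (A `&` [set w | t < tau n w <= t + h]))
    - h * (\int[P]_(w in A `&` index_is n t) L t w)%R| <= e * h.
Proof.
move=> t0 GA e e0.
have e20 : 0 < e / 2 by rewrite divr_gt0.
have [p0 p0E p0lim] := no_arrival hawkes t0.
have [p2 p2E p2lim] := more_arrivals hawkes t0.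
have [d0 d0_gt0 H0] := little_o_bound p0lim e20.
have [d2 d2_gt0 H2] := little_o_bound p2lim e20.
exists (Num.min d0 d2); first by rewrite lt_min d0_gt0.
move=> h /andP[h0]; rewrite lt_min => /andP[hd0 hd2].
have {}H0 := H0 h; rewrite h0 hd0 in H0; have {}H0 := H0 isT.
have {}H2 := H2 h; rewrite h0 hd2 in H2; have {}H2 := H2 isT.
have [_ ip0 Ep0] := p0E h h0.
have [_ ip2 Ep2] := p2E h h0.
have HA := history_index (t := t) GA.
have mA' : measurable (A `&` index_is n t) by exact: history_measurable HA.
have mA : measurable A by exact: early_sets_measurable GA.
have mset (a : R) k : measurable [set w | a < tau k w].
  by apply: measurable_bool_set; exact: measurable_fun_ltr.
have mset' (a : R) k : measurable [set w | tau k w <= a].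
  by apply: measurable_bool_set; exact: measurable_fun_ler.
have iL := intensity_integrable t0.
have fP (X : set T) : measurable X -> P X \is a fin_num by move=> mX; exact: fin_num_measure.
set S := A `&` index_is n t in HA mA' *.
pose X := S `&` [set w | tau n w <= t + h].
pose E2 := [set w | (1 < arrivals tau (t + h) w - arrivals tau t w)%N].
have agt := arrivals_gt tau_incr tau_unb.
have mX : measurable X by exact: measurableI.
have mE2 : measurable E2.
  rewrite (_ : E2 = \bigcup_k ([set w | t < tau k w] `&` [set w | tau k.+1 w <= t + h])).
    by apply: bigcup_measurable => k _; exact: measurableI.
  apply/seteqP; split => w /=.
    move=> a2; exists (arrivals tau t w) => //=; split.
      by rewrite ltNge -agt ltnn.
    by rewrite -agt; move: a2; rewrite /E2/= ltn_subRL addn1.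
  move=> [k _ /= []]; rewrite ltNge -(agt k t) -leqNgt => ak; rewrite -(agt k.+1) => ka.
  by rewrite /E2/= ltn_subRL addn1 (leq_ltn_trans _ ka).
have EX : fine (P X) = fine (P S) - (\int[P]_(w in S) p0 h w)%R.
  rewrite /Rintegral Ep0//.
  rewrite (_ : S `&` _ = S `&` [set w | t + h < tau n w]); last first.
    apply/seteqP; split => w /= [Sw].
      have an : arrivals tau t w = n by apply: arrivals_eq; case: Sw.
      by move/eqP; rewrite an subn_eq0 leqNgt agt -ltNge.
    have an : arrivals tau t w = n by apply: arrivals_eq; case: Sw.
    by rewrite ltNge -(agt n) -leqNgt => an'; split => //; apply/eqP; rewrite an subn_eq0.
  have -> : P S = (P X + P (S `&` [set w | (t + h < tau n w)%R]))%E.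
    have mS2 : measurable (S `&` [set w | t + h < tau n w]) by exact: measurableI.
    rewrite -measureU//; last first.
      by apply/seteqP; split => w //= [[_ a] [_ b]]; move: a b => /=; rewrite leNgt => /negP.
    congr (P _); apply/seteqP; split => w /=.
      by move=> Sw; have [?|?] := leP (tau n w) (t + h); [left|right].
    by move=> [[]|[]].
  by rewrite fineD ?fP//; [rewrite addrK|exact: measurableI].
pose pl w := p0 h w - (1 - L t w * h).
have iLS : P.-integrable S (EFin \o L t) by exact: integrableS iL.
have ip0S : P.-integrable S (EFin \o p0 h) by exact: integrableS ip0.
have iLhS : P.-integrable S (EFin \o (fun w => h * L t w)).
  by apply: eq_integrable (integrableZl mA' h iLS) => //= w _; rewrite EFinM.
have i1S : P.-integrable S (EFin \o (cst 1)) by exact: finite_measure_integrable_cst.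
have i1pS : P.-integrable S (EFin \o (fun w => 1 - p0 h w)).
  by apply: eq_integrable (integrableB mA' i1S ip0S) => //= w _; rewrite EFinB.
have iplS : P.-integrable S (EFin \o (fun w => 1 - p0 h w - h * L t w)).
  by apply: eq_integrable (integrableB mA' i1pS iLhS) => //= w _; rewrite EFinB.
(* [1 - p0 h] is the conditional probability of an arrival; integrating over an event of the history
   costs at most the L^1 remainder of the expansion. *)
have bX : `|fine (P X) - h * (\int[P]_(w in S) L t w)%R| <= e / 2 * h.
  have -> : fine (P X) - h * (\int[P]_(w in S) L t w)%R =
      (\int[P]_(w in S) (1 - p0 h w - h * L t w))%R.
    rewrite (RintegralB mA' i1pS iLhS) (RintegralB mA' i1S ip0S) RintegralZl//.
    by rewrite Rintegral_cst// mul1r EX.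
  apply: (le_trans (le_normr_Rintegral mA' iplS)).
  rewrite -lee_fin fineK; last first.
    apply: integrable_fin_num => //.
    by have := integrable_abse iplS; apply: eq_integrable.
  apply: le_trans H0; rewrite expectation.unlock.
  rewrite (eq_integral (fun w => (`|p0 h w - (1 - L t w * h)|)%:E)); last first.
    by move=> w _; rewrite -normrN; congr (Num.norm _)%:E; ring.
  apply: ge0_subset_integral => //; apply/measurable_EFinP.
  apply: measurableT_comp => //; apply: measurable_funB.
    by apply/measurable_EFinP; exact: (measurable_int P).
  by apply: measurable_funB => //; apply: measurable_funM => //; exact: intensity_measurable.
have bE2 : fine (P E2) <= e / 2 * h.
  rewrite -lee_fin fineK ?fP//.
  have <- : (\int[P]_(w in setT) (p2 h w)%:E)%E = P E2.
    by rewrite Ep2 ?setTI//; exact: (@measurableT _ (g_sigma_algebraType (history_sets tau mk t))).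
  apply: le_trans H2; rewrite expectation.unlock.
  apply: le_integral => //.
    by have := integrable_abse ip2; apply: eq_integrable => //= w _; rewrite subr0.
  by move=> w _; rewrite lee_fin subr0 ler_norm.
set Y := A `&` _.
have mY : measurable Y.
  apply: measurableI => //; rewrite (_ : mkset _ = [set w | t < tau n w] `&` [set w | tau n w <= t + h]).
    exact: measurableI.
  by apply/seteqP; split => w /=; [case/andP|case=> -> ->].
have XY : fine (P X) <= fine (P Y).
  rewrite fine_le ?fP// le_measure ?inE// => w [[Aw]]; rewrite index_isE => -[_ /= tn] nt.
  by split => //=; rewrite tn.
have YX : fine (P Y) <= fine (P X) + fine (P E2).
  rewrite -fineD ?fP//; apply: (@le_trans _ _ (fine (P (X `|` E2)))).
    rewrite fine_le ?fP//; first exact: measurableU.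
    rewrite le_measure ?inE//; first exact: measurableU.
    move=> w [Aw /= /andP[tn nt]].
    have [bw|nbw] := pselect (forall k, (k < n)%N -> tau k w <= t).
      by left; split => //; split => //; rewrite index_isE.
    (* An epoch of index k < n after t falls in (t, t + h] together with [tau n]. *)
    right; rewrite /E2 /= ltn_subRL addn1.
    have [k kn tk] : exists2 k, (k < n)%N & t < tau k w.
      apply: contrapT => nk; apply: nbw => k kn; rewrite leNgt; apply/negP => tk.
      by apply: nk; exists k.
    have : (n < arrivals tau (t + h) w)%N by rewrite agt.
    apply: leq_trans; rewrite ltnS; apply: leq_trans kn.
    by rewrite ltnS leqNgt agt -ltNge.
  rewrite fine_le ?fP//; [exact: measurableU|by rewrite fin_numD ?fP|].
  exact: measureU2.
move: bX; rewrite !ler_norml => /andP[b1 b2].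
apply/andP; split; lra.
Qed.

End point_process.

(** * No epoch at a fixed time *)

Section marks.
Context d (T : measurableType d) (R : realType) (P : probability T R) (lam r : R)
  (B : {RV P >-> R}) (tau mk : nat -> {RV P >-> R}) (b1 : R).
Hypotheses (lam_gt0 : 0 < lam) (r_gt0 : 0 < r).
Hypothesis hawkes : markovian_hawkes lam r B tau mk.
Hypothesis B_pos : P [set w | 0 < B w] = 1%E.
Hypothesis b1E : ('E_P[B] = b1%:E)%E.

Local Notation L := (intensity lam r tau mk).

(* B and the marks are positive only almost surely; their positive parts give
   processes that are nonnegative everywhere. *)
Definition pos_mark k w : R := Num.max 0 (mk k w).

Lemma pos_mark_ge0 k w : 0 <= pos_mark k w. Proof. by rewrite le_max lexx. Qed.

Lemma mark_integral k (f : R -> \bar R) : measurable_fun setT f -> (forall x, 0 <= f x)%E ->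
  (\int[P]_w f (mk k w) = \int[P]_w f (B w))%E.
Proof.
move=> mf f0; rewrite -(ge0_integral_distribution (mk k) mf f0).
rewrite -(ge0_integral_distribution B mf f0).
by apply: eq_measure_integral => C mC _; exact: (marks_law hawkes).
Qed.

Lemma ae_pos (X : {RV P >-> R}) : P [set w | 0 < X w] = 1%E -> {ae P, forall w, 0 < X w}.
Proof.
move=> X1.
have mX : measurable [set w | 0 < X w] by apply: measurable_bool_set; exact: measurable_fun_ltr.
exists (~` [set w | 0 < X w]); split; first exact: measurableC.
  by rewrite probability_setC// X1 subee.
by move=> w /= /negP; rewrite -leNgt => ?; apply/negP; rewrite -leNgt.
Qed.

Lemma ae_mark_pos : {ae P, forall w k, 0 < mk k w}.
Proof.
apply/ae_foralln => k; apply: ae_pos.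
have mC : measurable (`]0, +oo[%classic : set R) by exact: measurable_itv.
have := marks_law hawkes k mC; rewrite /distribution /pushforward.
have E (X : T -> R) : X @^-1` `]0, +oo[ = [set w | 0 < X w].
  by apply/seteqP; split => w /=; rewrite in_itv/= andbT.
by rewrite !E B_pos.
Qed.

Lemma pos_part_integral : (\int[P]_w (Num.max 0 (B w))%:E = b1%:E)%E.
Proof.
rewrite -b1E expectation.unlock; apply: ae_eq_integral => //.
- by apply/measurable_EFinP; apply: measurable_maxr.
- exact/measurable_EFinP.
- have := ae_pos B_pos; apply: filterS => w B0 _.
  by rewrite max_r// ltW.
Qed.

Lemma pos_mark_measurable k : measurable_fun setT (pos_mark k).
Proof. exact: measurable_maxr. Qed.

Lemma pos_mark_integral k : (\int[P]_w (pos_mark k w)%:E = b1%:E)%E.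
Proof.
rewrite -pos_part_integral (mark_integral k (f := fun x => (Num.max 0 x)%:E))//.
  by apply/measurable_EFinP; exact: measurable_maxr.
by move=> x; rewrite lee_fin le_max lexx.
Qed.

Lemma pos_mark_integrable k : P.-integrable setT (EFin \o pos_mark k).
Proof.
apply/integrableP; split; first by apply/measurable_EFinP; exact: pos_mark_measurable.
under eq_integral do rewrite /= ger0_norm ?pos_mark_ge0//.
by rewrite pos_mark_integral ltry.
Qed.

(** The intensity formula with exactly the first n epochs in it, whether or not they are past. It
    agrees almost surely with the intensity when exactly n epochs precede u, and it is known from
    [early_sets n n]. *)
Definition rate_after n (u : R) w : R := lam + \sum_(k < n) pos_mark k w * expR (- r * (u - tau k w)).

Lemma rate_after_ge0 n u w : 0 <= rate_after n u w.
Proof.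
by rewrite /rate_after addr_ge0 ?(ltW lam_gt0)//; apply: sumr_ge0 => k _; rewrite mulr_ge0 ?pos_mark_ge0// expR_ge0.
Qed.

(** Free of u, hence one integrable dominating function for all times. *)
Definition rate_bound n w : R := lam + \sum_(k < n) pos_mark k w.

Lemma rate_bound_integrable n : P.-integrable setT (EFin \o rate_bound n).
Proof.
rewrite (_ : _ \o _ = fun w => (cst lam%:E w + \sum_(k <- enum 'I_n) (pos_mark k w)%:E)%E); last first.
  by apply/funext => w /=; rewrite EFinD sumEFin big_enum.
apply: integrableD => //; first exact: finite_measure_integrable_cst.
by apply: integrable_sum => // k _; exact: pos_mark_integrable.
Qed.

Lemma rate_after_le_bound n u w : (forall k, (k < n)%N -> tau k w <= u) -> rate_after n u w <= rate_bound n w.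
Proof.
move=> nu; rewrite lerD2l; apply: ler_sum => k _; rewrite ler_piMr ?pos_mark_ge0//.
by rewrite -expR0 ler_expR mulNr oppr_le0 mulr_ge0 ?(ltW r_gt0)// subr_ge0 nu.
Qed.

Lemma measurable_rate_after_comp d' (S : measurableType d') n (u : S -> R) (f : S -> T) :
  measurable_fun setT u ->
  (forall k, (k < n)%N -> measurable_fun setT (fun x => tau k (f x))) ->
  (forall k, (k < n)%N -> measurable_fun setT (fun x => mk k (f x))) ->
  measurable_fun setT (fun x => rate_after n (u x) (f x)).
Proof.
move=> mu mt mm; apply: measurable_funD => //; apply: measurable_sum => k.
apply: measurable_funM; first by apply: measurable_maxr => //; exact: mm.
apply: measurableT_comp => //; apply: measurable_funM => //.
by apply: measurable_funB => //; exact: mt.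
Qed.

Lemma intensity_rate_after n u w : (forall k, 0 < mk k w) ->
  (forall k, (tau k w < u) = (k < n)%N) -> L u w = rate_after n u w.
Proof.
move=> m0 nE; rewrite (intensity_eq _ _ _ nE); congr (_ + _).
by apply: eq_bigr => k _; rewrite /pos_mark max_r// ltW.
Qed.

End marks.

Section no_atoms.
Context d (T : measurableType d) (R : realType) (P : probability T R) (lam r : R)
  (B : {RV P >-> R}) (tau mk : nat -> {RV P >-> R}) (b1 : R).
Hypotheses (lam_gt0 : 0 < lam) (r_gt0 : 0 < r).
Hypothesis hawkes : markovian_hawkes lam r B tau mk.
Hypothesis B_pos : P [set w | 0 < B w] = 1%E.
Hypothesis b1E : ('E_P[B] = b1%:E)%E.

Let tau_incr := epochs_increasing hawkes.
Local Notation L := (intensity lam r tau mk).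
Local Notation pos_mark := (pos_mark mk).
Local Notation rate_after := (rate_after lam r tau mk).
Let rate_after_ge0 := rate_after_ge0 r tau mk lam_gt0.
Let rate_after_le_bound := @rate_after_le_bound _ _ _ _ lam r tau mk r_gt0.

Lemma measurable_epoch_in n (x y : R) : measurable [set w | x < tau n w <= y].
Proof.
apply: measurable_bool_set; apply: measurable_and.
  exact: measurable_fun_ltr.
exact: measurable_fun_ler.
Qed.

Lemma epoch_in_add (A : set T) n (a x y : R) : measurable A -> a <= x -> x <= y ->
  fine (P (A `&` [set w | a < tau n w <= y])) =
  fine (P (A `&` [set w | a < tau n w <= x])) + fine (P (A `&` [set w | x < tau n w <= y])).
Proof.
move=> mA ax xy.
have mi (u v : R) : measurable (A `&` [set w | u < tau n w <= v]).
  by apply: measurableI => //; exact: measurable_epoch_in.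
rewrite -fineD ?fin_num_measure// -measureU//.
  congr (fine (P _)); apply/seteqP; split => w /=.
    move=> [Aw /andP[aw wy]]; have [wx|xw] := leP (tau n w) x.
      by left; rewrite aw.
    by right.
  move=> [[Aw /andP[aw wx]]|[Aw /andP[xw wy]]]; split => //.
    by rewrite aw (le_trans wx).
  by rewrite (le_lt_trans ax).
apply/seteqP; split => w //= [[_ /andP[_ wx]] [_ /andP[xw _]]].
by move: wx; rewrite leNgt xw.
Qed.

Lemma rate_after_measurable n (u : R) : measurable_fun setT (rate_after n u).
Proof. by apply: (@measurable_rate_after_comp _ _ _ _ lam r tau mk _ _ n (fun=> u) idfun). Qed.

Lemma rate_after_integrable n (u : R) (A : set T) : measurable A ->
  (forall w, A w -> forall k, (k < n)%N -> tau k w <= u) ->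
  P.-integrable A (EFin \o rate_after n u).
Proof.
move=> mA Au.
have il := rate_bound_integrable hawkes B_pos b1E n.
apply: (le_integrable mA _ _ (integrableS measurableT mA (@subsetT _ A) il)).
  by apply/measurable_EFinP; apply: measurable_funTS; exact: rate_after_measurable.
move=> w Aw; rewrite /= lee_fin !ger0_norm ?rate_after_ge0//; first exact: (rate_after_le_bound (Au _ Aw)).
by rewrite (le_trans (rate_after_ge0 n u w))// (rate_after_le_bound (Au _ Aw)).
Qed.

Lemma epoch_atom n (t : R) : P [set w | tau n w = t] = 0%E.
Proof.
set A := [set w | tau n w = t].
have [t0|t0] := leP t 0.
  rewrite (_ : A = set0) ?measure0//; apply/seteqP; split => w //= wt.
  have := epochs_pos hawkes w; rewrite ltNge (le_trans _ t0)// -wt.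
  exact: (tau_leW tau_incr).
have t0' := ltW t0.
have GA : <<s early_sets tau mk n.+1 n.+1 >> A.
  pose G := g_sigma_algebraType (early_sets tau mk n.+1 n.+1).
  have := @early_measurable_epoch _ T _ _ tau mk n.+1 n.+1 n (ltnSn n) measurableT [set t] (measurable_set1 t).
  by rewrite setTI.
have mA : measurable A := early_sets_measurable GA.
have Alt w : A w -> forall k, (k < n)%N -> tau k w < t.
  by move=> <- k kn; exact: (tau_ltW tau_incr).
have Ale w : A w -> forall k, (k < n.+1)%N -> tau k w <= t.
  by move=> <- k kn; exact: (tau_leW tau_incr).
have Agt w : A w -> t < tau n.+1 w by move=> <-; exact: tau_incr.
have Aidx : A `&` index_is tau n.+1 t = A.
  apply/seteqP; split => w; first by case.
  by move=> Aw; split => //; rewrite (index_isE hawkes); split => /=; [exact: Ale|exact: Agt].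
have aem := ae_mark_pos hawkes B_pos.
(* The strict inequality in [intensity] leaves out an epoch at t itself, so on A only the first n
   marks enter. *)
pose q := (\int[P]_(w in A) L t w)%R.
have qE : q = (\int[P]_(w in A) rate_after n t w)%R.
  congr fine; apply: ae_eq_integral => //.
  - by apply/measurable_EFinP; apply: measurable_funTS; exact: (intensity_measurable hawkes).
  - by apply/measurable_EFinP; apply: measurable_funTS; exact: rate_after_measurable.
  apply: filterS aem => w m0 Aw; congr _%:E; apply: intensity_rate_after => // k.
  case: (ltnP k n) => kn; first exact: Alt.
  by apply/negbTE; rewrite -leNgt -(Aw : tau n w = t) (tau_leW tau_incr).
(* A lower bound on A for the intensity at every u in (t, u0): the rate has decayed by no more than
   the factor exp(- r (u0 - t)), and the indicator removes the paths whose next epoch is not after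
   u0. *)
pose f u0 w := (u0 < tau n.+1 w)%R%:R * (expR (- r * (u0 - t)) * rate_after n.+1 t w).
pose c u0 := (\int[P]_(w in A) f u0 w)%R.
have ilt : P.-integrable A (EFin \o rate_after n.+1 t) by exact: rate_after_integrable.
have mf u0 : measurable_fun setT (f u0).
  apply: measurable_funM; first by apply: measurable_boolR; exact: measurable_fun_ltr.
  by apply: measurable_funM => //; exact: rate_after_measurable.
have f0 u0 w : 0 <= f u0 w by rewrite !mulr_ge0// ?expR_ge0 ?rate_after_ge0.
have fle u0 w : t < u0 -> f u0 w <= rate_after n.+1 t w.
  move=> tu; rewrite /f; case: (u0 < _); last by rewrite mul0r rate_after_ge0.
  rewrite mul1r ler_piMl ?rate_after_ge0// -expR0 ler_expR mulNr oppr_le0.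
  by rewrite mulr_ge0 ?(ltW r_gt0)// subr_ge0 ltW.
have if_ u0 : t < u0 -> P.-integrable A (EFin \o f u0).
  move=> tu; apply: (le_integrable mA _ _ ilt).
    by apply/measurable_EFinP; exact: measurable_funTS.
  by move=> w Aw /=; rewrite lee_fin !ger0_norm ?rate_after_ge0// fle.
pose G u := fine (P (A `&` [set w | t < tau n.+1 w <= u])).
have mG u : measurable (A `&` [set w | t < tau n.+1 w <= u]).
  by apply: measurableI => //; exact: measurable_epoch_in.
have G0 u : 0 <= G u by rewrite fine_ge0.
have cq u0 : t < u0 -> c u0 <= q.
  move=> tu0.
  have c0 : 0 <= c u0 by apply: Rintegral_ge0.
  have key u : t < u < u0 -> c u0 <= (\int[P]_(w in A `&` index_is tau n.+1 u) L u w)%R.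
    move=> /andP[tu uu0].
    have mI : measurable (A `&` index_is tau n.+1 u).
      exact: (history_measurable (history_index (t := u) hawkes GA)).
    have -> : (\int[P]_(w in A `&` index_is tau n.+1 u) L u w =
        \int[P]_(w in A `&` index_is tau n.+1 u) rate_after n.+1 u w)%R.
      congr fine; apply: ae_eq_integral => //.
      - by apply/measurable_EFinP; apply: measurable_funTS; exact: (intensity_measurable hawkes).
      - by apply/measurable_EFinP; apply: measurable_funTS; exact: rate_after_measurable.
      apply: filterS aem => w m0 [Aw iw]; congr _%:E; apply: intensity_rate_after => // k.
      case: (ltnP k n.+1) => kn; first exact: le_lt_trans (Ale _ Aw _ kn) tu.
      by apply/negbTE; rewrite -leNgt ltW// ltNge iw -leqNgt.
    have -> : c u0 = (\int[P]_(w in A `&` index_is tau n.+1 u) f u0 w)%R.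
      rewrite Rintegral_mkcondr; apply: eq_Rintegral => w; rewrite inE => Aw.
      rewrite patchE; case: ifPn => //; rewrite notin_setE => nw.
      rewrite /f; case: ltP => uw; last by rewrite mul0r.
      exfalso; apply: nw; rewrite (index_isE hawkes); split => /=; last exact: lt_trans uw.
      by move=> k kn; exact: (le_trans (Ale _ Aw _ kn) (ltW tu)).
    apply: le_Rintegral => //.
    - by apply: integrableS (if_ _ tu0) => //; exact: subIsetl.
    - apply: rate_after_integrable => // w [Aw _] k kn.
      exact: (le_trans (Ale _ Aw _ kn) (ltW tu)).
    move=> w [Aw _]; rewrite /f; case: ltP => uw; last by rewrite mul0r rate_after_ge0.
    rewrite mul1r /rate_after mulrDr lerD//.
      rewrite ler_piMl ?(ltW lam_gt0)// -expR0 ler_expR mulNr oppr_le0.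
      by rewrite mulr_ge0 ?(ltW r_gt0)// subr_ge0 ltW.
    rewrite mulr_sumr; apply: ler_sum => k _; rewrite mulrCA ler_wpM2l ?pos_mark_ge0//.
    rewrite -expRD ler_expR -mulrDr ler_wnM2l ?oppr_le0 ?(ltW r_gt0)//.
    lra.
  (* The start is at t1 > t, where the right derivative of G is at least [c u0]; at t itself the
     expansion has rate q. Monotonicity of G gives the left condition of [dini_le]. *)
  have step2 t1 t2 : t < t1 -> t1 <= t2 -> t2 < u0 -> c u0 * (t2 - t1) <= G t2.
    move=> tt1 t12 t2u0.
    suff : G t1 - c u0 * t1 <= G t2 - c u0 * t2.
      by have := G0 t1; rewrite mulrBr; lra.
    apply: (@dini_le R (fun u => G u - c u0 * u) t1 t2 t12) => [x /andP[t1x xt2] e e0|x /andP[t1x xt2] e e0].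
      exists (e / (c u0 + 1)); first by rewrite divr_gt0// ltr_wpDl.
      move=> y /andP[xy yx] t1y.
      have : G y <= G x.
        have Ey := @epoch_in_add A n.+1 t y x mA (le_trans (ltW tt1) t1y) (ltW yx).
        by rewrite /G Ey lerDl fine_ge0.
      have : c u0 * (x - y) <= e.
        have dx : x - y <= e / (c u0 + 1) by lra.
        apply: (@le_trans _ _ ((c u0 + 1) * (e / (c u0 + 1)))).
          by apply: ler_pM => //; [rewrite subr_ge0 ltW|rewrite lerDl].
        by rewrite mulrC divfK// gt_eqF// ltr_wpDl.
      by rewrite mulrBr; lra.
    have tx : t < x by exact: lt_le_trans t1x.
    have [dl dl0 H] := arrival_step hawkes (le_trans t0' (ltW tx)) GA e0.
    exists dl => // y /andP[xy ydl].
    have Ey := @epoch_in_add A n.+1 t x y mA (ltW tx) (ltW xy).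
    rewrite /G Ey.
    have /H : 0 < y - x < dl by rewrite subr_gt0 xy/= ltrBlDl.
    rewrite subrKC ler_norml => /andP[h1 _].
    have kx := key x; rewrite tx (lt_trans xt2 t2u0) in kx; have {}kx := kx isT.
    have : (y - x) * c u0 <= (y - x) * (\int[P]_(w in A `&` index_is tau n.+1 x) L x w)%R.
      by rewrite ler_wpM2l// subr_ge0 ltW.
    move: h1; set Q := (\int[P]_(w in _) L x w)%R; set I := (y - x) * Q.
    by rewrite mulrBl => *; lra.
  have step3 t2 : t < t2 -> t2 < u0 -> c u0 * (t2 - t) <= G t2.
    move=> tt2 t2u0; apply/ler_addgt0Pr => e e0.
    (* The minimum makes the stretch from t to t1 cost at most e; adding 1 to [c u0] avoids a
       division by 0. *)
    pose t1 := t + Num.min (t2 - t) (e / (c u0 + 1)).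
    have tt1 : t < t1 by rewrite ltrDl lt_min subr_gt0 tt2 divr_gt0// ltr_wpDl.
    have t12 : t1 <= t2 by rewrite /t1 addrC -lerBrDr ge_min lexx.
    have := step2 t1 t2 tt1 t12 t2u0.
    have : c u0 * (t1 - t) <= e.
      apply: (@le_trans _ _ ((c u0 + 1) * (e / (c u0 + 1)))).
        apply: ler_pM => //; [by rewrite subr_ge0 ltW|by rewrite lerDl|].
        by rewrite /t1 addrC addKr ge_min lexx orbT.
      by rewrite mulrC divfK// gt_eqF// ltr_wpDl.
    by rewrite !mulrBr; lra.
  apply/ler_addgt0Pr => e e0.
  (* All of A has exactly n.+1 epochs up to t, so the expansion at t has rate q; compared with
     [step3] over the same interval it yields [c u0 <= q + e]. *)
  have [dl dl0 H] := arrival_step hawkes t0' GA e0.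
  pose h := Num.min dl (u0 - t) / 2.
  have m0 : 0 < Num.min dl (u0 - t) by rewrite lt_min dl0 subr_gt0.
  have h0 : 0 < h by rewrite divr_gt0.
  have hm : h < Num.min dl (u0 - t) by rewrite ltr_pdivrMr// ltr_pMr// ltr1n.
  move: (hm); rewrite lt_min => /andP[hdl hu0].
  have /H : 0 < h < dl by rewrite h0.
  rewrite Aidx -/q -/(G (t + h)) ler_norml => /andP[_ h2].
  have := step3 (t + h); rewrite ltrDl h0 -ltrBrDl hu0 => /(_ isT isT).
  rewrite addrC addKr => h3.
  by rewrite -(ler_pM2r h0) mulrDl; move: h2; rewrite [h * q]mulrC; lra.
(* On A the next epoch is strictly after t, so the indicator in f is eventually 1 as u0 decreases to
   t. *)
have lim_c : c (t + n0.+1%:R^-1) @[n0 --> \oo] --> (\int[P]_(w in A) rate_after n.+1 t w)%R.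
  have hpos m : 0 < m.+1%:R^-1 :> R by rewrite invr_gt0.
  apply: fine_cvg; rewrite /Rintegral fineK; last exact: integrable_fin_num ilt.
  apply: (@dominated_cvg _ T R P A mA (fun m w => (f (t + m.+1%:R^-1) w)%:E) _ (EFin \o rate_after n.+1 t)) => //.
  - by move=> m; apply/measurable_EFinP; exact: measurable_funTS.
  - move=> w Aw; apply: cvg_EFin; first exact: nearW.
    have fE : \forall m \near \oo, expR (- r * m.+1%:R^-1) * rate_after n.+1 t w = f (t + m.+1%:R^-1) w.
      have : \forall m \near \oo, m.+1%:R^-1 < tau n.+1 w - t.
        have a0 : 0 < tau n.+1 w - t by rewrite subr_gt0; exact: Agt.
        exact: (cvgr_lt (0 : R) (@cvg_harmonic R) _ a0).
      apply: filterS => m hm; rewrite /f -ltrBDl hm mul1r.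
      by rewrite addrC addKr.
    have c1 : expR (- r * m.+1%:R^-1) @[m --> \oo] --> expR (- r * 0).
      apply: continuous_cvg; first exact: continuous_expR.
      by apply: cvgMl_tmp; exact: (@cvg_harmonic R).
    have := cvgMr_tmp (b := rate_after n.+1 t w) c1.
    rewrite mulr0 expR0 mul1r => h; refine (cvg_trans _ (h _)).
    exact: near_eq_cvg fE.
  - by move=> m w Aw; rewrite /= lee_fin ger0_norm// fle// ltrDl.
have qge : (\int[P]_(w in A) rate_after n.+1 t w)%R <= q.
  apply: (cvgr_to_le lim_c).
  by apply: nearW => k; apply: cq; rewrite ltrDl invr_gt0.
have ipm : P.-integrable A (EFin \o pos_mark n).
  exact: integrableS (pos_mark_integrable hawkes B_pos b1E n).
have pm0 : (\int[P]_(w in A) pos_mark n w)%R <= 0.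
  have iln : P.-integrable A (EFin \o rate_after n t).
    by apply: rate_after_integrable => // w Aw k kn; exact/ltW/Alt.
  (* At time t the epoch of index n contributes its full mark, with factor exp(0). *)
  suff : (\int[P]_(w in A) rate_after n.+1 t w)%R = q + (\int[P]_(w in A) pos_mark n w)%R by lra.
  rewrite qE -RintegralD//; apply: eq_Rintegral => w; rewrite inE => Aw.
  by rewrite /rate_after big_ord_recr/= (Aw : tau n w = t) subrr mulr0 expR0 mulr1 addrA.
have mpm : measurable_fun A (EFin \o pos_mark n).
  by apply/measurable_EFinP; apply: measurable_funTS; exact: pos_mark_measurable.
have : (\int[P]_(w in A) `|(pos_mark n w)%:E| = 0)%E.
  under eq_integral do rewrite gee0_abs ?lee_fin ?pos_mark_ge0//.
  rewrite -(fineK (integrable_fin_num mA ipm)); congr _%:E.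
  by apply/eqP; rewrite eq_le pm0 fine_ge0// integral_ge0// => w _; rewrite lee_fin pos_mark_ge0.
move=> /(ae_eq_integral_abs P mA mpm).1 ae0.
suff : P.-negligible A by move/negligibleP => ->.
have : {ae P, forall w, ~ A w}.
  apply: filterS2 aem ae0 => w m0 a0 Aw; have /= [] := a0 Aw.
  by rewrite /pos_mark max_r ?ltW// => e; have := m0 n; rewrite e ltxx.
by apply: negligibleS => w Aw /(_ Aw).
Qed.

End no_atoms.

(** * The compensator *)

(** [dini_le] for D and for -D. An expansion controls increments to the right, so only right
    derivatives are asked to vanish; left continuity does the rest. *)
Lemma dini_const (R : realType) (D : R -> R) (a b : R) : a <= b ->
  (forall x, a < x <= b -> forall e : R, 0 < e ->
     exists2 dl, 0 < dl & forall y, x - dl < y < x -> a <= y -> `|D y - D x| <= e) ->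
  (forall x, a <= x < b -> forall e : R, 0 < e ->
     exists2 dl, 0 < dl & forall y, x < y < x + dl -> `|D y - D x| <= e * (y - x)) ->
  D a = D b.
Proof.
move=> ab Dl Dr; apply/eqP; rewrite eq_le; apply/andP; split.
  apply: (dini_le ab) => x xab e e0.
    have [dl dl0 H] := Dl x xab e e0; exists dl => // y yx ay.
    by have := H y yx ay; rewrite ler_norml => /andP[]; lra.
  have [dl dl0 H] := Dr x xab e e0; exists dl => // y yx.
  by have := H y yx; rewrite ler_norml => /andP[]; lra.
rewrite -lerN2; apply: (@dini_le R (fun x => - D x) a b ab) => x xab e e0.
  have [dl dl0 H] := Dl x xab e e0; exists dl => // y yx ay.
  by have := H y yx ay; rewrite ler_norml => /andP[]; lra.
have [dl dl0 H] := Dr x xab e e0; exists dl => // y yx.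
by have := H y yx; rewrite ler_norml => /andP[]; lra.
Qed.

Lemma derive_step (R : realType) (f : R -> R) (x : R) : derivable f x 1 ->
  forall e : R, 0 < e -> exists2 dl, 0 < dl & forall y, x < y < x + dl ->
  `|f y - f x - (y - x) * derive1 f x| <= e * (y - x).
Proof.
move=> df e e0.
rewrite derive1E; have /cvgrPdist_le/(_ e e0)[dl /= dl0 H] := df.
exists dl => // y /andP[xy ydl].
have yx0 : 0 < y - x by rewrite subr_gt0.
have := H (y - x); rewrite /ball_/= sub0r normrN gtr0_norm// ltrBlDl => /(_ ydl).
rewrite gt_eqF// => /(_ isT); rewrite /GRing.scale/= mulr1 subrK.
rewrite -/(derive f x 1) -(ler_pM2r yx0) -{2}(gtr0_norm yx0) -normrM mulrBl mulrAC mulVf ?gt_eqF// mul1r.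
by rewrite distrC mulrC.
Qed.

Lemma continuous_step (R : realType) (f : R -> R) (x : R) : {for x, continuous f} ->
  forall e : R, 0 < e -> exists2 dl, 0 < dl & forall y, x - dl < y < x + dl -> `|f y - f x| <= e.
Proof.
move=> /cvgrPdist_le cf e e0; have [dl /= dl0 H] := cf _ e0.
exists dl => // y /andP[h1 h2]; rewrite distrC; apply: H.
by rewrite /ball_/= ltr_norml; apply/andP; split; lra.
Qed.

Section epoch_rates.
Context d (T : measurableType d) (R : realType) (P : probability T R) (lam r : R)
  (B : {RV P >-> R}) (tau mk : nat -> {RV P >-> R}) (b1 : R).
Hypotheses (lam_gt0 : 0 < lam) (r_gt0 : 0 < r).
Hypothesis hawkes : markovian_hawkes lam r B tau mk.
Hypothesis B_pos : P [set w | 0 < B w] = 1%E.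
Hypothesis b1E : ('E_P[B] = b1%:E)%E.

Let tau_incr := epochs_increasing hawkes.
Local Notation rate_after := (rate_after lam r tau mk).
Local Notation rate_bound := (rate_bound lam mk).
Let rate_after_ge0 := rate_after_ge0 r tau mk lam_gt0.
Let rate_after_le_bound := @rate_after_le_bound _ _ _ _ lam r tau mk r_gt0.
Let atom := epoch_atom lam_gt0 r_gt0 hawkes B_pos b1E.

(** Stochastic intensity of the single epoch of index n: it vanishes unless this epoch is the next
    to come. *)
Definition epoch_rate n (u : R) w : R := (upcoming tau n u w)%:R * rate_after n u w.

Lemma epoch_rate_ge0 n u w : 0 <= epoch_rate n u w.
Proof. by rewrite mulr_ge0. Qed.

Lemma upcoming_before n u w k : upcoming tau n u w -> (k < n)%N -> tau k w < u.
Proof. by move=> /(upcomingP tau_incr) ->. Qed.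

Lemma epoch_rate_le n u w : epoch_rate n u w <= rate_bound n w.
Proof.
rewrite /epoch_rate; case: (boolP (upcoming tau n u w)) => uw.
  by rewrite mul1r; apply: rate_after_le_bound => k kn; exact/ltW/(upcoming_before uw).
rewrite mul0r /rate_bound addr_ge0 ?(ltW lam_gt0)//; apply: sumr_ge0 => k _.
exact: pos_mark_ge0.
Qed.

Lemma measurable_upcoming d' (S : measurableType d') n (u : S -> R) (f : S -> T) :
  measurable_fun setT u -> (forall k, measurable_fun setT (fun x => tau k (f x))) ->
  measurable_fun setT (fun x => upcoming tau n (u x) (f x)).
Proof.
move=> mu mt; apply: measurable_and; last by apply: measurable_fun_ler.
by case: n => [|n]; [exact: measurable_cst|apply: measurable_fun_ltr].
Qed.

Lemma joint_measurable_epoch_rate d' (S : measurableType d') n (u : S -> R) (f : S -> T) :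
  measurable_fun setT u -> measurable_fun setT f ->
  measurable_fun setT (fun x => epoch_rate n (u x) (f x)).
Proof.
move=> mu mf; apply: measurable_funM.
  by apply/measurable_boolR/measurable_upcoming => // k; exact: measurableT_comp.
by apply: measurable_rate_after_comp => // k _; exact: measurableT_comp.
Qed.

Lemma epoch_rate_integrable n u (A : set T) : measurable A -> P.-integrable A (EFin \o epoch_rate n u).
Proof.
move=> mA.
have il := rate_bound_integrable hawkes B_pos b1E n.
apply: (le_integrable mA _ _ (integrableS measurableT mA (@subsetT _ A) il)).
  apply/measurable_EFinP; apply: measurable_funTS.
  exact: (joint_measurable_epoch_rate n (measurable_cst u) (@measurable_id _ T setT)).
move=> w Aw; rewrite /= lee_fin !ger0_norm ?epoch_rate_ge0// ?epoch_rate_le//.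
exact: le_trans (epoch_rate_ge0 n u w) (epoch_rate_le n u w).
Qed.

Lemma rate_after_continuous n w : continuous (rate_after n ^~ w).
Proof.
move=> u; apply: cvgD; first exact: cvg_cst.
apply: cvg_big => [|k _]; first exact: add_continuous.
apply: cvgMl_tmp; apply: continuous_cvg; first exact: continuous_expR.
by apply: cvgMl_tmp; apply: cvgB; [exact: cvg_id|exact: cvg_cst].
Qed.

(** An epoch different from u stays on the same side of all nearby times, so [upcoming] is locally
    constant. *)
Lemma epoch_rate_continuous n u w : (forall k, tau k w != u) -> {for u, continuous (epoch_rate n ^~ w)}.
Proof.
move=> ntau.
have : \forall v \near u, upcoming tau n v w = upcoming tau n u w.
  have H k : \forall v \near u, (tau k w < v) = (tau k w < u).
    have := ntau k; rewrite neq_lt => /orP[ku|uk].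
      by near=> v; rewrite ku; near: v; exact: lt_nbhsr.
    have : \forall v \near u, v < tau k w by exact: lt_nbhsl.
    by apply: filterS => v vk; rewrite (lt_gtF vk) (lt_gtF uk).
  have H' k : \forall v \near u, (v <= tau k w) = (u <= tau k w).
    by apply: filterS (H k) => v; rewrite ![(_ <= tau k w)]leNgt => ->.
  rewrite /upcoming; case: n => [|n]; first by apply: filterS (H' 0%N) => v ->.
  by apply: filterS2 (H n) (H' n.+1) => v -> ->.
move=> J; have JE : \forall v \near u, (upcoming tau n u w)%:R * rate_after n v w = epoch_rate n v w.
  by apply: filterS J => v Jv; rewrite /epoch_rate Jv.
have c1 : (upcoming tau n u w)%:R * rate_after n v w @[v --> u] --> epoch_rate n u w.
  by apply: cvgMl_tmp; exact: rate_after_continuous.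
by refine (cvg_trans _ c1); exact: near_eq_cvg JE.
Unshelve. all: by end_near. Qed.

Definition epoch_rate_on n (A : set T) (u : R) : R := (\int[P]_(w in A) epoch_rate n u w)%R.

Lemma ae_not_epoch u : {ae P, forall w k, tau k w != u}.
Proof.
apply/ae_foralln => k; exists [set w | tau k w = u]; split => //.
  rewrite -[X in measurable X]setTI.
  by have := @measurable_funPT _ _ _ _ (tau k) measurableT [set u] (measurable_set1 u).
  exact: atom.
by move=> w /= /negP; rewrite negbK => /eqP.
Qed.

(** Dominated convergence: paths can jump only at epochs, and almost surely none is at u by
    [epoch_atom]. *)
Lemma epoch_rate_on_continuous n A : measurable A -> continuous (epoch_rate_on n A).
Proof.
move=> mA u; apply/(@cvg_nbhsP _ R^o) => v vu.
have il := rate_bound_integrable hawkes B_pos b1E n.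
have mhz x : measurable_fun A (EFin \o epoch_rate n x).
  apply/measurable_EFinP; apply: measurable_funTS.
  exact: (joint_measurable_epoch_rate n (measurable_cst x) (@measurable_id _ T setT)).
have h1 : {ae P, forall w, A w -> (epoch_rate n (v m) w)%:E @[m --> \oo] --> (epoch_rate n u w)%:E}.
  have := ae_not_epoch u; apply: filterS => w nw _; apply: cvg_EFin; first exact: nearW.
  by have /(@cvg_nbhsP _ R^o) := @epoch_rate_continuous n u w nw; exact.
have h2 : {ae P, forall w m, A w -> (`|(epoch_rate n (v m) w)%:E| <= (EFin \o rate_bound n) w)%E}.
  by apply: aeW => w m _; rewrite /= lee_fin ger0_norm ?epoch_rate_ge0// epoch_rate_le.
have h3 : P.-integrable A (EFin \o rate_bound n) by exact: integrableS il.
apply: fine_cvg; rewrite /epoch_rate_on /Rintegral fineK; last exact: integrable_fin_num (epoch_rate_integrable n u mA).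
by have [] := @dominated_convergence _ T R P A mA (fun m w => (epoch_rate n (v m) w)%:E)
  (fun w => (epoch_rate n u w)%:E) (EFin \o rate_bound n) (fun m => mhz (v m)) (mhz u) h1 h3 h2.
Qed.

End epoch_rates.

Section hazard.
Context d (T : measurableType d) (R : realType) (P : probability T R) (lam r : R)
  (B : {RV P >-> R}) (tau mk : nat -> {RV P >-> R}) (b1 : R).
Hypotheses (lam_gt0 : 0 < lam) (r_gt0 : 0 < r).
Hypothesis hawkes : markovian_hawkes lam r B tau mk.
Hypothesis B_pos : P [set w | 0 < B w] = 1%E.
Hypothesis b1E : ('E_P[B] = b1%:E)%E.

Let tau_incr := epochs_increasing hawkes.
Local Notation L := (intensity lam r tau mk).
Local Notation epoch_rate := (epoch_rate lam r tau mk).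
Local Notation epoch_rate_on := (epoch_rate_on lam r tau mk).
Let epoch_rate_ge0 := epoch_rate_ge0 r tau mk lam_gt0.
Let atom := epoch_atom lam_gt0 r_gt0 hawkes B_pos b1E.
Let ae_not_epoch := ae_not_epoch lam_gt0 r_gt0 hawkes B_pos b1E.
Let epoch_rate_on_continuous := epoch_rate_on_continuous lam_gt0 r_gt0 hawkes B_pos b1E.

Lemma epoch_rate_measurable n u : measurable_fun setT (epoch_rate n u).
Proof. by apply: (@joint_measurable_epoch_rate _ T R P lam r tau mk _ T n (cst u) id). Qed.

(** [index_is] counts epochs with a weak inequality and [upcoming] with a strict one; they differ
    only if an epoch falls at x, a null event. This identifies the rate in [arrival_step]. *)
Lemma index_epoch_rate_on n A (x : R) : <<s early_sets tau mk n n >> A ->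
  (\int[P]_(w in A `&` index_is tau n x) L x w)%R = epoch_rate_on n A x.
Proof.
move=> GA; have mA : measurable A := early_sets_measurable GA.
have mI : measurable (index_is tau n x).
  rewrite (index_isE hawkes); apply: measurableI; last first.
    by apply: measurable_bool_set; exact: measurable_fun_ltr.
  rewrite (_ : mkset _ = \bigcap_(k in `I_n) [set w | tau k w <= x]); last by apply/seteqP; split.
  apply: bigcap_measurableType => k _.
  by apply: measurable_bool_set; exact: measurable_fun_ler.
rewrite Rintegral_mkcondr; congr fine; apply: ae_eq_integral => //.
- apply/measurable_EFinP; apply: measurable_funTS; apply/(measurable_restrictT _ mI).1.
  apply: measurable_funTS; exact: (intensity_measurable hawkes).
- by apply/measurable_EFinP; apply: measurable_funTS; exact: epoch_rate_measurable.
apply: filterS2 (ae_not_epoch x) (ae_mark_pos hawkes B_pos) => w nx m0 Aw; congr _%:E.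
have leE k : (tau k w <= x) = (tau k w < x) by rewrite le_eqVlt (negbTE (nx k)).
rewrite patchE; case: ifPn => [/set_mem iw|].
  have iw' k : (tau k w < x) = (k < n)%N by rewrite -leE iw.
  rewrite /epoch_rate (_ : upcoming _ _ _ _ = true); last exact/(upcomingP tau_incr).
  by rewrite mul1r (intensity_rate_after _ _ m0 iw').
rewrite notin_setE => niw.
rewrite /epoch_rate (_ : upcoming _ _ _ _ = false) ?mul0r//.
by apply/negbTE/negP => /(upcomingP tau_incr) h; apply: niw => k; rewrite leE.
Qed.

(** Continuity from above: the intervals shrink to the point x, which is not an atom. *)
Lemma epoch_left n (x e : R) : 0 < e ->
  exists2 dl, 0 < dl & forall y, x - dl < y -> fine (P [set w | y < tau n w <= x]) <= e.
Proof.
move=> e0.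
pose F m := [set w | x - m.+1%:R^-1 < tau n w <= x].
have mF m : measurable (F m) by exact: measurable_epoch_in.
have hpos m : 0 < m.+1%:R^-1 :> R by rewrite invr_gt0.
have capF : \bigcap_m F m = [set w | tau n w = x].
  apply/seteqP; split => w /=; last first.
    by move=> wx m _; rewrite /F/= wx lexx andbT ltrBlDr ltrDl.
  move=> Fw; apply/eqP; rewrite eq_le; have /andP[_ ->] := Fw 0%N I; rewrite /= leNgt; apply/negP => wx.
  have wx0 : 0 < x - tau n w by rewrite subr_gt0.
  have [m _ /(_ m (leqnn m))] := cvgr_lt (0 : R) (@cvg_harmonic R) _ wx0.
  have /andP[h _] := Fw m I; rewrite /harmonic/= => hm.
  by move: h hm; set a := (m.+1%:R^-1 : R) => h hm; lra.
have cvF : P (F m) @[m --> \oo] --> 0%E.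
  rewrite -(atom n x) -capF; apply: nonincreasing_cvg_mu => //.
  - by rewrite (le_lt_trans (probability_le1 _ _)) ?ltry.
  - exact: bigcapT_measurable.
  move=> m1 m2 m12; apply/subsetPset => w /andP[h1 h2]; rewrite /F/= h2 andbT.
  by apply: le_lt_trans h1; rewrite lerD2l lerN2 lef_pV2 ?posrE// ler_nat.
have ne : nbhs (0%E : \bar R) [set y | (y < e%:E)%E].
  apply: open_nbhs_nbhs; split; first exact: open_ereal_lt_ereal.
  by rewrite /= lte_fin.
have [m _ /(_ m (leqnn m)) /= hm] := cvF _ ne.
exists m.+1%:R^-1 => // y xy.
have my : measurable [set w | y < tau n w <= x] by exact: measurable_epoch_in.
rewrite -lee_fin fineK ?fin_num_measure//; apply: le_trans (ltW hm).
rewrite le_measure ?inE// => w /andP[h1 h2]; rewrite /F/= h2 andbT.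
exact: lt_trans h1.
Qed.

(** The factor exp(c tau_n) is carried along because exp(- c (t - tau_n)) is a multiple of it. For c
    >= 0 it is monotone, so an increment of the left side lies between [phi x] and [phi y] times
    P(A, x < tau_n <= y), which [arrival_step] expands; both sides then have the same right
    derivative. *)
Lemma epoch_hazard n A (c t : R) : <<s early_sets tau mk n n >> A -> 0 <= c -> 0 <= t ->
  (\int[P]_(w in A) ((tau n w < t)%R%:R * expR (c * tau n w))%:E =
   \int[lebesgue_measure]_(u in `[0%R, t]) \int[P]_(w in A) (epoch_rate n u w * expR (c * u))%:E)%E.
Proof.
move=> GA c0 t0; have mA : measurable A := early_sets_measurable GA.
pose phi u := expR (c * u).
have phi_mono (x y : R) : x <= y -> phi x <= phi y.
  by move=> xy; rewrite ler_expR ler_wpM2l.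
have phi_cont : continuous phi.
  by move=> x; apply: continuous_cvg; [exact: continuous_expR|apply: cvgMl_tmp; exact: cvg_id].
have mphi : measurable_fun setT (fun w => phi (tau n w)).
  by apply: measurableT_comp => //; exact: continuous_measurable_fun.
pose S x y := A `&` [set w | x < tau n w <= y].
have mS x y : measurable (S x y) by apply: measurableI => //; exact: measurable_epoch_in.
have iphi x y : P.-integrable (S x y) (EFin \o (fun w => phi (tau n w))).
  apply: (le_integrable (mS x y) _ _ (finite_measure_integrable_cst P (phi y) (mS x y))).
    by apply/measurable_EFinP; exact: measurable_funTS.
  move=> w [Aw /= /andP[_ wy]]; rewrite lee_fin !ger0_norm ?expR_ge0//.
  exact: phi_mono.
pose G x := (\int[P]_(w in S 0 x) phi (tau n w))%R.
pose I x y := (\int[P]_(w in S x y) phi (tau n w))%R.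
have Gdiff (x y : R) : 0 <= x -> x <= y -> G y = G x + I x y.
  move=> x0 xy; rewrite /G /I (_ : S 0 y = S 0 x `|` S x y); last first.
    apply/seteqP; split => w /=.
      move=> [Aw /andP[w0 wy]]; have [wx|xw] := leP (tau n w) x; [left|right]; split => //=; first by rewrite w0.
      by rewrite xw.
    move=> [[Aw /andP[w0 wx]]|[Aw /andP[xw wy]]]; split => //=.
      by rewrite w0 (le_trans wx).
    by rewrite wy (le_lt_trans x0).
  have dS : [disjoint S 0 x & S x y].
    apply/disj_setPS => w [[_ /= /andP[_ wx]] [_ /= /andP[xw _]]].
    by move: wx; rewrite leNgt xw.
  rewrite Rintegral_setU//.
  have -> : S 0 x `|` S x y = S 0 y.
    apply/seteqP; split => w /=.
      move=> [[Aw /andP[w0 wx]]|[Aw /andP[xw wy]]]; split => //=.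
        by rewrite w0 (le_trans wx).
      by rewrite wy (le_lt_trans x0).
    move=> [Aw /andP[w0 wy]]; have [wx|xw] := leP (tau n w) x; [left|right]; split => //=; first by rewrite w0.
    by rewrite xw.
  exact: iphi.
have Ilo x y : phi x * fine (P (S x y)) <= I x y.
  rewrite -Rintegral_cst//; apply: le_Rintegral => //; first exact: finite_measure_integrable_cst.
  by move=> w [Aw /= /andP[xw _]]; apply: phi_mono; exact: ltW.
have Ihi x y : I x y <= phi y * fine (P (S x y)).
  rewrite -Rintegral_cst//; apply: le_Rintegral => //; first exact: finite_measure_integrable_cst.
  by move=> w [Aw /= /andP[_ wy]]; apply: phi_mono.
pose k u := phi u * epoch_rate_on n A u.
have kcont : continuous k.
  by move=> x; apply: cvgM; [exact: phi_cont|exact: epoch_rate_on_continuous].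
(* Starting at -1 makes every x >= 0 an interior point, where psi has derivative [k x]. *)
pose psi (x : R) := (\int[lebesgue_measure]_(u in `[(-1)%R, x]) k u)%R.
have ik x y : lebesgue_measure.-integrable `[x, y] (EFin \o k).
  apply: continuous_compact_integrable; first exact: segment_compact.
  exact: continuous_subspaceT.
have psider (x : R) : -1 < x -> derivable psi x 1 /\ derive1 psi x = k x.
  move=> x1; apply: (@continuous_FTC1_closed _ k (-1) x (x + 1)) => //; first by rewrite ltrDl.
  exact: kcont.
have Deq : G 0 - psi 0 = G t - psi t.
  apply: (@dini_const R (fun x => G x - psi x) 0 t t0) => [x /andP[x0 xt]|x /andP[x0 xt]] e e0.
    have e20 : 0 < e / 2 by rewrite divr_gt0.
    have cpsi : {for x, continuous psi}.
      apply: differentiable_continuous; apply/derivable1_diffP.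
      by have [] := psider x (lt_trans (ltrN10 R) x0).
    have [d1 d10 H1] := continuous_step cpsi e20.
    have ep0 : 0 < e / 2 / phi x by rewrite divr_gt0// expR_gt0.
    have [d2 d20 H2] := epoch_left n x ep0.
    exists (Num.min d1 d2); first by rewrite lt_min d10.
    move=> y /andP[]; rewrite ltrBlDl -ltrBlDr lt_min => /andP[xd1 xd2] yx y0.
    have /H1 h1 : x - d1 < y < x + d1 by apply/andP; split; lra.
    have /H2 h2 : x - d2 < y by lra.
    have h3 : fine (P (S y x)) <= e / 2 / phi x.
      apply: le_trans h2; apply: fine_le; rewrite ?fin_num_measure//.
        exact: measurable_epoch_in.
      by rewrite le_measure ?inE//; [exact: measurable_epoch_in|exact: subIsetr].
    have h4 : I y x <= e / 2.
      apply: (le_trans (Ihi y x)).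
      by rewrite mulrC -ler_pdivlMr ?expR_gt0.
    have h5 : 0 <= I y x by apply: Rintegral_ge0 => w _; exact: expR_ge0.
    have := Gdiff y x y0 (ltW yx).
    move: h1; rewrite !ler_norml => /andP[? ?] ->.
    by apply/andP; split; lra.
  (* Of the error [e * (y - x)], half goes to psi, a quarter to the variation of phi and a quarter
     to [arrival_step]. *)
  have e20 : 0 < e / 2 by rewrite divr_gt0.
  have [psid psiE] := psider x (lt_le_trans (ltrN10 R) x0).
  have [d1 d10 H1] := derive_step psid e20.
  rewrite psiE in H1.
  have q0 : 0 <= epoch_rate_on n A x by apply: Rintegral_ge0.
  have ea : 0 < e / 4 / (epoch_rate_on n A x + 1) by rewrite !divr_gt0// ltr_wpDl.
  have [d2 d20 H2] := continuous_step (phi_cont x) ea.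
  (* The bound 1 gives p <= (q + 1) (y - x), which absorbs the variation of phi; the other bound
     leaves e / 4 after multiplication by [phi x]. *)
  have eb : 0 < Num.min 1 (e / 4 / phi x) by rewrite lt_min ltr01 !divr_gt0// expR_gt0.
  have [d3 d30 H3] := arrival_step hawkes x0 GA eb.
  rewrite index_epoch_rate_on// in H3.
  exists (Num.min d1 (Num.min d2 d3)); first by rewrite !lt_min d10 d20.
  move=> y /andP[xy]; rewrite -ltrBlDl !lt_min => /andP[yd1 /andP[yd2 yd3]].
  have yx0 : 0 < y - x by rewrite subr_gt0.
  have /H1 h1 : x < y < x + d1 by rewrite xy -ltrBlDl.
  have /H2 h2 : x - d2 < y < x + d2 by apply/andP; split; lra.
  have /H3 : 0 < y - x < d3 by rewrite yx0.
  rewrite subrKC => h3.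
  have lo := Ilo x y; have hi := Ihi x y.
  rewrite (Gdiff x y x0 (ltW xy)).
  set p := fine (P (S x y)) in h3 lo hi *.
  set q := epoch_rate_on n A x in h1 h3 q0 ea *.
  have p0 : 0 <= p by rewrite fine_ge0.
  have h3a : `|p - (y - x) * q| <= (e / 4 / phi x) * (y - x).
    by apply: (le_trans h3); rewrite ler_pM2r// ge_min lexx orbT.
  have h3b : p <= (q + 1) * (y - x).
    have : `|p - (y - x) * q| <= 1 * (y - x).
      by apply: (le_trans h3); rewrite ler_pM2r// ge_min lexx.
    have -> : (q + 1) * (y - x) = (y - x) * q + (y - x) by ring.
    by rewrite ler_norml mul1r => /andP[_]; lra.
  have h4 : (phi y - phi x) * p <= e / 4 * (y - x).
    apply: (@le_trans _ _ (e / 4 / (q + 1) * ((q + 1) * (y - x)))).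
      apply: ler_pM => //; first by rewrite subr_ge0 phi_mono// ltW.
      by apply: le_trans h2; exact: ler_norm.
    by rewrite mulrA divfK// gt_eqF// ltr_wpDl.
  have h5 : `|phi x * p - (y - x) * k x| <= e / 4 * (y - x).
    have -> : phi x * p - (y - x) * k x = phi x * (p - (y - x) * q) by rewrite /k -/q; ring.
    rewrite normrM gtr0_norm ?expR_gt0//.
    apply: (@le_trans _ _ (phi x * (e / 4 / phi x * (y - x)))).
      by rewrite ler_pM2l ?expR_gt0.
    by rewrite mulrA [phi x * _]mulrC divfK// gt_eqF// expR_gt0.
  have h6 : phi y * p = phi x * p + (phi y - phi x) * p by ring.
  move: h1 h5; rewrite !ler_norml => /andP[? ?] /andP[? ?].
  have e4 : e * (y - x) = e / 2 * (y - x) + e / 4 * (y - x) + e / 4 * (y - x) by field.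
  by apply/andP; split; lra.
have m1 : (-1 : R) < 0 by exact: ltrN10.
have psi0t : psi t - psi 0 = (\int[lebesgue_measure]_(u in `[0%R, t]) k u)%R.
  rewrite /psi (Rintegral_itvB (ik _ _)) ?bnd_simp ?(ltW m1)//.
  by rewrite Rintegral_itv_obnd_cbnd//; apply: integrableS (ik 0 t) => //; exact: subset_itv_oc_cc.
have G00 : G 0 = 0.
  rewrite /G (_ : S 0 0 = set0) ?Rintegral_set0//.
  apply/seteqP; split => w //= [_ /andP[h1 h2]].
  by move: h2; rewrite leNgt h1.
have Gt : G t = (\int[lebesgue_measure]_(u in `[0%R, t]) k u)%R.
  by rewrite -psi0t; move: Deq; rewrite G00; lra.
have mind : measurable_fun setT (fun w => (tau n w < t)%R%:R * expR (c * tau n w) : R).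
  apply: measurable_funM => //.
  by apply: measurable_boolR; exact: measurable_fun_ltr.
have mE : measurable [set w | 0 < tau n w <= t] by exact: measurable_epoch_in.
(* Strict and weak inequality at t agree almost surely, and every epoch is positive. *)
transitivity (\int[P]_(w in S 0%R t) (phi (tau n w))%:E)%E.
  rewrite [RHS]integral_mkcondr; apply: ae_eq_integral => //.
  - by apply/measurable_EFinP; exact: measurable_funTS.
  - apply: measurable_funTS; apply/(measurable_restrictT _ mE).1.
    by apply: measurable_funTS; exact/measurable_EFinP.
  apply: filterS (ae_not_epoch t) => w nt Aw.
  have tau0 : 0 < tau n w by apply: lt_le_trans (epochs_pos hawkes w) _; exact: (tau_leW tau_incr).
  rewrite patchE; case: ifPn => [/set_mem /= /andP[_ wt]|].
    by rewrite lt_neqAle nt wt mul1r.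
  rewrite notin_setE /= tau0/= => /negP wt.
  by rewrite (_ : (tau n w < t) = false) ?mul0r//; apply/negbTE; rewrite -leNgt ltW// ltNge.
rewrite -[LHS]fineK; last exact: integrable_fin_num (iphi 0 t).
rewrite -/(Rintegral P (S 0 t) _) -/(G t) Gt /Rintegral fineK; last exact: integrable_fin_num (ik 0 t).
apply: eq_integral => u _; rewrite /k /epoch_rate_on EFinM /Rintegral fineK; last first.
  exact: integrable_fin_num (epoch_rate_integrable lam_gt0 r_gt0 hawkes B_pos b1E n u mA).
rewrite -ge0_integralZl//.
- by apply: eq_integral => w _; rewrite -EFinM mulrC.
- by apply/measurable_EFinP; apply: measurable_funTS; exact: epoch_rate_measurable.
- by move=> w _; rewrite lee_fin.
- by rewrite lee_fin expR_ge0.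
Qed.

End hazard.

Section compensator.
Context d (T : measurableType d) (R : realType) (P : probability T R) (lam r : R)
  (B : {RV P >-> R}) (tau mk : nat -> {RV P >-> R}) (b1 : R).
Hypotheses (lam_gt0 : 0 < lam) (r_gt0 : 0 < r).
Hypothesis hawkes : markovian_hawkes lam r B tau mk.
Hypothesis B_pos : P [set w | 0 < B w] = 1%E.
Hypothesis b1E : ('E_P[B] = b1%:E)%E.

Local Notation epoch_rate := (epoch_rate lam r tau mk).
Let epoch_rate_ge0 := epoch_rate_ge0 r tau mk lam_gt0.
Local Notation mu := lebesgue_measure.

(** [epoch_hazard] is the case of an indicator H. Each side integrates H against a measure on the
    early sigma-algebra, the second one an image from the product of time and probability space;
    agreement on events extends to nonnegative functions. *)
Lemma compensator n (H : T -> R) (c t : R) : 0 <= c -> 0 <= t -> (forall w, 0 <= H w) ->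
  measurable_fun setT (H : g_sigma_algebraType (early_sets tau mk n n) -> R) ->
  (\int[P]_w (H w * ((tau n w < t)%R%:R * expR (c * tau n w)))%:E =
   \int[mu]_(u in `[0%R, t]) \int[P]_w (H w * (epoch_rate n u w * expR (c * u)))%:E)%E.
Proof.
move=> c0 t0 H0 mH.
have mHT : measurable_fun setT H by exact: early_measurable_fun mH.
pose T2 : measurableType _ := (measurableTypeR R * T)%type.
pose TG := g_sigma_algebraType (early_sets tau mk n n).
pose f1 w : R := (tau n w < t)%R%:R * expR (c * tau n w).
pose f2 (z : T2) : R := \1_(`[0, t]%classic) z.1 * (epoch_rate n z.1 z.2 * expR (c * z.1)).
have mf1 : measurable_fun setT f1.
  apply: measurable_funM; first by apply: measurable_boolR; exact: measurable_fun_ltr.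
  by apply: measurableT_comp => //; exact: measurable_funM.
have m1 : measurable_fun setT (fst : T2 -> R) by exact: measurable_fst.
have mhz2 : measurable_fun setT (fun z : T2 => epoch_rate n z.1 z.2 * expR (c * z.1)).
  apply: measurable_funM; first by apply: joint_measurable_epoch_rate; [exact: measurable_fst|exact: measurable_snd].
  by apply: measurableT_comp => //; exact: measurable_funM.
have mf2 : measurable_fun setT f2.
  by apply: measurable_funM => //; apply: measurableT_comp.
have f10 w : 0 <= f1 w by rewrite mulr_ge0// expR_ge0.
have f20 z : 0 <= f2 z by rewrite mulr_ge0// mulr_ge0 ?expR_ge0.
have mV1 : measurable_fun setT (idfun : T -> TG).
  by move=> _ Y mY; rewrite setTI; exact: early_sets_measurable mY.
have mV2 : measurable_fun setT (snd : T2 -> TG).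
  move=> _ Y mY; rewrite setTI -[X in measurable X]setTI.
  by apply: measurable_snd => //; exact: early_sets_measurable mY.
have split2 (g : T -> R) : (forall w, 0 <= g w) -> measurable_fun setT g ->
  (\int[mu \x P]_z ((g z.2)%:E * (f2 z)%:E) =
    \int[mu]_(u in `[0%R, t]) \int[P]_w (g w * (epoch_rate n u w * expR (c * u)))%:E)%E.
  move=> g0 mg.
  rewrite (@fubini_tonelli1 _ _ _ _ _ mu P (fun z => ((g z.2)%:E * (f2 z)%:E)%E)); first last.
  - by move=> z; rewrite mule_ge0// lee_fin.
  - apply: emeasurable_funM; apply/measurable_EFinP => //.
    by apply: measurableT_comp => //; exact: measurable_snd.
  rewrite [RHS]integral_mkcond; apply: eq_integral => u _.
  rewrite patchE /fubini_F; case: ifPn => ut.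
    by apply: eq_integral => w _; rewrite -EFinM /f2/= indicE ut mul1r.
  by apply: integral0_eq => w _; rewrite -EFinM /f2/= indicE (negbTE ut) mul0r mulr0.
have HC C : measurable (C : set TG) ->
    (\int[P]_(x in idfun @^-1` C) (f1 x)%:E = \int[mu \x P]_(x in snd @^-1` C) (f2 x)%:E)%E.
  move=> mC; have mCT : measurable (C : set T) := early_sets_measurable mC.
  have mI : measurable_fun setT (\1_C : T -> R) by exact: measurable_indic.
  transitivity (\int[mu \x P]_z (((\1_C : T -> R) z.2)%:E * (f2 z)%:E))%E; last first.
    rewrite [RHS]integral_mkcond; apply: eq_integral => z _.
    rewrite patchE indicE; case: ifPn => [/set_mem /= Cz|].
      by rewrite mem_set// mul1e.
    by rewrite notin_setE => /= Cz; rewrite memNset// mul0e.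
  rewrite split2//.
  rewrite preimage_id (epoch_hazard lam_gt0 r_gt0 hawkes B_pos b1E mC c0 t0).
  apply: eq_integral => u _; rewrite integral_mkcond; apply: eq_integral => w _.
  by rewrite patchE indicE; case: ifPn; rewrite ?mul1r ?mul0r.
under eq_integral do rewrite EFinM.
rewrite -(split2 H H0 mHT).
have mHE : measurable_fun setT (EFin \o H : TG -> \bar R) by exact/measurable_EFinP.
have H0E w : (0 <= (EFin \o H) w)%E by rewrite lee_fin.
pose M : {measure set T2 -> \bar R} := (mu \x P)%E.
exact: (@ge0_integral_comp_unique _ _ _ T _ TG R P M _ _ _ _ mV1 mV2 mf1 mf2 f10 f20 HC _ mHE H0E).
Qed.

End compensator.

(** * Shot noise *)

(* [initial] makes the constant 1 and a bound of all the noises shot noises too. *)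
Record shot (R : realType) := Shot {
  weight : R -> R ; rate : R ; initial : R ;
  weight_ge0 : forall x, 0 <= weight x ; weight_measurable : measurable_fun setT weight ;
  rate_ge0 : 0 <= rate ; initial_ge0 : 0 <= initial }.

Section shots.
Context d (T : measurableType d) (R : realType) (P : probability T R) (lam r : R)
  (B : {RV P >-> R}) (tau mk : nat -> {RV P >-> R}).
Hypothesis hawkes : markovian_hawkes lam r B tau mk.

Let tau_incr := epochs_increasing hawkes.
Implicit Types s : shot R.

Lemma early_sets_subset p q p' q' : (p <= p')%N -> (q <= q')%N ->
  <<s early_sets tau mk p q >> `<=` <<s early_sets tau mk p' q' >>.
Proof.
move=> pp' qq'; apply: sub_sigma_algebra2 => A [X [[k kp <-]|[k kq <-]] hA].
  by exists (tau k) => //; left; exists k => //=; exact: leq_trans pp'.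
by exists (mk k) => //; right; exists k => //=; exact: leq_trans qq'.
Qed.

Lemma early_measurable_subset p q p' q' (f : T -> R) : (p <= p')%N -> (q <= q')%N ->
  measurable_fun setT (f : g_sigma_algebraType (early_sets tau mk p q) -> R) ->
  measurable_fun setT (f : g_sigma_algebraType (early_sets tau mk p' q') -> R).
Proof. by move=> pp' qq' mf mT Y mY; apply: (early_sets_subset pp' qq'); exact: mf. Qed.

(** Freezing with the mark integrated out; Y may involve [tau n], the epoch that carries the
    mark. *)
Lemma mark_indep n (f : R -> R) (Y : T -> R) :
  (forall x, 0 <= f x) -> measurable_fun setT f -> (forall w, 0 <= Y w) ->
  measurable_fun setT (Y : g_sigma_algebraType (early_sets tau mk n.+1 n) -> R) ->
  (\int[P]_w (f (mk n w) * Y w)%:E = (\int[P]_w (f (B w))%:E) * \int[P]_w (Y w)%:E)%E.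
Proof.
move=> f0 mf Y0 mY.
pose TG := g_sigma_algebraType (early_sets tau mk n.+1 n).
have mYT : measurable_fun setT Y by exact: early_measurable_fun mY.
pose F (z : R * TG) := (f z.1 * Y z.2)%:E.
have mF : measurable_fun setT F.
  apply/measurable_EFinP; apply: measurable_funM.
    by apply: measurableT_comp => //; exact: measurable_fst.
  by apply: measurableT_comp => //; exact: measurable_snd.
have F0 z : (0 <= F z)%E by rewrite lee_fin mulr_ge0.
have mfE : measurable_fun setT (EFin \o f) by exact/measurable_EFinP.
have f0E x : (0 <= (EFin \o f) x)%E by rewrite lee_fin.
have iX : independent_of P (mk n) <<s early_sets tau mk n.+1 n >>.
  by move=> A C GA mC; exact: (marks_independent hawkes).
rewrite (ge0_integral_independent (@early_sets_measurable _ _ _ _ tau mk n.+1 n) iX mF F0).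
have inner w : (\int[distribution P (mk n)]_x F (x, w) = (\int[P]_w (f (B w))%:E) * (Y w)%:E)%E.
  rewrite /F/=; under eq_integral do rewrite EFinM.
  rewrite ge0_integralZr//; [|by move=> x _; rewrite lee_fin|by rewrite lee_fin].
  by rewrite (ge0_integral_distribution (mk n) mfE f0E)/= (mark_integral hawkes n mfE f0E).
under eq_integral do rewrite inner.
rewrite ge0_integralZl//; first exact/measurable_EFinP.
- by move=> w _; rewrite lee_fin.
- by apply: integral_ge0 => w _; rewrite lee_fin.
Qed.

(** Without indicators, unlike [noise_upto]: it is known from the first n epochs and marks and obeys
    the exact decay rule [noise_after_shift]. The two agree once the first n epochs are past. *)
Definition noise_after s n (u : R) w : R :=
  initial s * expR (- rate s * u) + \sum_(i < n) weight s (mk i w) * expR (- rate s * (u - tau i w)).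

(** The noise of the process cut after its first n epochs; it is nondecreasing in n, so that
    monotone convergence applies. *)
Definition noise_upto s n (t : R) w : R :=
  initial s * expR (- rate s * t) +
  \sum_(i < n) (tau i w < t)%R%:R * (weight s (mk i w) * expR (- rate s * (t - tau i w))).

Lemma noise_after_ge0 s n u w : 0 <= noise_after s n u w.
Proof.
rewrite addr_ge0 ?mulr_ge0 ?initial_ge0 ?expR_ge0// sumr_ge0// => i _.
by rewrite mulr_ge0 ?weight_ge0 ?expR_ge0.
Qed.

Lemma noise_upto_ge0 s n u w : 0 <= noise_upto s n u w.
Proof.
rewrite addr_ge0 ?mulr_ge0 ?initial_ge0 ?expR_ge0// sumr_ge0// => i _.
by rewrite !mulr_ge0 ?weight_ge0 ?expR_ge0.
Qed.

Lemma noise_upto_after s n u w : upcoming tau n u w -> noise_upto s n u w = noise_after s n u w.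
Proof.
move=> /(upcomingP tau_incr) uw; congr (_ + _); apply: eq_bigr => i _.
by rewrite uw ltn_ord mul1r.
Qed.

Lemma noise_upto_nondecreasing s n m u w : (n <= m)%N -> noise_upto s n u w <= noise_upto s m u w.
Proof.
move=> nm; rewrite /noise_upto lerD2l.
pose F i := (tau i w < u)%R%:R * (weight s (mk i w) * expR (- rate s * (u - tau i w))).
rewrite -!(big_mkord xpredT F) (big_cat_nat (leq0n n) nm)/= lerDl sumr_ge0// => i _.
by rewrite /F !mulr_ge0 ?weight_ge0 ?expR_ge0.
Qed.

Lemma noise_upto_stationary s n m u w : upcoming tau n u w -> (n <= m)%N -> noise_upto s m u w = noise_after s n u w.
Proof.
move=> uw nm; rewrite -noise_upto_after// /noise_upto; congr (_ + _).
pose F i := (tau i w < u)%R%:R * (weight s (mk i w) * expR (- rate s * (u - tau i w))).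
rewrite -!(big_mkord xpredT F) (big_cat_nat (leq0n n) nm)/= [X in _ + X]big_nat_cond.
rewrite [X in _ + X]big1 ?addr0// => i /andP[/andP[ni _] _].
by rewrite /F (proj1 (upcomingP tau_incr _ _ _) uw) ltnNge ni mul0r.
Qed.

(** Exponential decay is memoryless. This moves the noise in an integrand from the time t of
    observation to the time u of the arrival, which is what closes the moment equations. *)
Lemma noise_after_shift s n t u w : noise_after s n t w = expR (- rate s * (t - u)) * noise_after s n u w.
Proof.
rewrite /noise_after mulrDr mulr_sumr mulrCA -expRD; congr (_ * expR _ + _); first by ring.
by apply: eq_bigr => i _; rewrite mulrCA -expRD; congr (_ * expR _); ring.
Qed.

Lemma noise_upto_before s n t w : tau n w < t -> noise_upto s n t w = noise_after s n t w.
Proof.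
move=> nt; congr (_ + _); apply: eq_bigr => i _.
by rewrite (lt_trans (tau_ltW tau_incr _ (ltn_ord i)) nt) mul1r.
Qed.

Lemma measurable_noise_after d' (S : measurableType d') s n (u : S -> R) (f : S -> T) :
  measurable_fun setT u ->
  (forall k, (k < n)%N -> measurable_fun setT (fun x => tau k (f x))) ->
  (forall k, (k < n)%N -> measurable_fun setT (fun x => mk k (f x))) ->
  measurable_fun setT (fun x => noise_after s n (u x) (f x)).
Proof.
move=> mu mt mm; apply: measurable_funD.
  apply: measurable_funM => //; apply: measurableT_comp => //; exact: measurable_funM.
apply: measurable_sum => k; apply: measurable_funM.
  by apply: measurableT_comp; [exact: weight_measurable|exact: mm].
apply: measurableT_comp => //; apply: measurable_funM => //.
by apply: measurable_funB => //; exact: mt.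
Qed.

Lemma measurable_noise_upto d' (S : measurableType d') s n (u : S -> R) (f : S -> T) :
  measurable_fun setT u ->
  (forall k, (k < n)%N -> measurable_fun setT (fun x => tau k (f x))) ->
  (forall k, (k < n)%N -> measurable_fun setT (fun x => mk k (f x))) ->
  measurable_fun setT (fun x => noise_upto s n (u x) (f x)).
Proof.
move=> mu mt mm; apply: measurable_funD.
  apply: measurable_funM => //; apply: measurableT_comp => //; exact: measurable_funM.
apply: measurable_sum => k; apply: measurable_funM.
  by apply: measurable_boolR; apply: measurable_fun_ltr => //; exact: mt.
apply: measurable_funM.
  by apply: measurableT_comp; [exact: weight_measurable|exact: mm].
apply: measurableT_comp => //; apply: measurable_funM => //.
by apply: measurable_funB => //; exact: mt.
Qed.

End shots.

(** * Integrals over time and probability space *)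

Section double_integral.
Context d (T : measurableType d) (R : realType) (P : probability T R).
Local Notation mu := lebesgue_measure.

(** What Tonelli asks of an integrand; sums and limits can then be taken in the extended reals
    before any moment is known to be finite. *)
Definition jointly (g : R -> T -> R) :=
  measurable_fun setT (fun z : measurableTypeR R * T => g z.1 z.2) /\ forall u w, 0 <= g u w.

Definition time_integral (t : R) (g : R -> T -> R) : \bar R :=
  (\int[mu]_(u in `[0%R, t]) \int[P]_w (g u w)%:E)%E.

Lemma jointly_slice g u : jointly g -> measurable_fun setT (g u).
Proof. by move=> [mg _]; exact: (measurableT_comp mg (measurable_pair1 u)). Qed.

Lemma jointly_integral g : jointly g ->
  measurable_fun setT (fun u : measurableTypeR R => \int[P]_w (g u w)%:E)%E.
Proof.
move=> [mg g0].
apply: (@measurable_fun_fubini_tonelli_F _ _ (measurableTypeR R) T R P (fun z => (g z.1 z.2)%:E)).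
  exact/measurable_EFinP.
by move=> z; rewrite lee_fin.
Qed.

Lemma jointlyD g h : jointly g -> jointly h -> jointly (fun u w => g u w + h u w).
Proof. by move=> [mg g0] [mh h0]; split => [|u w]; [exact: measurable_funD|exact: addr_ge0]. Qed.

Lemma jointlyM g h : jointly g -> jointly h -> jointly (fun u w => g u w * h u w).
Proof. by move=> [mg g0] [mh h0]; split => [|u w]; [exact: measurable_funM|exact: mulr_ge0]. Qed.

Lemma jointly_cst (k : R) : 0 <= k -> jointly (fun _ _ => k).
Proof. by move=> k0; split. Qed.

Lemma jointly_expR (a b : R) : jointly (fun u _ => expR (a * (b - u))).
Proof.
split => [|u w]; last exact: expR_ge0.
by apply: measurableT_comp => //; apply: measurable_funM => //; exact: measurable_funB.
Qed.

Lemma jointly_sum n (g : nat -> R -> T -> R) : (forall i, jointly (g i)) ->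
  jointly (fun u w => \sum_(i < n) g i u w).
Proof.
move=> jg; split => [|u w]; last by rewrite sumr_ge0// => i _; case: (jg i).
by apply: measurable_sum => i; case: (jg i).
Qed.

Lemma time_integralD t g h : jointly g -> jointly h ->
  time_integral t (fun u w => g u w + h u w) = (time_integral t g + time_integral t h)%E.
Proof.
move=> jg jh; have [_ g0] := jg; have [_ h0] := jh.
rewrite /time_integral -ge0_integralD//;
  try (by apply: measurable_funTS; exact: jointly_integral);
  try (by move=> u _; apply: integral_ge0 => w _; rewrite lee_fin).
apply: eq_integral => u _; rewrite -ge0_integralD//;
  try (by move=> w _; rewrite lee_fin);
  by apply/measurable_EFinP; exact: jointly_slice.
Qed.

Lemma time_integralZ t g (k : R) : 0 <= k -> jointly g ->
  time_integral t (fun u w => k * g u w) = (k%:E * time_integral t g)%E.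
Proof.
move=> k0 jg; have [_ g0] := jg.
rewrite /time_integral -ge0_integralZl//;
  try (by apply: measurable_funTS; exact: jointly_integral);
  try (by move=> u _; apply: integral_ge0 => w _; rewrite lee_fin).
apply: eq_integral => u _; rewrite -ge0_integralZl//;
  try (by move=> w _; rewrite lee_fin);
  by apply/measurable_EFinP; exact: jointly_slice.
Qed.

Lemma eq_time_integral t g h : (forall u w, g u w = h u w) -> time_integral t g = time_integral t h.
Proof.
by move=> gh; apply: eq_integral => u _; apply: eq_integral => w _; rewrite gh.
Qed.

Lemma time_integral_eq0 t g : (forall u w, g u w = 0) -> time_integral t g = 0%E.
Proof. by move=> g0; apply: integral0_eq => u _; apply: integral0_eq => w _; rewrite g0. Qed.

Lemma le_time_integral t g h : jointly g -> jointly h ->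
  (forall u w, 0 <= u <= t -> g u w <= h u w) -> (time_integral t g <= time_integral t h)%E.
Proof.
move=> jg jh gh; have [_ g0] := jg; have [_ h0] := jh.
apply: ge0_le_integral => //;
  try (by apply: measurable_funTS; exact: jointly_integral);
  try (by move=> u _; apply: integral_ge0 => w _; rewrite lee_fin).
move=> u /=; rewrite in_itv/= => ut; apply: ge0_le_integral => //;
  try (by apply/measurable_EFinP; exact: jointly_slice);
  by move=> w _; rewrite lee_fin// gh.
Qed.

End double_integral.

Section shot_products.
Context d (T : measurableType d) (R : realType) (P : probability T R) (lam r : R)
  (B : {RV P >-> R}) (tau mk : nat -> {RV P >-> R}) (b1 : R).
Hypotheses (lam_gt0 : 0 < lam) (r_gt0 : 0 < r).
Hypothesis hawkes : markovian_hawkes lam r B tau mk.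
Hypothesis B_pos : P [set w | 0 < B w] = 1%E.
Hypothesis b1E : ('E_P[B] = b1%:E)%E.

Local Notation epoch_rate := (epoch_rate lam r tau mk).
Let epoch_rate_ge0 := epoch_rate_ge0 r tau mk lam_gt0.
Local Notation noise_after := (noise_after tau mk).
Local Notation noise_upto := (noise_upto tau mk).
Local Notation time_integral := (time_integral P).
Let noise_after_ge0 := noise_after_ge0 tau mk.
Let noise_upto_ge0 := noise_upto_ge0 tau mk.
Implicit Types s : shot R.

Lemma jointly_epoch_rate n : jointly (epoch_rate n).
Proof.
split; last by move=> u w; exact: epoch_rate_ge0.
by apply: joint_measurable_epoch_rate; [exact: measurable_fst|exact: measurable_snd].
Qed.

Lemma jointly_noise_after s n : jointly (noise_after s n).
Proof.
split; last by move=> u w; exact: noise_after_ge0.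
apply: measurable_noise_after => [|k _|k _]; first exact: measurable_fst.
  by apply: measurableT_comp => //; exact: measurable_snd.
by apply: measurableT_comp => //; exact: measurable_snd.
Qed.

Lemma jointly_noise_upto s n : jointly (noise_upto s n).
Proof.
split; last by move=> u w; exact: noise_upto_ge0.
apply: measurable_noise_upto => [|k _|k _]; first exact: measurable_fst.
  by apply: measurableT_comp => //; exact: measurable_snd.
by apply: measurableT_comp => //; exact: measurable_snd.
Qed.

Lemma early_measurable_noise_after s n u :
  measurable_fun setT (noise_after s n u : g_sigma_algebraType (early_sets tau mk n n) -> R).
Proof.
apply: (@measurable_noise_after _ T R P tau mk _ (g_sigma_algebraType (early_sets tau mk n n)) s n (cst u) idfun) => // k kn.
  exact: early_measurable_epoch.
exact: early_measurable_mark.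
Qed.

(** The mark is independent of the other factors and averages to e; [compensator] then trades the
    indicator of the epoch for the integral of its rate. H may be a noise at the later time t, as
    [noise_after] is still known from the first n epochs. *)
Lemma arrival_integral n (f : R -> R) (H : T -> R) (c t e : R) :
  (forall x, 0 <= f x) -> measurable_fun setT f -> (\int[P]_w (f (B w))%:E = e%:E)%E ->
  0 <= c -> 0 <= t -> (forall w, 0 <= H w) ->
  measurable_fun setT (H : g_sigma_algebraType (early_sets tau mk n n) -> R) ->
  (\int[P]_w ((tau n w < t)%R%:R * (f (mk n w) * expR (- c * (t - tau n w))) * H w)%:E =
   time_integral t (fun u w => (expR (- c * (t - u)) * (epoch_rate n u w * (e * H w)))%R))%E.
Proof.
move=> f0 mf fE c0 t0 H0 mH.
have mHT : measurable_fun setT H by exact: early_measurable_fun mH.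
have e0 : 0 <= e.
  by rewrite -lee_fin -fE; apply: integral_ge0 => w _; rewrite lee_fin.
(* All factors but the mark, known from n.+1 epochs and n marks. *)
pose Y w := H w * ((tau n w < t)%R%:R * expR (- c * (t - tau n w))).
have Y0 w : 0 <= Y w by rewrite !mulr_ge0 ?expR_ge0.
have mY : measurable_fun setT (Y : g_sigma_algebraType (early_sets tau mk n.+1 n) -> R).
  pose G := g_sigma_algebraType (early_sets tau mk n.+1 n).
  have mtau : measurable_fun setT (tau n : G -> R) by exact: early_measurable_epoch.
  apply: measurable_funM; first exact: early_measurable_subset mH.
  apply: measurable_funM; first by apply: measurable_boolR; exact: measurable_fun_ltr.
  by apply: measurableT_comp => //; apply: measurable_funM => //; exact: measurable_funB.
rewrite (eq_integral (fun w => (f (mk n w) * Y w)%:E)); last first.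
  by move=> w _; congr _%:E; rewrite /Y; ring.
rewrite (mark_indep hawkes f0 mf Y0 mY) fE.
have -> : (\int[P]_w (Y w)%:E = (expR (- c * t))%:E *
    \int[P]_w (H w * ((tau n w < t)%R%:R * expR (c * tau n w)))%:E)%E.
  have mg : measurable_fun setT (fun w => H w * ((tau n w < t)%R%:R * expR (c * tau n w))).
    apply: measurable_funM => //; apply: measurable_funM.
      by apply: measurable_boolR; exact: measurable_fun_ltr.
    by apply: measurableT_comp => //; exact: measurable_funM.
  rewrite -ge0_integralZl ?lee_fin ?expR_ge0//; last 2 first.
  - exact/measurable_EFinP.
  - by move=> w _; rewrite lee_fin !mulr_ge0 ?expR_ge0.
  apply: eq_integral => w _; rewrite -EFinM; congr _%:E; rewrite /Y.
  have -> : - c * (t - tau n w) = - c * t + c * tau n w by ring.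
  by rewrite expRD; ring.
rewrite (compensator lam_gt0 r_gt0 hawkes B_pos b1E c0 t0 H0 mH).
rewrite -/(time_integral t (fun u w => H w * (epoch_rate n u w * expR (c * u)))).
have jH : jointly (fun (_ : R) w => H w).
  by split => //; apply: measurableT_comp => //; exact: measurable_snd.
have jg : jointly (fun u w => H w * (epoch_rate n u w * expR (c * u))).
  apply: jointlyM => //; apply: jointlyM; first exact: jointly_epoch_rate.
  split => [|u w]; last exact: expR_ge0.
  by apply: measurableT_comp => //; apply: measurable_funM => //; exact: measurable_fst.
rewrite muleA -EFinM -time_integralZ ?mulr_ge0 ?expR_ge0//.
apply: eq_time_integral => u w.
have -> : - c * (t - u) = - c * t + c * u by ring.
by rewrite expRD; ring.
Qed.

(** Mean rate of increase of the product of two noises. An arrival with mark x raises it by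
    [weight s x] times the second noise, [weight s' x] times the first, and the product of the
    weights; es, es' and ess' stand for the means of these three. *)
Definition shot_kernel s s' (es es' ess' : R) n u w : R :=
  \sum_(i < n) epoch_rate i u w * (es * noise_after s' i u w + es' * noise_after s i u w + ess').

(** Induction on n: the epoch of index n adds two cross terms and the product of its own
    contributions. Where this epoch is past, the noise of the first n epochs equals [noise_after],
    so [arrival_integral] applies to each term. *)
Lemma noise_upto_product_integral s s' (es es' ess' : R) n (t : R) : 0 <= t ->
  (\int[P]_w (weight s (B w))%:E = es%:E)%E ->
  (\int[P]_w (weight s' (B w))%:E = es'%:E)%E ->
  (\int[P]_w (weight s (B w) * weight s' (B w))%:E = ess'%:E)%E ->
  (\int[P]_w (noise_upto s n t w * noise_upto s' n t w)%:E =
   (initial s * initial s' * expR (- (rate s + rate s') * t))%:E +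
   time_integral t (fun u w => (expR (- (rate s + rate s') * (t - u)) *
                       shot_kernel s s' es es' ess' n u w)%R))%E.
Proof.
move=> t0 Es Es' Ess'.
have es0 : 0 <= es.
  by rewrite -lee_fin -Es; apply: integral_ge0 => w _; rewrite lee_fin weight_ge0.
have es'0 : 0 <= es'.
  by rewrite -lee_fin -Es'; apply: integral_ge0 => w _; rewrite lee_fin weight_ge0.
have ess'0 : 0 <= ess'.
  by rewrite -lee_fin -Ess'; apply: integral_ge0 => w _; rewrite lee_fin mulr_ge0// weight_ge0.
have jk n' : jointly (shot_kernel s s' es es' ess' n').
  apply: (@jointly_sum _ T R n' (fun i u w => epoch_rate i u w * (es * noise_after s' i u w + es' * noise_after s i u w + ess'))) => i.
  apply: jointlyM; first exact: jointly_epoch_rate.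
  apply: jointlyD; last exact: jointly_cst.
  by apply: jointlyD; apply: jointlyM; (try exact: jointly_cst); exact: jointly_noise_after.
elim: n => [|n IHn].
  rewrite (_ : time_integral t _ = 0%E) ?adde0.
    rewrite (eq_integral (cst (initial s * initial s' * expR (- (rate s + rate s') * t))%:E)).
      by rewrite integral_cst//= probability_setT mule1.
    move=> w _; congr _%:E; rewrite /noise_upto !big_ord0 !addr0.
    have -> : - (rate s + rate s') * t = - rate s * t + - rate s' * t by ring.
    by rewrite expRD; ring.
  apply: time_integral_eq0 => u w.
  by rewrite /shot_kernel big_ord0 mulr0.
(* Contributions of the new epoch to the two noises; a2 is their product. *)
pose a w := (tau n w < t)%R%:R * (weight s (mk n w) * expR (- rate s * (t - tau n w))).
pose a' w := (tau n w < t)%R%:R * (weight s' (mk n w) * expR (- rate s' * (t - tau n w))).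
pose a2 w := (tau n w < t)%R%:R * (weight s (mk n w) * weight s' (mk n w) * expR (- (rate s + rate s') * (t - tau n w))).
have prodE w : noise_upto s n.+1 t w * noise_upto s' n.+1 t w =
    noise_upto s n t w * noise_upto s' n t w + (a w * noise_after s' n t w + a' w * noise_after s n t w + a2 w * 1).
  have E1 : noise_upto s n.+1 t w = noise_upto s n t w + a w by rewrite /noise_upto big_ord_recr/= addrA.
  have E2 : noise_upto s' n.+1 t w = noise_upto s' n t w + a' w by rewrite /noise_upto big_ord_recr/= addrA.
  rewrite E1 E2; case: (ltP (tau n w) t) => nt; last first.
    by rewrite /a /a' /a2 ltNge nt/= !mul0r !addr0.
  rewrite !(noise_upto_before hawkes _ nt).
  have -> : a2 w = a w * a' w; last by ring.
  rewrite /a /a' /a2 nt !mul1r.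
  have -> : - (rate s + rate s') * (t - tau n w) =
    - rate s * (t - tau n w) + - rate s' * (t - tau n w) by ring.
  by rewrite expRD; ring.
have mtau : measurable_fun setT (fun w => (tau n w < t)%R%:R : R).
  by apply: measurable_boolR; exact: measurable_fun_ltr.
have mexp c : measurable_fun setT (fun w => expR (c * (t - tau n w))).
  by apply: measurableT_comp => //; apply: measurable_funM => //; exact: measurable_funB.
have mwt s0 : measurable_fun setT (fun w => weight s0 (mk n w)).
  by apply: measurableT_comp => //; exact: weight_measurable.
have ma : measurable_fun setT a by apply: measurable_funM => //; exact: measurable_funM.
have ma' : measurable_fun setT a' by apply: measurable_funM => //; exact: measurable_funM.
have ma2 : measurable_fun setT a2.
  by apply: measurable_funM => //; apply: measurable_funM => //; exact: measurable_funM.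
have a0 w : 0 <= a w by rewrite !mulr_ge0 ?weight_ge0 ?expR_ge0.
have a'0 w : 0 <= a' w by rewrite !mulr_ge0 ?weight_ge0 ?expR_ge0.
have a20 w : 0 <= a2 w by rewrite !mulr_ge0 ?weight_ge0 ?expR_ge0.
have mS s0 : measurable_fun setT (noise_after s0 n t) by exact: jointly_slice (jointly_noise_after s0 n).
have mX s0 : measurable_fun setT (noise_upto s0 n t) by exact: jointly_slice (jointly_noise_upto s0 n).
rewrite (eq_integral (fun w => (noise_upto s n t w * noise_upto s' n t w)%:E +
   ((a w * noise_after s' n t w)%:E + (a' w * noise_after s n t w)%:E + (a2 w * 1)%:E))%E); last first.
  by move=> w _; rewrite prodE !EFinD.
have ge1 w : (0 <= (noise_upto s n t w * noise_upto s' n t w)%:E)%E by rewrite lee_fin mulr_ge0.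
have ge2 w : (0 <= (a w * noise_after s' n t w)%:E)%E by rewrite lee_fin mulr_ge0.
have ge3 w : (0 <= (a' w * noise_after s n t w)%:E)%E by rewrite lee_fin mulr_ge0.
have ge4 w : (0 <= (a2 w * 1)%:E)%E by rewrite lee_fin mulr_ge0.
have me1 : measurable_fun setT (fun w => (noise_upto s n t w * noise_upto s' n t w)%:E).
  by apply/measurable_EFinP; exact: measurable_funM.
have me2 : measurable_fun setT (fun w => (a w * noise_after s' n t w)%:E).
  by apply/measurable_EFinP; exact: measurable_funM.
have me3 : measurable_fun setT (fun w => (a' w * noise_after s n t w)%:E).
  by apply/measurable_EFinP; exact: measurable_funM.
have me4 : measurable_fun setT (fun w => (a2 w * 1)%:E).
  by apply/measurable_EFinP; exact: measurable_funM.
rewrite ge0_integralD//; first last.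
- by apply: emeasurable_funD => //; exact: emeasurable_funD.
- by move=> w _; rewrite !adde_ge0.
rewrite ge0_integralD//; first last.
- by exact: emeasurable_funD.
- by move=> w _; rewrite !adde_ge0.
rewrite ge0_integralD// IHn.
have I1 : (\int[P]_w (a w * noise_after s' n t w)%:E =
    time_integral t (fun u w => (expR (- rate s * (t - u)) * (epoch_rate n u w * (es * noise_after s' n t w)))%R))%E.
  exact: (arrival_integral (@weight_ge0 _ s) (@weight_measurable _ s) Es (rate_ge0 s) t0 (noise_after_ge0 s' n t) (@early_measurable_noise_after s' n t)).
have I2 : (\int[P]_w (a' w * noise_after s n t w)%:E =
    time_integral t (fun u w => (expR (- rate s' * (t - u)) * (epoch_rate n u w * (es' * noise_after s n t w)))%R))%E.
  exact: (arrival_integral (@weight_ge0 _ s') (@weight_measurable _ s') Es' (rate_ge0 s') t0 (noise_after_ge0 s n t) (@early_measurable_noise_after s n t)).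
have I3 : (\int[P]_w (a2 w * 1)%:E =
    time_integral t (fun u w => (expR (- (rate s + rate s') * (t - u)) * (epoch_rate n u w * (ess' * 1)))%R))%E.
  apply: (@arrival_integral n (fun x => weight s x * weight s' x) (cst 1)) => //.
  - by move=> x; rewrite mulr_ge0 ?weight_ge0.
  - by apply: measurable_funM; exact: weight_measurable.
  - by rewrite addr_ge0 ?rate_ge0.
rewrite I1 I2 I3.
have jhS c k s0 : 0 <= k -> jointly (fun u w => expR (c * (t - u)) * (epoch_rate n u w * (k * noise_after s0 n t w))).
  move=> k0; apply: jointlyM; first exact: jointly_expR.
  apply: jointlyM; first exact: jointly_epoch_rate.
  apply: jointlyM; first exact: jointly_cst.
  split => //; apply: (measurableT_comp (mS s0)); exact: measurable_snd.
have jh1 c k : 0 <= k -> jointly (fun u w => expR (c * (t - u)) * (epoch_rate n u w * (k * 1))).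
  move=> k0; apply: jointlyM; first exact: jointly_expR.
  apply: jointlyM; first exact: jointly_epoch_rate.
  by apply: jointlyM; exact: jointly_cst.
rewrite -time_integralD; [|exact: jhS|exact: jhS].
rewrite -time_integralD; [|by apply: jointlyD; exact: jhS|exact: jh1].
rewrite -addeA -time_integralD; first last.
- by apply: jointlyD; [apply: jointlyD; exact: jhS|exact: jh1].
- by apply: jointlyM; [exact: jointly_expR|exact: jk].
congr (_ + _)%E; apply: eq_time_integral => u w; rewrite /shot_kernel big_ord_recr/= [RHS]mulrDr; congr (_ + _).
(* Taken back from t to u, each noise supplies the decay factor that its cross term lacks. *)
rewrite (noise_after_shift tau mk s n t u) (noise_after_shift tau mk s' n t u).
have -> : - (rate s + rate s') * (t - u) = - rate s * (t - u) + - rate s' * (t - u) by ring.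
by rewrite expRD; ring.
Qed.

End shot_products.

Lemma integral_derivative (R : realType) (F f : R -> R) (t : R) :
  (forall x : R, is_derive x (1 : R) F (f x)) -> continuous f -> 0 <= t ->
  (\int[lebesgue_measure]_(u in `[0%R, t]) (f u)%:E = (F t - F 0%R)%:E)%E.
Proof.
move=> dF cf; rewrite le_eqVlt => /predU1P[<-|t0].
  by rewrite set_itv1 integral_set1 subrr.
rewrite (@continuous_FTC2 _ f F)//.
- exact: continuous_subspaceT.
- have cF : continuous F.
    by move=> x; apply: differentiable_continuous; apply/derivable1_diffP.
  split => [x _| |]; first by [].
    by apply: cvg_at_right_filter; exact: cF.
  by apply: cvg_at_left_filter; exact: cF.
- by move=> x _; rewrite derive1E; exact: derive_val.
Qed.

(** * From finitely many epochs to all of them *)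

Section shot_limits.
Context d (T : measurableType d) (R : realType) (P : probability T R) (lam r : R)
  (B : {RV P >-> R}) (tau mk : nat -> {RV P >-> R}) (b1 : R).
Hypotheses (lam_gt0 : 0 < lam) (r_gt0 : 0 < r).
Hypothesis hawkes : markovian_hawkes lam r B tau mk.
Hypothesis B_pos : P [set w | 0 < B w] = 1%E.
Hypothesis b1E : ('E_P[B] = b1%:E)%E.

Let tau_incr := epochs_increasing hawkes.
Let tau_unb := epochs_unbounded hawkes.
Local Notation epoch_rate := (epoch_rate lam r tau mk).
Local Notation rate_after := (rate_after lam r tau mk).
Let epoch_rate_ge0 := epoch_rate_ge0 r tau mk lam_gt0.
Local Notation noise_after := (noise_after tau mk).
Local Notation noise_upto := (noise_upto tau mk).
Local Notation time_integral := (time_integral P).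
Local Notation shot_kernel := (shot_kernel lam r tau mk).
Let noise_after_ge0 := noise_after_ge0 tau mk.
Let noise_upto_ge0 := noise_upto_ge0 tau mk.
Implicit Types s : shot R.

Definition epochs_before (u : R) w : nat := Defs.count [set k | tau k w < u].

Lemma epochs_beforeP u w : upcoming tau (epochs_before u w) u w.
Proof.
have [n nE] := epoch_index_strict tau_incr tau_unb u w.
have -> : epochs_before u w = n.
  rewrite /epochs_before /Defs.count (set_index nE); apply: card_fset_set; exact: card_eqxx.
exact/(upcomingP tau_incr).
Qed.

Lemma upcoming_epochs_before n u w : upcoming tau n u w = (n == epochs_before u w).
Proof.
apply/idP/eqP => [/(upcomingP tau_incr) h|->]; last exact: epochs_beforeP.
rewrite /epochs_before /Defs.count (set_index h); apply/esym/card_fset_set; exact: card_eqxx.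
Qed.

Definition noise s u w : R := noise_after s (epochs_before u w) u w.

Lemma noise_ge0 s u w : 0 <= noise s u w. Proof. exact: noise_after_ge0. Qed.

Lemma noise_uptoE s n u w : (epochs_before u w <= n)%N -> noise_upto s n u w = noise s u w.
Proof. exact: (noise_upto_stationary hawkes s (epochs_beforeP u w)). Qed.

Lemma jointly_noise s : jointly (noise s).
Proof.
split; last by move=> u w; exact: noise_ge0.
apply: (@measurable_fun_cvg _ _ _ _ (fun n (z : measurableTypeR R * T) => noise_upto s n z.1 z.2)) => //.
  by move=> n; case: (jointly_noise_upto tau mk s n).
move=> z _; apply: cvg_near_cst; exists (epochs_before z.1 z.2) => // n /= nn.
exact: noise_uptoE.
Qed.

Lemma mark_weight_ge0 (x : R) : 0 <= Num.max 0 x. Proof. by rewrite le_max lexx. Qed.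
Lemma mark_weight_measurable : measurable_fun setT (fun x : R => Num.max 0 x).
Proof. exact: measurable_maxr. Qed.

(** Plus lam, the noise of this shot is almost surely the intensity; the positive part of the mark
    keeps the weight nonnegative everywhere. *)
Definition mark_shot : shot R :=
  Shot mark_weight_ge0 mark_weight_measurable (ltW r_gt0) (lexx 0).

Definition pos_intensity u w : R := lam + noise mark_shot u w.

Lemma pos_intensity_ge0 u w : 0 <= pos_intensity u w.
Proof. by rewrite addr_ge0 ?(ltW lam_gt0)// noise_ge0. Qed.

Lemma jointly_pos_intensity : jointly pos_intensity.
Proof. by apply: jointlyD; [exact/jointly_cst/ltW|exact: jointly_noise]. Qed.

Lemma rate_afterE n u w : rate_after n u w = lam + noise_after mark_shot n u w.
Proof. by rewrite /noise_after/= mul0r add0r. Qed.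

(** Exactly one epoch is upcoming at each time, so at most one summand survives and the truncation
    remains only as an indicator. *)
Lemma shot_kernelE s s' (es es' ess' : R) n u w : shot_kernel s s' es es' ess' n u w =
  (epochs_before u w < n)%N%:R * (pos_intensity u w * (es * noise s' u w + es' * noise s u w + ess')).
Proof.
rewrite /shot_kernel.
have F0 (i : nat) : i != epochs_before u w ->
    epoch_rate i u w * (es * noise_after s' i u w + es' * noise_after s i u w + ess') = 0.
  by move=> ni; rewrite /epoch_rate upcoming_epochs_before (negbTE ni) !mul0r.
case: ltnP => [nn|nn].
  rewrite (bigD1 (Ordinal nn))//= [X in _ + X]big1 ?addr0; last first.
    by move=> i ni; apply: F0.
  by rewrite /epoch_rate epochs_beforeP !mul1r rate_afterE.
rewrite mul0r big1// => i _; apply: F0.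
by rewrite ltn_eqF// (leq_trans (ltn_ord i)).
Qed.

Lemma jointly_shot_kernel s s' (es es' ess' : R) n : 0 <= es -> 0 <= es' -> 0 <= ess' ->
  jointly (shot_kernel s s' es es' ess' n).
Proof.
move=> es0 es'0 ess'0.
split; last by move=> u w; rewrite shot_kernelE mulr_ge0// mulr_ge0 ?pos_intensity_ge0// !addr_ge0// mulr_ge0// noise_ge0.
have -> : (fun z : measurableTypeR R * T => shot_kernel s s' es es' ess' n z.1 z.2) =
  (fun z => \sum_(i < n) epoch_rate i z.1 z.2 * (es * noise_after s' i z.1 z.2 + es' * noise_after s i z.1 z.2 + ess')) by [].
apply: measurable_sum => i; apply: measurable_funM; first by case: (jointly_epoch_rate r tau mk lam_gt0 i).
apply: measurable_funD => //; apply: measurable_funD.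
  by apply: measurable_funM => //; case: (jointly_noise_after tau mk s' i).
by apply: measurable_funM => //; case: (jointly_noise_after tau mk s i).
Qed.

Lemma time_integral_cvg t (g : nat -> R -> T -> R) (h : R -> T -> R) : (forall n, jointly (g n)) ->
  (forall u w n m, (n <= m)%N -> g n u w <= g m u w) ->
  (forall u w, \forall n \near \oo, g n u w = h u w) ->
  time_integral t (g n) @[n --> \oo] --> time_integral t h.
Proof.
move=> jg ndg gh.
have lim_gh u w : (g n u w)%:E @[n --> \oo] --> (h u w)%:E.
  by apply: cvg_near_cst; apply: filterS (gh u w) => n ->.
have E1 u : (\int[P]_w (h u w)%:E = limn (fun n => \int[P]_w (g n u w)%:E))%E.
  rewrite -monotone_convergence//.
  - by apply: eq_integral => w _; apply/esym/cvg_lim.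
  - by move=> n; apply/measurable_EFinP; exact: jointly_slice.
  - by move=> n w _; rewrite lee_fin; case: (jg n).
  - by move=> w _ n m nm; rewrite lee_fin ndg.
have mI n : measurable_fun `[0%R, t] (fun u : measurableTypeR R => \int[P]_w (g n u w)%:E)%E.
  by apply: measurable_funTS; exact: jointly_integral.
have I0 n u : `[0%R, t]%classic u -> (0 <= \int[P]_w (g n u w)%:E)%E.
  by move=> _; apply: integral_ge0 => w _; rewrite lee_fin; case: (jg n).
have ndI u : `[0%R, t]%classic u ->
    {homo (fun n => \int[P]_w (g n u w)%:E)%E : n m / (n <= m)%N >-> (n <= m)%E}.
  move=> _ n m nm; apply: ge0_le_integral => //;
    try (by apply/measurable_EFinP; exact: jointly_slice);
    try (by move=> w _; rewrite lee_fin ndg);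
    by move=> w _; rewrite lee_fin; case: (jg n); case: (jg m).
rewrite (_ : time_integral t h = (\int[lebesgue_measure]_(u in `[0%R, t]) limn (fun n => \int[P]_w (g n u w)%:E))%E).
  exact: (cvg_monotone_convergence (mu := lebesgue_measure) (measurable_itv _) mI I0 ndI).
by apply: eq_integral => u _; rewrite E1.
Qed.

Lemma noise_upto_product_cvg s s' t :
  (\int[P]_w (noise_upto s n t w * noise_upto s' n t w)%:E @[n --> \oo] -->
    \int[P]_w (noise s t w * noise s' t w)%:E)%E.
Proof.
rewrite (_ : (\int[P]_w (noise s t w * noise s' t w)%:E)%E =
    (\int[P]_w (limn (fun n => (noise_upto s n t w * noise_upto s' n t w)%:E)))%E); last first.
  apply: eq_integral => w _; apply/esym/cvg_lim => //.
  apply: cvg_near_cst; exists (epochs_before t w) => // n /= nn.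
  by rewrite !noise_uptoE.
apply: cvg_monotone_convergence => //.
- move=> n; apply/measurable_EFinP; apply: measurable_funM;
    exact: jointly_slice (jointly_noise_upto tau mk _ n).
- by move=> n w _; rewrite lee_fin mulr_ge0.
- by move=> w _ n m nm; rewrite lee_fin ler_pM// noise_upto_nondecreasing.
Qed.

(** Monotone limit of [noise_upto_product_integral]: for a given path and time, the integrands are
    nondecreasing in n and eventually constant. *)
Lemma noise_product_integral s s' (es es' ess' : R) (t : R) : 0 <= t ->
  (\int[P]_w (weight s (B w))%:E = es%:E)%E ->
  (\int[P]_w (weight s' (B w))%:E = es'%:E)%E ->
  (\int[P]_w (weight s (B w) * weight s' (B w))%:E = ess'%:E)%E ->
  (\int[P]_w (noise s t w * noise s' t w)%:E =
   (initial s * initial s' * expR (- (rate s + rate s') * t))%:E +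
   time_integral t (fun u w => (expR (- (rate s + rate s') * (t - u)) *
     (pos_intensity u w * (es * noise s' u w + es' * noise s u w + ess')))%R))%E.
Proof.
move=> t0 Es Es' Ess'.
have es0 : 0 <= es.
  by rewrite -lee_fin -Es; apply: integral_ge0 => w _; rewrite lee_fin weight_ge0.
have es'0 : 0 <= es'.
  by rewrite -lee_fin -Es'; apply: integral_ge0 => w _; rewrite lee_fin weight_ge0.
have ess'0 : 0 <= ess'.
  by rewrite -lee_fin -Ess'; apply: integral_ge0 => w _; rewrite lee_fin mulr_ge0// weight_ge0.
have c1 := @noise_upto_product_cvg s s' t.
have jlim : jointly (fun u w => pos_intensity u w * (es * noise s' u w + es' * noise s u w + ess')).
  apply: jointlyM; first exact: jointly_pos_intensity.
  apply: jointlyD; last exact: jointly_cst.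
  by apply: jointlyD; apply: jointlyM; (try exact: jointly_cst); exact: jointly_noise.
have jk n : jointly (shot_kernel s s' es es' ess' n) by exact: jointly_shot_kernel.
have c2 : time_integral t (fun u w => (expR (- (rate s + rate s') * (t - u)) *
     shot_kernel s s' es es' ess' n u w)%R) @[n --> \oo] -->
   time_integral t (fun u w => (expR (- (rate s + rate s') * (t - u)) *
     (pos_intensity u w * (es * noise s' u w + es' * noise s u w + ess')))%R).
  apply: time_integral_cvg.
  - by move=> n; apply: jointlyM => //; exact: jointly_expR.
  - move=> u w n m nm; rewrite ler_wpM2l ?expR_ge0// !shot_kernelE ler_wpM2r//; first by case: jlim.
    by rewrite ler_nat; case: ltnP => // h; rewrite (leq_trans h nm).
  - move=> u w; exists (epochs_before u w).+1 => // n /= nn.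
    by rewrite shot_kernelE nn mul1r.
have E n := noise_upto_product_integral lam_gt0 r_gt0 hawkes B_pos b1E n t0 Es Es' Ess'.
rewrite (funext E) in c1.
apply: (cvg_unique _ c1); first exact: ereal_hausdorff.
apply: cvgeD; [exact: fin_num_adde_defr|exact: cvg_cst|exact: c2].
Qed.

End shot_limits.

Lemma is_derive_expR_mul (R : realType) (k x : R) :
  is_derive x (1 : R) (fun u => expR (k * u)) (k * expR (k * x)).
Proof.
apply: DeriveDef; first exact: ex_derive.
rewrite -derive1E derive1_comp// derive1Ml// derive1_id mulr1 derive1E mulrC.
by have /funeqP -> := @derive_expR R.
Qed.

Lemma continuous_expR_mul (R : realType) (k : R) : continuous (fun u : R => expR (k * u)).
Proof.
by move=> x; apply: continuous_cvg; [exact: continuous_expR|apply: cvgMl_tmp; exact: cvg_id].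
Qed.

Lemma integral_expR (R : realType) (k t : R) : 0 <= t ->
  (\int[lebesgue_measure]_(u in `[0%R, t]) (k * expR (k * u))%:E = (expR (k * t) - 1)%:E)%E.
Proof.
move=> t0; rewrite (integral_derivative (is_derive_expR_mul k) _ t0) ?mulr0 ?expR0//.
by move=> x; apply: cvgMl_tmp; exact: continuous_expR_mul.
Qed.

(** * Exponential growth bound *)

Section shot_bound.
Context d (T : measurableType d) (R : realType) (P : probability T R) (lam r : R)
  (B : {RV P >-> R}) (tau mk : nat -> {RV P >-> R}) (b1 : R).
Hypotheses (lam_gt0 : 0 < lam) (r_gt0 : 0 < r).
Hypothesis hawkes : markovian_hawkes lam r B tau mk.
Hypothesis B_pos : P [set w | 0 < B w] = 1%E.
Hypothesis b1E : ('E_P[B] = b1%:E)%E.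

Let tau_incr := epochs_increasing hawkes.
Local Notation noise_after := (noise_after tau mk).
Local Notation noise_upto := (noise_upto tau mk).
Local Notation noise := (noise tau mk).
Local Notation time_integral := (time_integral P).
Local Notation pos_intensity := (pos_intensity lam tau mk r_gt0).
Let noise_ge0 := noise_ge0 tau mk.
Let noise_upto_ge0 := noise_upto_ge0 tau mk.
Implicit Types s : shot R.

Lemma wide_weight_ge0 (x : R) : 0 <= 1 + Num.max 0 x.
Proof. by rewrite addr_ge0// le_max lexx. Qed.
Lemma wide_weight_measurable : measurable_fun setT (fun x : R => 1 + Num.max 0 x).
Proof. by apply: measurable_funD => //; exact: measurable_maxr. Qed.

(** Dominates the other noises: it does not decay, its weight covers both marks and counts, and the
    initial value 1 keeps it at least 1, so that constants and linear terms are bounded by multiples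
    of its square. *)
Definition wide_shot : shot R :=
  Shot wide_weight_ge0 wide_weight_measurable (lexx 0) ler01.

Lemma noise_after_wide s n u w : (forall k, (k < n)%N -> tau k w <= u) -> 0 <= u ->
  (forall x, weight s x <= 1 + Num.max 0 x) -> initial s <= 1 -> noise_after s n u w <= noise_after wide_shot n u w.
Proof.
move=> nu u0 ws i1; have e1 (c v : R) : 0 <= c -> 0 <= v -> expR (- c * v) <= 1.
  by move=> c0 v0; rewrite -expR0 ler_expR mulNr oppr_le0 mulr_ge0.
rewrite /noise_after/= oppr0 mul0r expR0 mulr1; apply: lerD.
  by rewrite (le_trans (ler_pM (initial_ge0 s) (expR_ge0 _) i1 (e1 _ _ (rate_ge0 s) u0))) ?mulr1.
apply: ler_sum => i _; rewrite mul0r expR0 mulr1.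
rewrite (le_trans (ler_pM (weight_ge0 s _) (expR_ge0 _) (ws _) (e1 _ (u - tau i w) (rate_ge0 s) _))) ?mulr1//.
by rewrite subr_ge0 nu.
Qed.

Lemma noise_wide s u w : 0 <= u -> (forall x, weight s x <= 1 + Num.max 0 x) -> initial s <= 1 ->
  noise s u w <= noise wide_shot u w.
Proof.
move=> u0 ws i1; apply: noise_after_wide => // k kn.
by apply/ltW; have /(upcomingP tau_incr) -> := epochs_beforeP hawkes u w.
Qed.

Lemma wide_ge1 u w : 1 <= noise wide_shot u w.
Proof.
rewrite /noise /noise_after/= oppr0 mul0r expR0 mulr1 lerDl sumr_ge0// => i _.
by rewrite mulr_ge0 ?wide_weight_ge0 ?expR_ge0.
Qed.

Lemma pos_intensity_wide u w : 0 <= u -> pos_intensity u w <= (lam + 1) * noise wide_shot u w.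
Proof.
move=> u0; rewrite /pos_intensity mulrDl mul1r lerD//.
  by rewrite ler_peMr ?(ltW lam_gt0)// wide_ge1.
by apply: noise_wide => //= x; rewrite ?lerDr.
Qed.

Variables eW eW2 : R.
Hypothesis eWE : (\int[P]_w (weight wide_shot (B w))%:E = eW%:E)%E.
Hypothesis eW2E : (\int[P]_w (weight wide_shot (B w) * weight wide_shot (B w))%:E = eW2%:E)%E.

(** Growth rate: with W the noise of [wide_shot], the intensity is at most (lam + 1) W, and the mean
    increase of W^2 at an arrival is at most (eW + eW + eW2) W. *)
Let K := (lam + 1) * (eW + eW + eW2).

Let eW0 : 0 <= eW.
Proof. by rewrite -lee_fin -eWE; apply: integral_ge0 => w _; rewrite lee_fin weight_ge0. Qed.
Let eW20 : 0 <= eW2.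
Proof.
by rewrite -lee_fin -eW2E; apply: integral_ge0 => w _; rewrite lee_fin mulr_ge0 ?weight_ge0.
Qed.
Let K0 : 0 <= K.
Proof. by rewrite mulr_ge0 ?addr_ge0// ltW. Qed.

(** Induction on n, as a Gronwall argument would presuppose finiteness. The kernel for n.+1 epochs
    vanishes unless at most n epochs are past, and then the noise is that of the first n epochs. The
    bound reproduces itself since 1 + K int_0^t exp(K u) du = exp(K t). *)
Lemma wide_bound_n n t : 0 <= t ->
  (\int[P]_w (noise_upto wide_shot n t w * noise_upto wide_shot n t w)%:E <= (expR (K * t))%:E)%E.
Proof.
elim: n t => [|n IHn] t t0.
  rewrite (eq_integral (cst 1%:E)); last first.
    by move=> w _; rewrite /noise_upto big_ord0/= addr0 oppr0 mul0r expR0 !mulr1.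
  by rewrite integral_cst//= probability_setT mule1 lee_fin -expR0 ler_expR mulr_ge0.
rewrite (noise_upto_product_integral lam_gt0 r_gt0 hawkes B_pos b1E n.+1 t0 eWE eWE eW2E) /=.
have jX := jointly_noise_upto tau mk wide_shot n.
have jX2 : jointly (fun u w => noise_upto wide_shot n u w * noise_upto wide_shot n u w) by exact: jointlyM.
apply: (@le_trans _ _ (1%:E + time_integral t (fun u w => (K * (noise_upto wide_shot n u w * noise_upto wide_shot n u w))%R))%E).
  rewrite !addr0 oppr0 mul0r expR0 !mulr1 leeD2l//; apply: le_time_integral.
  - apply: jointlyM; first exact: jointly_expR.
    by apply: (jointly_shot_kernel lam_gt0 r_gt0 hawkes).
  - by apply: jointlyM => //; exact: jointly_cst.
  move=> u w /andP[u0 ut]; rewrite mul0r expR0 mul1r (shot_kernelE r_gt0 hawkes).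
  case: ltnP => nn; last by rewrite mul0r mulr_ge0// mulr_ge0.
  rewrite mul1r (noise_uptoE hawkes)//.
  set W := noise wide_shot u w.
  have W1 : 1 <= W by exact: wide_ge1.
  have W0 : 0 <= W by exact: le_trans W1.
  have h1 := pos_intensity_wide w u0.
  have h2 : eW * W + eW * W + eW2 <= (eW + eW + eW2) * W.
    by rewrite !mulrDl lerD2l ler_peMr.
  have h3 : 0 <= eW * W + eW * W + eW2 by rewrite !addr_ge0// mulr_ge0.
  rewrite (le_trans (ler_pM (pos_intensity_ge0 tau mk lam_gt0 r_gt0 u w) h3 h1 h2))//.
  by rewrite /K -/W le_eqVlt; apply/orP; left; apply/eqP; ring.
rewrite time_integralZ//.
have mexp : measurable_fun `[0%R, t] (fun u : R => (expR (K * u))%:E).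
  apply/measurable_EFinP; apply: measurable_funTS; apply: continuous_measurable_fun.
  exact: continuous_expR_mul.
have exp0 (u : R) : `[0%R, t]%classic u -> (0 <= (expR (K * u))%:E)%E.
  by rewrite lee_fin expR_ge0.
apply: (@le_trans _ _ (1%:E + K%:E * \int[lebesgue_measure]_(u in `[0%R, t]) (expR (K * u))%:E)%E).
  rewrite leeD2l// lee_wpmul2l ?lee_fin//.
  apply: ge0_le_integral => //;
    try (by apply: measurable_funTS; exact: jointly_integral);
    try (by move=> u _; apply: integral_ge0 => w _; rewrite lee_fin mulr_ge0).
  by move=> u /=; rewrite in_itv/= => /andP[u0 _]; exact: IHn.
rewrite -ge0_integralZl ?lee_fin//.
under eq_integral do rewrite -EFinM.
by rewrite integral_expR// -EFinD lee_fin addrC subrK.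
Qed.

Lemma wide_bound t : 0 <= t ->
  (\int[P]_w (noise wide_shot t w * noise wide_shot t w)%:E <= (expR (K * t))%:E)%E.
Proof.
move=> t0; apply: (cvge_to_le (@noise_upto_product_cvg _ _ _ _ _ _ _ _ _ hawkes wide_shot wide_shot t)).
by apply: nearW => n; exact: wide_bound_n.
Qed.

End shot_bound.

(** * Volterra equations and their solutions *)

Section volterra.
Context (R : realType).
Local Notation mu := (@lebesgue_measure R).
Implicit Types y z g eta : R -> R.

Lemma continuous_integrable (f : R -> R) (t : R) : continuous f ->
  mu.-integrable `[0, t] (EFin \o f).
Proof.
move=> cf; apply: continuous_compact_integrable; first exact: segment_compact.
exact: continuous_subspaceT.
Qed.

Lemma bounded_integrable (f : R -> R) (t M : R) : measurable_fun setT f ->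
  (forall u, 0 <= u <= t -> `|f u| <= M) -> mu.-integrable `[0, t] (EFin \o f).
Proof.
move=> mf fM; have iM := continuous_integrable t (@cst_continuous R R M).
have mI : measurable (`[0, t]%classic : set (measurableTypeR R)) by exact: measurable_itv.
apply: (le_integrable mI _ _ iM).
  by apply/measurable_EFinP; exact: measurable_funTS.
move=> u /=; rewrite in_itv/= => ut; rewrite lee_fin (le_trans (fM u ut))//.
exact: ler_norm.
Qed.

(** Each use of the equation improves the bound M 2^-n exp(2 K t) by a factor 1/2, because K int_0^t
    exp(2 K u) du is at most exp(2 K t) / 2. *)
Lemma gronwall0 (eta : R -> R) (b T0 M : R) : measurable_fun setT eta ->
  (forall t, 0 <= t <= T0 -> `|eta t| <= M) ->
  (forall t, 0 <= t <= T0 -> eta t = (\int[mu]_(u in `[0, t]) (b * eta u))%R) ->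
  forall t, 0 <= t <= T0 -> eta t = 0.
Proof.
move=> meta etaM eq_eta.
(* The summand 1 keeps K positive when b = 0. *)
pose K := `|b| + 1.
have K0 : 0 < K by rewrite ltr_wpDl.
have K20 : 0 < 2 * K by rewrite mulr_gt0.
have step n t : 0 <= t <= T0 -> `|eta t| <= M * (2^-1) ^+ n * expR (2 * K * t).
  elim: n t => [|n IHn] t /andP[t0 tT].
    have M0 : 0 <= M by apply: le_trans (etaM t _) => //; rewrite t0.
    rewrite expr0 mulr1 (le_trans (etaM t _)) ?t0// ler_peMr//.
    by rewrite -[leLHS]expR0 ler_expR mulr_ge0// ltW.
  have M0 : 0 <= M by apply: le_trans (etaM t _) => //; rewrite t0.
  have ieta : mu.-integrable `[0, t] (EFin \o (fun u => b * eta u)).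
    apply: (@bounded_integrable _ t (`|b| * M)); first exact: measurable_funM.
    move=> u /andP[u0 ut]; rewrite normrM ler_wpM2l// etaM// u0.
    exact: le_trans tT.
  rewrite eq_eta ?t0//; apply: (le_trans (le_normr_Rintegral _ ieta)) => //.
  pose C := M * 2^-1 ^+ n.+1.
  have C0 : 0 <= C by rewrite mulr_ge0// exprn_ge0// invr_ge0.
  have cF : continuous (fun u : R => C * (2 * K * expR (2 * K * u))).
    by move=> x; do 2! apply: cvgMl_tmp; exact: continuous_expR_mul.
  have iF := continuous_integrable t cF.
  apply: (@le_trans _ _ (\int[mu]_(u in `[0, t]) (C * (2 * K * expR (2 * K * u))))%R).
    apply: le_Rintegral => //.
      by have := integrable_abse ieta; apply: eq_integrable.
    move=> u /=; rewrite in_itv/= => /andP[u0 ut].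
    rewrite normrM; apply: (@le_trans _ _ (K * (M * (2^-1) ^+ n * expR (2 * K * u)))).
      by apply: ler_pM => //; [rewrite lerDl|apply: IHn; rewrite u0 (le_trans ut)].
    by rewrite le_eqVlt /C exprSr; apply/orP; left; apply/eqP; field.
  rewrite RintegralZl//; last first.
    by apply: continuous_integrable => x; apply: cvgMl_tmp; exact: continuous_expR_mul.
  rewrite /Rintegral (integral_expR (2 * K) t0)/=.
  by rewrite ler_wpM2l// lerBlDr lerDl.
move=> t tT; apply/eqP; rewrite -normr_le0.
have lim : M * (2^-1) ^+ n * expR (2 * K * t) @[n --> \oo] --> M * 0 * expR (2 * K * t).
  apply: cvgMr_tmp; apply: cvgMl_tmp; apply: cvg_expr.
  by rewrite ger0_norm ?invr_ge0// invf_lt1// ltr1n.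
rewrite mulr0 mul0r in lim.
by apply: (cvgr_to_ge lim); apply: nearW => n; exact: step.
Qed.

(** The integrating factor exp(k t) removes t from the kernel. The difference of y and z, so
    multiplied, solves a homogeneous equation and vanishes by [gronwall0]. *)
Lemma volterra_unique y z g (k b y0 T0 M : R) :
  measurable_fun setT y -> (forall t, 0 <= t <= T0 -> `|y t| <= M) -> continuous g ->
  (forall t, 0 <= t <= T0 ->
     y t = y0 * expR (- k * t) +
           (\int[mu]_(u in `[0, t]) (expR (- k * (t - u)) * (g u + b * y u)))%R) ->
  (forall x, is_derive x (1 : R) z ((b - k) * z x + g x)) -> z 0 = y0 ->
  forall t, 0 <= t <= T0 -> y t = z t.
Proof.
move=> my yM cg eq_y dz z0.
have cz : continuous z.
  by move=> x; apply: differentiable_continuous; apply/derivable1_diffP.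
pose eta t := expR (k * t) * (y t - z t).
have mz : measurable_fun setT z by exact: continuous_measurable_fun.
have mexp : measurable_fun setT (fun t : R => expR (k * t)).
  by apply: continuous_measurable_fun; exact: continuous_expR_mul.
have meta : measurable_fun setT eta by apply: measurable_funM => //; exact: measurable_funB.
have cf : continuous (fun u => expR (k * u) * (g u + b * z u)).
  move=> x; apply: cvgM; first exact: continuous_expR_mul.
  by apply: cvgD; [exact: cg|apply: cvgMl_tmp; exact: cz].
have Fz t : 0 <= t -> expR (k * t) * z t =
    y0 + (\int[mu]_(u in `[0, t]) (expR (k * u) * (g u + b * z u)))%R.
  move=> t0; have dF (x : R) : is_derive x (1 : R) (fun u => expR (k * u) * z u)
      (expR (k * x) * (g x + b * z x)).
    have h := is_deriveM (is_derive_expR_mul k x) (dz x).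
    apply: (is_derive_eq h).
    by rewrite /GRing.scale/=; ring.
  rewrite /Rintegral (integral_derivative dF cf t0)/= mulr0 expR0 mul1r z0.
  by rewrite addrC subrK.
have [M' M'0 etaM] : exists2 M', 0 <= M' & forall t, 0 <= t <= T0 -> `|eta t| <= M'.
  pose E u := expR (k * u) * z u.
  have [Mz [_ zM]] : bounded_set (z @` `[0, T0]).
    apply: compact_bounded; apply: continuous_compact; last exact: segment_compact.
    exact: continuous_subspaceT.
  have [Me [_ eM]] : bounded_set ((fun u => expR (k * u)) @` `[0, T0]).
    apply: compact_bounded; apply: continuous_compact; last exact: segment_compact.
    by apply: continuous_subspaceT; exact: continuous_expR_mul.
  exists ((`|Me| + 1) * (`|M| + (`|Mz| + 1))); first by rewrite mulr_ge0// !addr_ge0.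
  move=> t tT; rewrite /eta normrM; apply: ler_pM => //.
    apply: eM; first by rewrite ltr_pwDr// ler_norm.
    by exists t => //=; rewrite in_itv.
  rewrite (le_trans (ler_normB _ _))// lerD//; first exact: le_trans (yM t tT) (ler_norm _).
  apply: zM; first by rewrite ltr_pwDr// ler_norm.
  by exists t => //=; rewrite in_itv.
(* The integrand of y is that of z, which is continuous, plus b eta, which is bounded. *)
have iy t : 0 <= t <= T0 -> mu.-integrable `[0, t] (EFin \o (fun u => expR (k * u) * (g u + b * y u))).
  move=> /andP[t0 tT].
  have i1 := continuous_integrable t cf.
  have i2 : mu.-integrable `[0, t] (EFin \o (fun u => b * eta u)).
    apply: (@bounded_integrable _ t (`|b| * M')); first exact: measurable_funM.
    move=> u /andP[u0 ut]; rewrite normrM ler_wpM2l// etaM// u0.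
    exact: le_trans tT.
  have mI : measurable (`[0, t]%classic : set (measurableTypeR R)) by exact: measurable_itv.
  apply: eq_integrable (integrableD mI i1 i2) => //= u _.
  by rewrite -EFinD /eta; congr _%:E; ring.
have Fy t : 0 <= t <= T0 -> expR (k * t) * y t =
    y0 + (\int[mu]_(u in `[0, t]) (expR (k * u) * (g u + b * y u)))%R.
  move=> tT; rewrite (eq_y t tT) mulrDr mulrCA -expRD mulNr addrN expR0 mulr1; congr (_ + _).
  have -> : (\int[mu]_(u in `[0, t]) (expR (- k * (t - u)) * (g u + b * y u)) =
      \int[mu]_(u in `[0, t]) (expR (- k * t) * (expR (k * u) * (g u + b * y u))))%R.
    apply: eq_Rintegral => u _; rewrite mulrA -expRD; congr (expR _ * _); ring.
  by rewrite RintegralZl ?iy// mulrA -expRD mulNr addrN expR0 mul1r.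
have eq_eta t : 0 <= t <= T0 -> eta t = (\int[mu]_(u in `[0, t]) (b * eta u))%R.
  move=> tT; have t0 : 0 <= t by case/andP: tT.
  rewrite /eta mulrBr (Fy t tT) (Fz t t0).
  rewrite opprD addrACA subrr add0r -RintegralB//; [|exact: iy|exact: continuous_integrable].
  by apply: eq_Rintegral => u _; ring.
move=> t tT.
have /eqP := @gronwall0 eta b T0 M' meta etaM eq_eta t tT.
by rewrite /eta mulf_eq0 gt_eqF ?expR_gt0//= subr_eq0 => /eqP.
Qed.

End volterra.

(** * Equations for the second moments of shot noises *)

Section moments.
Context d (T : measurableType d) (R : realType) (P : probability T R) (lam r : R)
  (B : {RV P >-> R}) (tau mk : nat -> {RV P >-> R}) (b1 b2 : R).
Hypotheses (lam_gt0 : 0 < lam) (r_gt0 : 0 < r).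
Hypothesis hawkes : markovian_hawkes lam r B tau mk.
Hypothesis B_pos : P [set w | 0 < B w] = 1%E.
Hypothesis b1E : ('E_P[B] = b1%:E)%E.
Hypothesis b2E : ('E_P[fun w => (B w ^+ 2)%R] = b2%:E)%E.

Local Notation noise := (noise tau mk).
Local Notation pos_intensity := (pos_intensity lam tau mk r_gt0).
Local Notation sL := (mark_shot r_gt0).
Local Notation mu := (@lebesgue_measure R).
Let noise_ge0 := noise_ge0 tau mk.
Implicit Types s : shot R.

Lemma one_shot_subproof (x : R) : (0 : R) <= cst 0 x. Proof. by []. Qed.
(** Its noise is constantly 1, so that first moments are second moments against it. *)
Definition one_shot : shot R :=
  Shot one_shot_subproof (@measurable_cst _ _ R R setT (0 : R)) (lexx 0) ler01.

Lemma count_shot_subproof (x : R) : (0 : R) <= cst 1 x. Proof. exact: ler01. Qed.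
(** For c = mu the noise sums the survival probabilities of the past arrivals, for c = 2 mu their
    squares. *)
Definition count_shot (c : R) (c0 : 0 <= c) : shot R :=
  Shot count_shot_subproof (@measurable_cst _ _ R R setT (1 : R)) c0 (lexx 0).

Lemma noise_one u w : noise one_shot u w = 1.
Proof.
rewrite /noise /noise_after/= oppr0 mul0r expR0 mulr1 big1 ?addr0// => i _.
by rewrite mul0r.
Qed.

Lemma pos_part_square_integral : (\int[P]_w (Num.max 0 (B w) * Num.max 0 (B w))%:E = b2%:E)%E.
Proof.
rewrite -b2E expectation.unlock; apply: ae_eq_integral => //.
- by apply/measurable_EFinP; apply: measurable_funM; apply: measurable_maxr.
- by apply/measurable_EFinP; exact: measurable_funX.
- by have := ae_pos B_pos; apply: filterS => w B0 _; rewrite max_r ?ltW// expr2.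
Qed.

Let mB : measurable_fun setT (fun w => Num.max 0 (B w)).
Proof. exact: measurable_maxr. Qed.

Lemma one_shot_weight : (\int[P]_w (weight one_shot (B w))%:E = 0%:E)%E.
Proof. by apply: integral0_eq. Qed.
Lemma mark_shot_weight : (\int[P]_w (weight sL (B w))%:E = b1%:E)%E.
Proof. exact: (pos_part_integral B_pos b1E). Qed.
Lemma mark_shot_weight2 : (\int[P]_w (weight sL (B w) * weight sL (B w))%:E = b2%:E)%E.
Proof. exact: pos_part_square_integral. Qed.
Lemma count_shot_weight (c : R) (c0 : 0 <= c) : (\int[P]_w (weight (count_shot c0) (B w))%:E = 1%:E)%E.
Proof. by rewrite /= integral_cst//= probability_setT mule1. Qed.

Lemma wide_shot_weight : (\int[P]_w (weight (wide_shot R) (B w))%:E = (1 + b1)%:E)%E.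
Proof.
rewrite /=; under eq_integral do rewrite EFinD.
rewrite ge0_integralD//; last 2 first.
- by move=> w _; rewrite lee_fin le_max lexx.
- exact/measurable_EFinP.
by rewrite integral_cst//= probability_setT mule1 (pos_part_integral B_pos b1E).
Qed.

Lemma wide_shot_weight2 :
  (\int[P]_w (weight (wide_shot R) (B w) * weight (wide_shot R) (B w))%:E = (1 + b1 + (b1 + b2))%:E)%E.
Proof.
have h0 w : 0 <= Num.max 0 (B w) by rewrite le_max lexx.
rewrite (eq_integral (fun w => (1 + Num.max 0 (B w))%:E +
  (Num.max 0 (B w) + Num.max 0 (B w) * Num.max 0 (B w))%:E)%E); last first.
  by move=> w _; rewrite -EFinD; congr _%:E; rewrite /=; ring.
rewrite ge0_integralD//; first last.
- by apply/measurable_EFinP; apply: measurable_funD => //; exact: measurable_funM.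
- by move=> w _; rewrite lee_fin addr_ge0// mulr_ge0.
- by apply/measurable_EFinP; exact: measurable_funD.
- by move=> w _; rewrite lee_fin addr_ge0.
rewrite [X in (X + _)%E]wide_shot_weight [in RHS]EFinD; congr (_ + _)%E.
under eq_integral do rewrite EFinD.
rewrite ge0_integralD//; first last.
- by apply/measurable_EFinP; exact: measurable_funM.
- by move=> w _; rewrite lee_fin mulr_ge0.
- by apply/measurable_EFinP.
- by move=> w _; rewrite lee_fin.
by rewrite (pos_part_integral B_pos b1E) pos_part_square_integral.
Qed.

(** The conditions under which [noise_wide] bounds the noise by that of [wide_shot]. *)
Definition narrow s := (forall x, weight s x <= 1 + Num.max 0 x) /\ initial s <= 1.

Lemma narrow_one : narrow one_shot.
Proof. by split => // x /=; rewrite addr_ge0// le_max lexx. Qed.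
Lemma narrow_mark : narrow sL.
Proof. by split => // x /=; rewrite lerDr. Qed.
Lemma narrow_count (c : R) (c0 : 0 <= c) : narrow (count_shot c0).
Proof. by split => // x /=; rewrite lerDl le_max lexx. Qed.

(** The growth rate of [wide_bound] for E(1 + B) = 1 + b1 and E(1 + B)^2 = 1 + b1 + (b1 + b2). *)
Let K : R := (lam + 1) * ((1 + b1) + (1 + b1) + (1 + b1 + (b1 + b2))).

Lemma noise_product_le s s' t : narrow s -> narrow s' -> 0 <= t ->
  (\int[P]_w (noise s t w * noise s' t w)%:E <= (expR (K * t))%:E)%E.
Proof.
move=> [ws is_] [ws' is'] t0.
have mS s0 : measurable_fun setT (noise s0 t) by exact: jointly_slice (jointly_noise hawkes s0).
apply: le_trans (wide_bound lam_gt0 r_gt0 hawkes B_pos b1E wide_shot_weight wide_shot_weight2 t0).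
have mp s0 s1 : measurable_fun setT (fun w => (noise s0 t w * noise s1 t w)%:E).
  by apply/measurable_EFinP; exact: measurable_funM.
apply: ge0_le_integral => //; try (by move=> w _; rewrite lee_fin mulr_ge0).
by move=> w _; rewrite lee_fin ler_pM// (noise_wide hawkes).
Qed.

Lemma noise_product_integrable s s' t : narrow s -> narrow s' -> 0 <= t ->
  P.-integrable setT (EFin \o (fun w => noise s t w * noise s' t w)).
Proof.
move=> ns ns' t0; apply/integrableP; split.
  have mS s0 : measurable_fun setT (noise s0 t) by exact: jointly_slice (jointly_noise hawkes s0).
  by apply/measurable_EFinP; exact: measurable_funM.
apply: le_lt_trans (ltry (expR (K * t))).
rewrite (eq_integral (fun w => (noise s t w * noise s' t w)%:E)); last first.
  by move=> w _; rewrite /= ger0_norm// mulr_ge0.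
exact: noise_product_le.
Qed.

Definition moment s s' t : R := (\int[P]_w (noise s t w * noise s' t w))%R.

Lemma momentE s s' t : narrow s -> narrow s' -> 0 <= t ->
  (\int[P]_w (noise s t w * noise s' t w)%:E = (moment s s' t)%:E)%E.
Proof.
move=> ns ns' t0; rewrite /moment /Rintegral fineK//.
exact: integrable_fin_num (noise_product_integrable ns ns' t0).
Qed.

Lemma moment_one t : moment one_shot one_shot t = 1.
Proof.
rewrite /moment (@eq_Rintegral _ _ _ P setT (cst 1)); last by move=> w _; rewrite !noise_one mulr1.
by rewrite Rintegral_cst//= probability_setT mulr1.
Qed.

Lemma moment_ge0 s s' t : 0 <= moment s s' t.
Proof. by apply: Rintegral_ge0 => w _; rewrite mulr_ge0. Qed.

Lemma moment_measurable s s' : measurable_fun setT (moment s s').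
Proof.
apply: (measurableT_comp (f := fine)) => //.
by apply: (jointly_integral P); apply: jointlyM; exact: (jointly_noise hawkes).
Qed.

Lemma moment_bounded s s' (T0 : R) : narrow s -> narrow s' ->
  forall t, 0 <= t <= T0 -> `|moment s s' t| <= expR (`|K| * T0).
Proof.
move=> ns ns' t /andP[t0 tT]; rewrite ger0_norm ?moment_ge0// -lee_fin -momentE//.
rewrite (le_trans (noise_product_le ns ns' t0))// lee_fin ler_expR.
apply: (@le_trans _ _ (`|K| * t)); first by rewrite ler_wpM2r// ler_norm.
by rewrite ler_wpM2l.
Qed.

(** Mean of the integrand in [noise_product_integral], without its decay factor and with the
    intensity written as lam plus the noise of [mark_shot]. Only second moments of noises occur, so
    the system is closed. *)
Definition moment_source s s' (es es' ess' : R) (u : R) : R :=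
  es * (lam * moment s' one_shot u + moment sL s' u) +
  (es' * (lam * moment s one_shot u + moment sL s u) + ess' * (lam * moment one_shot one_shot u + moment sL one_shot u)).

Lemma pos_intensity_noise_integral s (u : R) : narrow s -> 0 <= u ->
  P.-integrable setT (EFin \o (fun w => pos_intensity u w * noise s u w)) /\
  (\int[P]_w (pos_intensity u w * noise s u w))%R = lam * moment s one_shot u + moment sL s u.
Proof.
move=> ns u0.
have i1 := noise_product_integrable ns narrow_one u0.
have i2 := noise_product_integrable narrow_mark ns u0.
have i1' : P.-integrable setT (EFin \o (fun w => lam * (noise s u w * noise one_shot u w))).
  by apply: eq_integrable (integrableZl measurableT lam i1) => // w _; rewrite /= EFinM.
have E w : pos_intensity u w * noise s u w =
    lam * (noise s u w * noise one_shot u w) + noise sL u w * noise s u w.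
  by rewrite noise_one /pos_intensity; ring.
split.
  by apply: eq_integrable (integrableD measurableT i1' i2) => // w _; rewrite /= E EFinD.
under eq_Rintegral do rewrite E.
by rewrite RintegralD// RintegralZl.
Qed.

Lemma moment_renewal s s' (es es' ess' t : R) : narrow s -> narrow s' -> 0 <= t ->
  (\int[P]_w (weight s (B w))%:E = es%:E)%E ->
  (\int[P]_w (weight s' (B w))%:E = es'%:E)%E ->
  (\int[P]_w (weight s (B w) * weight s' (B w))%:E = ess'%:E)%E ->
  moment s s' t = initial s * initial s' * expR (- (rate s + rate s') * t) +
    (\int[mu]_(u in `[0, t]) (expR (- (rate s + rate s') * (t - u)) * moment_source s s' es es' ess' u))%R.
Proof.
move=> ns ns' t0 Es Es' Ess'.
have tot := momentE ns ns' t0.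
rewrite (noise_product_integral lam_gt0 r_gt0 hawkes B_pos b1E t0 Es Es' Ess') in tot.
have inner u : 0 <= u -> (\int[P]_w (expR (- (rate s + rate s') * (t - u)) *
     (pos_intensity u w * (es * noise s' u w + es' * noise s u w + ess')))%:E =
   (expR (- (rate s + rate s') * (t - u)) * moment_source s s' es es' ess' u)%:E)%E.
  move=> u0.
  have [i1 E1] := pos_intensity_noise_integral ns' u0.
  have [i2 E2] := pos_intensity_noise_integral ns u0.
  have [i3 E3] := pos_intensity_noise_integral narrow_one u0.
  have iZ (f : T -> R) k : P.-integrable setT (EFin \o f) -> P.-integrable setT (EFin \o (fun w => k * f w)).
    by move=> h; apply: eq_integrable (integrableZl measurableT k h) => // w _; rewrite /= EFinM.
  have iD (f g : T -> R) : P.-integrable setT (EFin \o f) -> P.-integrable setT (EFin \o g) ->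
      P.-integrable setT (EFin \o (fun w => f w + g w)).
    by move=> h1 h2; apply: eq_integrable (integrableD measurableT h1 h2) => // w _; rewrite /= EFinD.
  pose F w := es * (pos_intensity u w * noise s' u w) + (es' * (pos_intensity u w * noise s u w) + ess' * (pos_intensity u w * noise one_shot u w)).
  have iF : P.-integrable setT (EFin \o F) by apply: (iD); [exact: iZ|apply: iD; exact: iZ].
  have EF : (\int[P]_w F w)%R = moment_source s s' es es' ess' u.
    rewrite /F RintegralD//; [|exact: iZ|by apply: iD; exact: iZ].
    rewrite RintegralD//; [|exact: iZ|exact: iZ].
    by rewrite !RintegralZl// E1 E2 E3.
  rewrite -EF -RintegralZl// /Rintegral fineK; last exact: integrable_fin_num (iZ _ _ iF).
  by apply: eq_integral => w _; congr _%:E; rewrite /F noise_one; ring.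
rewrite /time_integral in tot; set I := (X in (_ + X)%E) in tot.
have EI : I = (\int[mu]_(u in `[0%R, t]) (expR (- (rate s + rate s') * (t - u)) * moment_source s s' es es' ess' u)%:E)%E.
  by apply: eq_integral => u; rewrite inE/= in_itv/= => /andP[u0 _]; exact: inner.
rewrite EI in tot.
(* [Rintegral] is 0 on an infinite integral; since the total is finite, this case does not arise. *)
rewrite /Rintegral; move: tot; case: (integral _ _ _) => [i| |] //.
by rewrite -EFinD => -[<-].
Qed.

End moments.

(** * Explicit solutions of the moment equations *)

Section expsum.
Context (R : realType).

(** Pairs of a coefficient and an exponent. All moments and sources have this form, so that a
    differential equation becomes an algebraic identity for [field]. *)
Definition expsum (l : seq (R * R)) (u : R) : R := \sum_(p <- l) p.1 * expR (p.2 * u).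

Lemma is_derive_expsum l (x : R) :
  is_derive x (1 : R) (expsum l) (\sum_(p <- l) p.1 * (p.2 * expR (p.2 * x))).
Proof.
elim: l => [|p l IHl].
  rewrite big_nil (_ : expsum _ = cst 0); first exact: is_derive_cst.
  by apply/funext => u; rewrite /expsum big_nil.
rewrite big_cons (_ : expsum _ = (p.1 \*: (fun u => expR (p.2 * u))) + expsum l).
  by apply: is_deriveD; apply: is_deriveZ; exact: is_derive_expR_mul.
by apply/funext => u; rewrite /expsum big_cons.
Qed.

Lemma continuous_expsum l : continuous (expsum l).
Proof.
move=> x; apply: differentiable_continuous; apply/derivable1_diffP.
by have := is_derive_expsum l x; case.
Qed.

End expsum.

Section solutions.
Context d (T : measurableType d) (R : realType) (P : probability T R) (lam r : R)
  (B : {RV P >-> R}) (tau mk : nat -> {RV P >-> R}) (b1 b2 : R).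
Hypotheses (lam_gt0 : 0 < lam) (r_gt0 : 0 < r).
Hypothesis hawkes : markovian_hawkes lam r B tau mk.
Hypothesis B_pos : P [set w | 0 < B w] = 1%E.
Hypothesis b1E : ('E_P[B] = b1%:E)%E.
Hypothesis b2E : ('E_P[fun w => (B w ^+ 2)%R] = b2%:E)%E.

Local Notation sL := (mark_shot r_gt0).
Local Notation moment := (moment tau mk).
Local Notation source := (moment_source lam tau mk r_gt0).
Implicit Types s : shot R.

(** Uniqueness reduces a moment to two checks on a guessed list l, the differential equation and the
    initial value. The coefficient b collects the occurrences of the moment in its own source, lg
    the moments already solved. *)
Lemma moment_solution s s' (es es' ess' b : R) (l lg : seq (R * R)) : narrow s -> narrow s' ->
  (\int[P]_w (weight s (B w))%:E = es%:E)%E ->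
  (\int[P]_w (weight s' (B w))%:E = es'%:E)%E ->
  (\int[P]_w (weight s (B w) * weight s' (B w))%:E = ess'%:E)%E ->
  (forall u, 0 <= u -> source s s' es es' ess' u = expsum lg u + b * moment s s' u) ->
  (forall x, \sum_(p <- l) p.1 * (p.2 * expR (p.2 * x)) =
     (b - (rate s + rate s')) * expsum l x + expsum lg x) ->
  expsum l 0 = initial s * initial s' ->
  forall t, 0 <= t -> moment s s' t = expsum l t.
Proof.
move=> ns ns' Es Es' Ess' srcE dl l0 t t0.
apply: (@volterra_unique _ (moment s s') (expsum l) (expsum lg) (rate s + rate s') b
  (initial s * initial s') t) => //.
- exact: (moment_measurable hawkes).
- exact: (moment_bounded lam_gt0 r_gt0 hawkes B_pos b1E b2E ns ns').
- exact: continuous_expsum.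
- move=> v /andP[v0 _].
  rewrite {1}(moment_renewal lam_gt0 r_gt0 hawkes B_pos b1E b2E ns ns' v0 Es Es' Ess'); congr (_ + _).
  apply: eq_Rintegral => u; rewrite inE/= in_itv/= => /andP[u0 _].
  by rewrite srcE.
- by move=> x; apply: (is_derive_eq (is_derive_expsum l x)).
- by rewrite t0 lexx.
Qed.

Local Notation r0 := (r - b1).
Hypothesis r0_neq0 : r0 != 0.

(** Mean intensity minus lam: the solution of m' = b1 lam - r0 m with m(0) = 0. *)
Definition sol_L : seq (R * R) := [:: (lam * b1 / r0, 0); (- (lam * b1 / r0), - r0)].

Let expsumE := (big_cons, big_nil, mul0r, expR0, mulr0, addr0, mulr1).

Lemma moment_L t : 0 <= t -> moment sL (one_shot R) t = expsum sol_L t.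
Proof.
apply: (@moment_solution _ _ b1 0 0 b1 sol_L [:: (b1 * lam, 0)]).
- exact: narrow_mark.
- exact: narrow_one.
- exact: (mark_shot_weight r_gt0 B_pos b1E).
- exact: one_shot_weight.
- by apply: integral0_eq => w _; rewrite /= mulr0.
- move=> u u0; rewrite /moment_source moment_one /expsum !expsumE/=; ring.
- move=> x; rewrite /expsum /sol_L !big_cons !big_nil/= !mul0r expR0.
  by set E := expR _; field.
- by rewrite /expsum /sol_L !expsumE/=; ring.
Qed.

(** [moment_LL] less lam^2 and 2 lam times [sol_L], from expanding the square of lam plus noise. *)
Definition sol_LL (D1 : R) : seq (R * R) :=
  [:: (lam * r * (b2 + 2 * lam * r) / (2 * r0 ^+ 2) - lam ^+ 2 - 2 * lam * (lam * b1 / r0), 0);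
      (- (lam * b1 * (b2 + 2 * lam * r) / r0 ^+ 2) + 2 * lam * (lam * b1 / r0), - r0);
      (D1, - 2 * r0)].

Lemma moment_LLE D1 t : 0 <= t -> moment_LL lam r b1 b2 D1 0 = lam ^+ 2 ->
  moment sL sL t = expsum (sol_LL D1) t.
Proof.
move=> t0 D1E; move: t t0.
apply: (@moment_solution _ _ b1 b1 b2 (2 * b1) (sol_LL D1)
  [:: (2 * b1 * lam * (lam * b1 / r0) + b2 * (lam + lam * b1 / r0), 0);
      (- (lam * b1 / r0) * (2 * b1 * lam + b2), - r0)]).
- exact: narrow_mark.
- exact: narrow_mark.
- exact: (mark_shot_weight r_gt0 B_pos b1E).
- exact: (mark_shot_weight r_gt0 B_pos b1E).
- exact: (mark_shot_weight2 r_gt0 B_pos b2E).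
- move=> u u0; rewrite /moment_source moment_one moment_L// /expsum /sol_L !expsumE/=; ring.
- move=> x; rewrite /expsum /sol_LL !big_cons !big_nil/= !mul0r expR0.
  set E := expR (- r0 * x); set F := expR _; field.
  exact: r0_neq0.
- move: D1E; rewrite /moment_LL /expsum /sol_LL !expsumE/= => D1E.
  rewrite (_ : D1 = lam ^+ 2 - (lam * r * (b2 + 2 * lam * r) / (2 * r0 ^+ 2)
    - lam * b1 * (b2 + 2 * lam * r) / r0 ^+ 2)); first by ring.
  by rewrite -D1E; ring.
Qed.

Lemma sol_LL_sum D1 t : lam ^+ 2 + 2 * lam * expsum sol_L t + expsum (sol_LL D1) t =
  moment_LL lam r b1 b2 D1 t.
Proof.
rewrite /expsum /sol_L /sol_LL /moment_LL !big_cons !big_nil/= !mul0r expR0.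
by set E := expR (- r0 * t); set F := expR _; field.
Qed.

Section count.
Context (c : R) (c_gt0 : 0 < c) (cr0 : c - r0 != 0).
Local Notation sK := (count_shot (ltW c_gt0)).

(** Mean number of customers for service rate c. Besides c = mu, the value c = 2 mu serves for the
    squared survival probabilities. *)
Definition sol_K : seq (R * R) :=
  [:: (lam * r / (c * r0), 0); (lam * (r - c) / (c * (c - r0)), - c);
      (- (lam * b1 / (r0 * (c - r0))), - r0)].

Lemma moment_K t : 0 <= t -> moment sK (one_shot R) t = expsum sol_K t.
Proof.
have c0 := lt0r_neq0 c_gt0.
apply: (@moment_solution _ _ 1 0 0 0 sol_K
  [:: (lam + lam * b1 / r0, 0); (- (lam * b1 / r0), - r0)]).
- exact: narrow_count.
- exact: narrow_one.
- exact: count_shot_weight.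
- exact: one_shot_weight.
- by apply: integral0_eq => w _; rewrite /= mulr0.
- move=> u u0; rewrite /moment_source moment_one moment_L// /expsum /sol_L !expsumE/=; ring.
- move=> x; rewrite /expsum /sol_K !big_cons !big_nil/= !mul0r expR0.
  set E := expR (- r0 * x); set F := expR _; field.
  by rewrite c0 r0_neq0 cr0.
- rewrite /expsum /sol_K !expsumE/=; field.
  by rewrite c0 r0_neq0 cr0.
Qed.

End count.

Section count_products.
Context (mu : R) (mu_gt0 : 0 < mu) (mur0 : mu - r0 != 0) (mupr0 : mu + r0 != 0).
Context (D1 D2 : R) (D1E : moment_LL lam r b1 b2 D1 0 = lam ^+ 2)
  (D2E : moment_LN lam r mu b1 b2 D1 D2 0 = 0).
Local Notation sK := (count_shot (ltW mu_gt0)).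

(** [moment_LN] less lam times the mean number of customers, as the intensity is lam plus noise. *)
Definition sol_LK : seq (R * R) :=
  [:: (lam * r / (r0 * (mu + r0))
        * ((b2 + 2 * lam * r) / (2 * r0) + (lam * r + mu * b1) / mu) - lam * (lam * r / (mu * r0)), 0);
      (lam ^+ 2 * r * (r - mu) / (mu * r0 * (mu - r0)) - lam * (lam * (r - mu) / (mu * (mu - r0))), - mu);
      (- (lam * b1 / (mu * r0)
    * (b1 + (b2 + 2 * lam * r) / r0 + lam * r / (mu - r0))) + lam * (lam * b1 / (r0 * (mu - r0))), - r0);
      (D1 / (mu - r0), - 2 * r0); (D2, - (mu + r0))].

Lemma sol_LN_sum t : lam * expsum (sol_K mu) t + expsum sol_LK t = moment_LN lam r mu b1 b2 D1 D2 t.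
Proof.
have mu0 := lt0r_neq0 mu_gt0.
rewrite /expsum /sol_K /sol_LK /moment_LN !big_cons !big_nil/= !mul0r expR0.
set E := expR (- r0 * t); set F := expR (- 2 * r0 * t); set G := expR (- mu * t); set H := expR _; field.
by rewrite mu0 r0_neq0 mur0.
Qed.

Lemma moment_LK t : 0 <= t -> moment sL sK t = expsum sol_LK t.
Proof.
have mu0 := lt0r_neq0 mu_gt0.
apply: (@moment_solution _ _ b1 1 b1 b1 sol_LK
  [:: (b1 * lam * (lam * r / (mu * r0)) + lam * (lam * b1 / r0) + b1 * (lam + lam * b1 / r0) +
       (lam * r * (b2 + 2 * lam * r) / (2 * r0 ^+ 2) - lam ^+ 2 - 2 * lam * (lam * b1 / r0)), 0);
      (b1 * lam * (lam * (r - mu) / (mu * (mu - r0))), - mu);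
      (- (b1 * lam * (lam * b1 / (r0 * (mu - r0)))) - (lam + b1) * (lam * b1 / r0) +
       (- (lam * b1 * (b2 + 2 * lam * r) / r0 ^+ 2) + 2 * lam * (lam * b1 / r0)), - r0);
      (D1, - 2 * r0)]).
- exact: narrow_mark.
- exact: narrow_count.
- exact: (mark_shot_weight r_gt0 B_pos b1E).
- exact: count_shot_weight.
- by under eq_integral do rewrite /= mulr1; exact: (mark_shot_weight r_gt0 B_pos b1E).
- move=> u u0; rewrite /moment_source moment_one moment_L// moment_K// (moment_LLE u0 D1E).
  rewrite /expsum /sol_L /sol_LL /sol_K !expsumE/=.
  by move: (moment _ _ _) => m; ring.
- move=> x; rewrite /expsum /sol_LK !big_cons !big_nil/= !mul0r expR0.
  set E := expR (- r0 * x); set F := expR (- 2 * r0 * x); set G := expR (- mu * x); set H := expR _; field.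
  by rewrite mu0 r0_neq0 mur0 mupr0.
(* The mean number of customers is 0 at time 0, so the list has the initial value of [moment_LN],
   which D2 makes 0. *)
- have := sol_LN_sum 0; rewrite D2E.
  have -> : expsum (sol_K mu) 0 = 0.
    rewrite /expsum /sol_K !expsumE/=; field.
    by rewrite mu0 r0_neq0 mur0.
  by rewrite mulr0 add0r => ->; rewrite /= mulr0.
Qed.

Hypothesis mu2r0 : 2 * mu - r0 != 0.
Context (D3 : R) (D3E : moment_NN lam r mu b1 b2 D1 D2 D3 0 = 0).

Definition sol_NN : seq (R * R) :=
  [:: (lam * r / (mu * r0 * (mu + r0))
    * ((b2 + 2 * lam * r) / (2 * r0) + (mu * (mu + r) + lam * r) / mu), 0);
      (lam * (r - mu) * (mu * r0 + 2 * lam * r) / (mu ^+ 2 * r0 * (mu - r0)), - mu);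
      (- (2 * lam * b1 / (mu * r0 * (2 * mu - r0))
    * (b1 + (b2 + 2 * lam * r) / r0 + lam * r / (mu - r0)
       + mu / 2 * ((2 * mu - r0) / (mu - r0)))), - r0);
      (D1 / (mu - r0) ^+ 2, - 2 * r0);
      (2 * D2 / (mu - r0), - (mu + r0));
      (D3, - 2 * mu)].

(** E K^2 = E N^2 - E K + E K', term by term; K' contributes [sol_K] at rate 2 mu. *)
Definition sol_KK : seq (R * R) :=
  sol_NN ++ [:: (- (lam * r / (mu * r0)), 0); (- (lam * (r - mu) / (mu * (mu - r0))), - mu);
      (lam * b1 / (r0 * (mu - r0)), - r0)] ++
  [:: (lam * r / ((2 * mu) * r0), 0); (lam * (r - 2 * mu) / (2 * mu * (2 * mu - r0)), - 2 * mu);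
      (- (lam * b1 / (r0 * (2 * mu - r0))), - r0)].

Lemma sol_NN_sum t : expsum sol_KK t + expsum (sol_K mu) t - expsum (sol_K (2 * mu)) t =
  moment_NN lam r mu b1 b2 D1 D2 D3 t.
Proof.
rewrite /expsum /sol_K /sol_KK /sol_NN /moment_NN !big_cat !big_cons !big_nil/= !mul0r expR0.
rewrite -[- (2 * mu)]mulNr.
set E := expR (- r0 * t); set F := expR (_ * r0 * t); set G := expR (- mu * t); set H := expR (- (mu + _) * _).
set I := expR (_ * mu * _).
by ring.
Qed.

(** The arrival rate does not depend on the count noise, so this moment is absent from its own
    source and b = 0. *)
Lemma moment_KK t : 0 <= t -> moment sK sK t = expsum sol_KK t.
Proof.
have mu0 := lt0r_neq0 mu_gt0.
apply: (@moment_solution _ _ 1 1 1 0 sol_KK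
  [:: (2 * lam * (lam * r / (mu * r0)) + (lam + lam * b1 / r0) +
       2 * (lam * r / (r0 * (mu + r0))
        * ((b2 + 2 * lam * r) / (2 * r0) + (lam * r + mu * b1) / mu) - lam * (lam * r / (mu * r0))), 0);
      (2 * lam * (lam * (r - mu) / (mu * (mu - r0))) +
       2 * (lam ^+ 2 * r * (r - mu) / (mu * r0 * (mu - r0)) - lam * (lam * (r - mu) / (mu * (mu - r0)))), - mu);
      (- (2 * lam * (lam * b1 / (r0 * (mu - r0)))) - lam * b1 / r0 +
       2 * (- (lam * b1 / (mu * r0)
    * (b1 + (b2 + 2 * lam * r) / r0 + lam * r / (mu - r0))) + lam * (lam * b1 / (r0 * (mu - r0)))), - r0);
      (2 * (D1 / (mu - r0)), - 2 * r0); (2 * D2, - (mu + r0))]).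
- exact: narrow_count.
- exact: narrow_count.
- exact: count_shot_weight.
- exact: count_shot_weight.
- by under eq_integral do rewrite /= mulr1; exact: count_shot_weight.
- move=> u u0; rewrite /moment_source moment_one moment_L// moment_K// moment_LK//.
  rewrite /expsum /sol_L /sol_LK /sol_K !expsumE/=.
  by ring.
- move=> x; rewrite /expsum /sol_KK /sol_NN !big_cat !big_cons !big_nil/= !mul0r expR0.
  set E := expR (- r0 * x); set F := expR (- 2 * r0 * x); set G := expR (- mu * x).
  set H := expR (- (mu + _) * x); set I := expR _; field.
  by rewrite mu0 r0_neq0 mur0 mupr0 mu2r0.
- have := sol_NN_sum 0; rewrite D3E.
  have mm : mu + mu != 0 by rewrite gt_eqF// addr_gt0.
  have -> : expsum (sol_K mu) 0 = 0.
    by rewrite /expsum /sol_K !expsumE/=; field; rewrite mu0 r0_neq0 mur0.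
  have -> : expsum (sol_K (2 * mu)) 0 = 0.
    by rewrite /expsum /sol_K !expsumE/=; field; rewrite mu0 r0_neq0 mu2r0.
  by rewrite addr0 subr0 => ->; rewrite /= mulr0.
Qed.

End count_products.

End solutions.

(** * Customers *)

(** By complement: there is no mass below 0, and the mass of [0, x] is 1 - exp(- mu x). *)
Lemma exponential_prob_gt (R : realType) (mu x : R) (Q : probability R R) : 0 < mu -> 0 < x ->
  (forall C : set R, measurable C -> Q C = exponential_prob mu C) ->
  Q `]x, +oo[%classic = (expR (- mu * x))%:E.
Proof.
move=> mu0 x0 QE.
have E : [set: R] = (`]-oo, 0[ `|` `[0, x]) `|` `]x, +oo[.
  apply/seteqP; split => // y _ /=; rewrite !in_itv/= andbT.
  have [|y0] := ltP y 0; first by left; left.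
  by have [|xy] := leP y x; [left; right|right].
have q0 : Q `]-oo, 0[%classic = 0%E.
  rewrite QE//; apply: integral0_eq => y /=; rewrite in_itv/= => y0.
  by rewrite lt0_exponential_pdf.
have h : (Q `]-oo, 0%R[%classic + Q `[0%R, x]%classic + Q `]x, +oo[%classic = 1)%E.
  rewrite -(probability_setT Q) E.
  rewrite measureU//; last 2 first.
  - by apply: measurableU.
  - apply/seteqP; split => // y [] [] /=; rewrite !in_itv/= andbT.
      by move=> y0 /(lt_trans x0)/(lt_trans y0); rewrite ltxx.
    by move=> /andP[_ yx] /(le_lt_trans yx); rewrite ltxx.
  rewrite measureU//.
  by apply/seteqP; split => // y [] /=; rewrite !in_itv/= => y0 /andP[/le_lt_trans/(_ y0)]; rewrite ltxx.
rewrite q0 add0e (QE `[0, x]%classic)// exponential_prob_itv0c// in h.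
have fQ : Q `]x, +oo[%classic \is a fin_num by exact: fin_num_measure.
move: h; rewrite -(fineK fQ) -EFinB -EFinD => -[h].
by congr _%:E; lra.
Qed.

(** * Survival of a customer given arrivals and earlier services *)

Section services.
Context d (T : measurableType d) (R : realType) (P : probability T R) (lam r mu : R)
  (B : {RV P >-> R}) (tau mk srv : nat -> {RV P >-> R}).
Hypothesis mu_gt0 : 0 < mu.
Hypothesis queue : hawkes_infinite_server lam r mu B tau mk srv.
Let hawkes := hawkes_arrivals queue.

Local Notation noise := (noise tau mk).
Local Notation noise_upto := (noise_upto tau mk).
Implicit Types (s : shot R) (t : R).

(** All epochs and all marks, but only the first n services, so that [srv n] is independent of the
    generated sigma-algebra. *)
Definition service_sets n : set (set T) :=
  \bigcup_(X in (range (fun k => tau k : T -> R) `|` range (fun k => mk k : T -> R) `|`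
     [set (srv k : T -> R) | k in `I_n])) preimage_set_system setT X (@measurable _ R).

Lemma service_sets_measurable n : <<s service_sets n >> `<=` measurable.
Proof.
apply: smallest_sub; first exact: sigma_algebra_measurable.
by move=> _ [_ [[[k _ <-]|[k _ <-]]|[k _ <-]] [C mC <-]]; rewrite setTI; exact: measurable_funPTI.
Qed.

Local Notation SG n := (g_sigma_algebraType (service_sets n)).

Lemma service_measurable_fun n d' (S : measurableType d') (f : T -> S) :
  measurable_fun setT (f : SG n -> S) -> measurable_fun setT f.
Proof. by move=> mf mT Y mY; apply: (@service_sets_measurable n); exact: mf. Qed.

Lemma service_measurable_epoch n k : measurable_fun setT (tau k : SG n -> R).
Proof.
move=> _ Y mY; apply: sub_sigma_algebra; exists (tau k); last by exists Y.
by left; left; exists k.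
Qed.

Lemma service_measurable_mark n k : measurable_fun setT (mk k : SG n -> R).
Proof.
move=> _ Y mY; apply: sub_sigma_algebra; exists (mk k); last by exists Y.
by left; right; exists k.
Qed.

Lemma service_measurable_service n k : (k < n)%N -> measurable_fun setT (srv k : SG n -> R).
Proof.
move=> kn _ Y mY; apply: sub_sigma_algebra; exists (srv k); last by exists Y.
by right; exists k.
Qed.

Lemma service_measurable_noise_upto s n t m : measurable_fun setT (noise_upto s m t : SG n -> R).
Proof.
apply: measurable_funD => //.
apply: measurable_sum => i; apply: measurable_funM.
  by apply: measurable_boolR; apply: measurable_fun_ltr => //; exact: service_measurable_epoch.
apply: measurable_funM.
  by apply: (measurableT_comp (weight_measurable s)); exact: service_measurable_mark.
apply: measurableT_comp => //; apply: measurable_funM => //; apply: measurable_funB => //.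
exact: service_measurable_epoch.
Qed.

Lemma service_measurable_noise s n t : measurable_fun setT (noise s t : SG n -> R).
Proof.
apply: (@measurable_fun_cvg _ (SG n) _ setT (fun m => noise_upto s m t)) => //.
  by move=> m; exact: service_measurable_noise_upto.
move=> w _; apply: cvg_near_cst; exists (epochs_before tau t w) => // m /= nm.
exact: (noise_uptoE hawkes).
Qed.

(** Strict in [tau i w < t], like [noise], whereas [customers] admits an arrival at t;
    [ae_customers] bridges the difference. *)
Definition present i t w : R := (tau i w < t)%R%:R * (t < tau i w + srv i w)%R%:R.
Definition survival i t w : R := (tau i w < t)%R%:R * expR (- mu * (t - tau i w)).

Lemma present_ge0 i t w : 0 <= present i t w. Proof. exact: mulr_ge0. Qed.
Lemma survival_ge0 i t w : 0 <= survival i t w. Proof. by rewrite mulr_ge0// expR_ge0. Qed.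

Lemma service_measurable_present i n t : (i < n)%N -> measurable_fun setT (present i t : SG n -> R).
Proof.
move=> i_n; apply: measurable_funM; apply: measurable_boolR; apply: measurable_fun_ltr => //.
- exact: service_measurable_epoch.
- by apply: measurable_funD; [exact: service_measurable_epoch|exact: service_measurable_service].
Qed.

Lemma service_measurable_survival i n t : measurable_fun setT (survival i t : SG n -> R).
Proof.
apply: measurable_funM.
  by apply: measurable_boolR; apply: measurable_fun_ltr => //; exact: service_measurable_epoch.
apply: measurableT_comp => //; apply: measurable_funM => //; apply: measurable_funB => //.
exact: service_measurable_epoch.
Qed.

(** Given all epochs, all marks and the earlier services, the service of index n outlasts t - tau_n
    with probability exp(- mu (t - tau_n)). *)
Lemma present_integral n t (Y : T -> R) : (forall w, 0 <= Y w) ->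
  measurable_fun setT (Y : SG n -> R) ->
  (\int[P]_w (Y w * present n t w)%:E = \int[P]_w (Y w * survival n t w)%:E)%E.
Proof.
move=> Y0 mY.
pose F (z : R * SG n) := (Y z.2 * ((tau n z.2 < t)%R%:R * (t - tau n z.2 < z.1)%R%:R))%:E.
have mt2 : measurable_fun setT (fun z : R * SG n => tau n z.2).
  by apply: (measurableT_comp (@service_measurable_epoch n n)); exact: measurable_snd.
have mF : measurable_fun setT F.
  apply/measurable_EFinP; apply: measurable_funM.
    by apply: (measurableT_comp mY); exact: measurable_snd.
  apply: measurable_funM; apply: measurable_boolR; apply: measurable_fun_ltr => //.
    by apply: measurable_funB.
have F0 z : (0 <= F z)%E by rewrite lee_fin !mulr_ge0.
have iX : independent_of P (srv n) <<s service_sets n >>.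
  by move=> A C GA mC; exact: (services_independent queue).
transitivity (\int[P]_w F (srv n w, w))%E.
  by apply: eq_integral => w _; rewrite /F /present/= ltrBlDl.
rewrite (ge0_integral_independent (@service_sets_measurable n) iX mF F0).
apply: eq_integral => w _; rewrite /F /survival/=.
have [tn|] := ltP; last by move=> _; under eq_integral do rewrite mul0r mulr0; rewrite integral0 mul0r mulr0.
under eq_integral do rewrite mul1r EFinM.
rewrite ge0_integralZl//; last 2 first.
- by apply/measurable_EFinP; apply: measurable_boolR; exact: measurable_fun_ltr.
- by rewrite lee_fin.
rewrite mul1r EFinM; congr (_ * _)%E.
have d0 : 0 < t - tau n w by rewrite subr_gt0.
rewrite -(exponential_prob_gt mu_gt0 d0 (services_law queue n)).
rewrite -(setIT `](t - tau n w), +oo[%classic) -integral_indic//.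
apply: eq_integral => x _; rewrite indicE; congr (_%:R)%:E; congr nat_of_bool.
by apply/idP/idP; rewrite ?inE/= in_itv/= andbT.
Qed.

End services.

Section integrals.
Context d (T : measurableType d) (R : realType) (P : probability T R).
Implicit Types f g : T -> R.

Lemma ge0_integral_EFinD f g : (forall w, 0 <= f w) -> measurable_fun setT f ->
  (forall w, 0 <= g w) -> measurable_fun setT g ->
  (\int[P]_w (f w + g w)%:E = \int[P]_w (f w)%:E + \int[P]_w (g w)%:E)%E.
Proof.
move=> f0 mf g0 mg; rewrite -ge0_integralD//; try (by move=> w _; rewrite lee_fin);
  exact/measurable_EFinP.
Qed.

(* N counts the customers present among the first arrivals, X and Q are the sums
   of their survival probabilities and of the squares of these; p indicates the
   presence of the next customer, s is the survival probability. *)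
Lemma thinned_square_step (N Q X p s : T -> R) :
  (forall w, [/\ 0 <= N w, 0 <= Q w, 0 <= X w, 0 <= p w & 0 <= s w]) ->
  measurable_fun setT N -> measurable_fun setT Q -> measurable_fun setT X ->
  measurable_fun setT p -> measurable_fun setT s ->
  (\int[P]_w (N w ^+ 2 + Q w)%:E = \int[P]_w (X w ^+ 2 + X w)%:E)%E ->
  (\int[P]_w ((2 * N w + 1) * p w)%:E = \int[P]_w ((2 * N w + 1) * s w)%:E)%E ->
  (\int[P]_w (2 * s w * N w)%:E = \int[P]_w (2 * s w * X w)%:E)%E ->
  (\int[P]_w ((N w ^+ 2 + Q w) + ((2 * N w + 1) * p w + s w ^+ 2))%:E =
   \int[P]_w ((X w ^+ 2 + X w) + (2 * s w * X w + s w + s w ^+ 2))%:E)%E.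
Proof.
move=> pos mN mQ mX mp ms E1 E2 E3.
have N0 w : 0 <= N w by have [] := pos w.
have Q0 w : 0 <= Q w by have [] := pos w.
have X0 w : 0 <= X w by have [] := pos w.
have p0 w : 0 <= p w by have [] := pos w.
have s0 w : 0 <= s w by have [] := pos w.
have mNX (f : T -> R) : measurable_fun setT f -> measurable_fun setT (fun w => 2 * s w * f w).
  by move=> mf; apply: measurable_funM => //; exact: measurable_funM.
have sN0 (f : T -> R) : (forall w, 0 <= f w) -> forall w, 0 <= 2 * s w * f w.
  by move=> f0 w; rewrite !mulr_ge0.
have m2 (f : T -> R) : measurable_fun setT f -> measurable_fun setT (fun w => f w ^+ 2).
  by move=> mf; exact: measurable_funX.
have mN1 : measurable_fun setT (fun w => 2 * N w + 1).
  by apply: measurable_funD => //; exact: measurable_funM.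
have N10 w : 0 <= 2 * N w + 1 by rewrite addr_ge0 ?mulr_ge0.
have mN1p : measurable_fun setT (fun w => (2 * N w + 1) * p w) by exact: measurable_funM.
have N1p0 w : 0 <= (2 * N w + 1) * p w by rewrite mulr_ge0.
have sq0 w : 0 <= s w ^+ 2 by exact: sqr_ge0.
rewrite ge0_integral_EFinD; first last.
- by apply: measurable_funD => //; exact: m2.
- by move=> w; rewrite addr_ge0.
- by apply: measurable_funD => //; exact: m2.
- by move=> w; rewrite addr_ge0// sqr_ge0.
rewrite [in RHS]ge0_integral_EFinD; first last.
- by apply: measurable_funD; [apply: measurable_funD => //; exact: mNX|exact: m2].
- by move=> w; rewrite !addr_ge0// sN0.
- by apply: measurable_funD => //; exact: m2.
- by move=> w; rewrite addr_ge0// sqr_ge0.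
congr (_ + _)%E; first exact: E1.
rewrite ge0_integral_EFinD//; last exact: m2.
rewrite [in RHS]ge0_integral_EFinD//; first last.
- exact: m2.
- by apply: measurable_funD => //; exact: mNX.
- by move=> w; rewrite addr_ge0// sN0.
congr (_ + _)%E; rewrite E2.
(* Regrouped so that N stands only in the term that E3 rewrites in terms of X. *)
transitivity (\int[P]_w (2 * s w * N w + s w)%:E)%E.
  by apply: eq_integral => w _; congr _%:E; ring.
rewrite ge0_integral_EFinD//; [|exact: sN0|exact: mNX].
by rewrite [in RHS]ge0_integral_EFinD// ?E3//; [exact: sN0|exact: mNX].
Qed.

Lemma integral_stationary_cvg (F : nat -> T -> R) f (N : T -> nat) :
  (forall n w, 0 <= F n w) -> (forall n, measurable_fun setT (F n)) ->
  (forall w n m, (n <= m)%N -> F n w <= F m w) ->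
  (forall w n, (N w <= n)%N -> F n w = f w) ->
  (\int[P]_w (F n w)%:E @[n --> \oo] --> \int[P]_w (f w)%:E)%E.
Proof.
move=> F0 mF ndF FN.
rewrite (_ : (\int[P]_w (f w)%:E)%E = (\int[P]_w (limn (fun n => (F n w)%:E)))%E); last first.
  apply: eq_integral => w _; apply/esym/cvg_lim => //.
  by apply: cvg_near_cst; exists (N w) => // n /= nn; rewrite FN.
apply: cvg_monotone_convergence => //.
- by move=> n; apply/measurable_EFinP.
- by move=> n w _; rewrite lee_fin.
- by move=> w _ n m nm; rewrite lee_fin ndF.
Qed.

End integrals.

(** * Thinning of the arrivals by their services *)

Section customers.
Context d (T : measurableType d) (R : realType) (P : probability T R) (lam r mu : R)
  (B : {RV P >-> R}) (tau mk srv : nat -> {RV P >-> R}).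
Hypotheses (lam_gt0 : 0 < lam) (r_gt0 : 0 < r) (mu_gt0 : 0 < mu).
Hypothesis queue : hawkes_infinite_server lam r mu B tau mk srv.
Let hawkes := hawkes_arrivals queue.

Local Notation noise := (noise tau mk).
Local Notation noise_upto := (noise_upto tau mk).
Local Notation epochs_before := (epochs_before tau).
Local Notation pos_intensity := (pos_intensity lam tau mk r_gt0).
Local Notation sK := (count_shot (ltW mu_gt0)).
Hypothesis mu2_gt0 : 0 < 2 * mu.
Local Notation sK2 := (count_shot (ltW mu2_gt0)).
Local Notation present := (present tau srv).
Local Notation survival := (survival mu tau).
Local Notation SG n := (g_sigma_algebraType (service_sets tau mk srv n)).
Let present_ge0 := @present_ge0 _ _ _ _ tau srv.
Let survival_ge0 := @survival_ge0 _ _ _ _ mu tau.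
Implicit Types (t : R).

Definition present_upto n t w : R := \sum_(i < n) present i t w.
Definition present_total t w : R := present_upto (epochs_before t w) t w.

Lemma present_upto_ge0 n t w : 0 <= present_upto n t w.
Proof. exact: sumr_ge0. Qed.

Lemma present_upto_nondecreasing n m t w : (n <= m)%N -> present_upto n t w <= present_upto m t w.
Proof.
move=> nm; rewrite /present_upto -!(big_mkord xpredT (fun i => present i t w)).
by rewrite (big_cat_nat (leq0n n) nm)/= lerDl sumr_ge0.
Qed.

Lemma present_uptoE n t w : (epochs_before t w <= n)%N -> present_upto n t w = present_total t w.
Proof.
move=> nn; rewrite /present_total /present_upto -!(big_mkord xpredT (fun i => present i t w)).
rewrite (big_cat_nat (leq0n _) nn)/= [X in _ + X]big_nat_cond.
rewrite [X in _ + X]big1 ?addr0// => i /andP[/andP[ni _] _].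
have /(upcomingP (epochs_increasing hawkes)) E := epochs_beforeP hawkes t w.
by rewrite /present E ltnNge ni mul0r.
Qed.

Lemma service_measurable_present_upto n t : measurable_fun setT (present_upto n t : SG n -> R).
Proof.
by apply: measurable_sum => i; exact: (@service_measurable_present _ _ _ _ tau mk srv).
Qed.

Lemma measurable_present n t : measurable_fun setT (present n t).
Proof.
apply: (@service_measurable_fun _ _ _ _ tau mk srv n.+1).
exact: service_measurable_present.
Qed.
Lemma measurable_survival n t : measurable_fun setT (survival n t).
Proof.
apply: (@service_measurable_fun _ _ _ _ tau mk srv n).
exact: service_measurable_survival.
Qed.
Lemma measurable_present_upto n t : measurable_fun setT (present_upto n t).
Proof. by apply: measurable_sum => i; exact: measurable_present. Qed.

Lemma noise_upto_count n t w : noise_upto sK n t w = \sum_(i < n) survival i t w.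
Proof. by rewrite /noise_upto/= mul0r add0r; apply: eq_bigr => i _; rewrite mul1r. Qed.

Lemma noise_upto_count2 n t w : noise_upto sK2 n t w = \sum_(i < n) survival i t w ^+ 2.
Proof.
rewrite /noise_upto/= mul0r add0r; apply: eq_bigr => i _; rewrite mul1r /survival exprMn.
rewrite [X in _ = X * _]expr2 -natrM mulnb andbb; congr (_ * _).
by rewrite expr2 -expRD; congr expR; ring.
Qed.

Let mX s n t : measurable_fun setT (noise_upto s n t).
Proof. exact: jointly_slice (jointly_noise_upto tau mk s n). Qed.
Let mI s t : measurable_fun setT (noise s t).
Proof. exact: jointly_slice (jointly_noise hawkes s). Qed.

(** Y is free of services, so [present_integral] replaces the customers by their survival
    probabilities one at a time. *)
Lemma present_upto_integral n t (Y : T -> R) : (forall w, 0 <= Y w) ->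
  (forall k, measurable_fun setT (Y : SG k -> R)) ->
  (\int[P]_w (Y w * present_upto n t w)%:E = \int[P]_w (Y w * noise_upto sK n t w)%:E)%E.
Proof.
move=> Y0 mY; have mYT := service_measurable_fun (mY 0%N).
elim: n => [|n IHn].
  by apply: eq_integral => w _; rewrite noise_upto_count /present_upto !big_ord0.
have -> : (\int[P]_w (Y w * present_upto n.+1 t w)%:E =
    \int[P]_w (Y w * present_upto n t w + Y w * present n t w)%:E)%E.
  by apply: eq_integral => w _; rewrite /present_upto big_ord_recr mulrDr.
have -> : (\int[P]_w (Y w * noise_upto sK n.+1 t w)%:E =
    \int[P]_w (Y w * noise_upto sK n t w + Y w * survival n t w)%:E)%E.
  by apply: eq_integral => w _; rewrite !noise_upto_count big_ord_recr mulrDr.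
rewrite ge0_integral_EFinD; first last.
- by apply: measurable_funM => //; exact: measurable_present.
- by move=> w; rewrite mulr_ge0.
- by apply: measurable_funM => //; exact: measurable_present_upto.
- by move=> w; rewrite mulr_ge0// present_upto_ge0.
rewrite ge0_integral_EFinD; first last.
- by apply: measurable_funM => //; exact: measurable_survival.
- by move=> w; rewrite mulr_ge0.
- exact: measurable_funM.
- by move=> w; rewrite mulr_ge0// noise_upto_ge0.
by rewrite IHn (present_integral mu_gt0 queue t Y0 (mY n)).
Qed.

(** In the notation of [thinned_square_step]: an indicator is its own square, so a further customer
    adds (2 N + 1) p to N^2, with the mean of 2 N s + s, while X^2 gains 2 s X + s^2. The terms s
    and s^2 are balanced by X and Q; keeping Q on the left avoids subtracting integrals that might
    be infinite. *)
Lemma present_upto_square_integral n t :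
  (\int[P]_w (present_upto n t w ^+ 2 + noise_upto sK2 n t w)%:E =
   \int[P]_w (noise_upto sK n t w ^+ 2 + noise_upto sK n t w)%:E)%E.
Proof.
elim: n => [|n IHn].
  apply: eq_integral => w _.
  by rewrite noise_upto_count noise_upto_count2 /present_upto !big_ord0 expr2 mul0r.
have -> : (\int[P]_w (present_upto n.+1 t w ^+ 2 + noise_upto sK2 n.+1 t w)%:E =
  \int[P]_w ((present_upto n t w ^+ 2 + noise_upto sK2 n t w) +
    ((2 * present_upto n t w + 1) * present n t w + survival n t w ^+ 2))%:E)%E.
  apply: eq_integral => w _; congr _%:E.
  rewrite !noise_upto_count2 /present_upto !big_ord_recr/=.
  have pp : present n t w ^+ 2 = present n t w.
    by rewrite /present expr2 mulrACA -!natrM !mulnb !andbb.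
  by rewrite sqrrD pp; ring.
have -> : (\int[P]_w (noise_upto sK n.+1 t w ^+ 2 + noise_upto sK n.+1 t w)%:E =
  \int[P]_w ((noise_upto sK n t w ^+ 2 + noise_upto sK n t w) +
    ((2 * survival n t w * noise_upto sK n t w + survival n t w) + survival n t w ^+ 2))%:E)%E.
  apply: eq_integral => w _; congr _%:E.
  by rewrite !noise_upto_count !big_ord_recr/= sqrrD; ring.
apply: thinned_square_step.
- by move=> w; split; [exact: present_upto_ge0|exact: noise_upto_ge0|exact: noise_upto_ge0|exact: present_ge0|exact: survival_ge0].
- exact: measurable_present_upto.
- exact: mX.
- exact: mX.
- exact: measurable_present.
- exact: measurable_survival.
- exact: IHn.
(* The factor 2 N + 1 is known from the first n services, so only the presence of the next customer
   is averaged. *)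
- apply: (present_integral mu_gt0 queue t).
    by move=> w; apply: addr_ge0; [apply: mulr_ge0; [exact: ler0n|exact: present_upto_ge0]|exact: ler01].
  apply: measurable_funD; last exact: measurable_cst.
  by apply: measurable_funM; [exact: measurable_cst|exact: service_measurable_present_upto].
(* The factor 2 s is free of services, so N itself can be replaced by X. *)
- apply: present_upto_integral.
    by move=> w; apply: mulr_ge0; [exact: ler0n|exact: survival_ge0].
  move=> k; apply: measurable_funM; first exact: measurable_cst.
  exact: service_measurable_survival.
Qed.

(** The intensity is free of services, so [present_upto_integral] applies for each n; monotone
    convergence extends it to all arrivals. *)
Lemma pos_intensity_present_integral t :
  (\int[P]_w (pos_intensity t w * present_total t w)%:E = \int[P]_w (pos_intensity t w * noise sK t w)%:E)%E.
Proof.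
have mL : measurable_fun setT (pos_intensity t) by apply: measurable_funD.
have L0 w : 0 <= pos_intensity t w by exact: pos_intensity_ge0.
have c1 : (\int[P]_w (pos_intensity t w * present_upto n t w)%:E @[n --> \oo] -->
    \int[P]_w (pos_intensity t w * present_total t w)%:E)%E.
  apply: (@integral_stationary_cvg _ _ _ P _ _ (epochs_before t)).
  - by move=> n w; rewrite mulr_ge0// present_upto_ge0.
  - by move=> n; apply: measurable_funM => //; exact: measurable_present_upto.
  - by move=> w n m nm; rewrite ler_wpM2l// present_upto_nondecreasing.
  - by move=> w n nn; rewrite present_uptoE.
have c2 : (\int[P]_w (pos_intensity t w * noise_upto sK n t w)%:E @[n --> \oo] -->
    \int[P]_w (pos_intensity t w * noise sK t w)%:E)%E.
  apply: (@integral_stationary_cvg _ _ _ P _ _ (epochs_before t)).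
  - by move=> n w; rewrite mulr_ge0// noise_upto_ge0.
  - by move=> n; exact: measurable_funM.
  - by move=> w n m nm; rewrite ler_wpM2l// noise_upto_nondecreasing.
  - by move=> w n nn; rewrite (noise_uptoE hawkes).
rewrite (_ : (fun n => _) = (fun n => \int[P]_w (pos_intensity t w * noise_upto sK n t w)%:E)%E) in c1.
  exact: (cvg_unique _ c1 c2).
apply/funext => n; apply: present_upto_integral => // k; apply: measurable_funD => //.
exact: (service_measurable_noise queue).
Qed.

Lemma present_total_square_integral t :
  (\int[P]_w (present_total t w ^+ 2)%:E + \int[P]_w (noise sK2 t w)%:E =
   \int[P]_w (noise sK t w ^+ 2)%:E + \int[P]_w (noise sK t w)%:E)%E.
Proof.
have c1 : (\int[P]_w (present_upto n t w ^+ 2 + noise_upto sK2 n t w)%:E @[n --> \oo] -->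
    \int[P]_w (present_total t w ^+ 2 + noise sK2 t w)%:E)%E.
  apply: (@integral_stationary_cvg _ _ _ P _ _ (epochs_before t)).
  - by move=> n w; rewrite addr_ge0 ?sqr_ge0// noise_upto_ge0.
  - by move=> n; apply: measurable_funD => //; apply: measurable_funX; exact: measurable_present_upto.
  - by move=> w n m nm; rewrite lerD ?noise_upto_nondecreasing// lerXn2r ?nnegrE ?present_upto_ge0// present_upto_nondecreasing.
  - by move=> w n nn; rewrite present_uptoE// (noise_uptoE hawkes).
have c2 : (\int[P]_w (noise_upto sK n t w ^+ 2 + noise_upto sK n t w)%:E @[n --> \oo] -->
    \int[P]_w (noise sK t w ^+ 2 + noise sK t w)%:E)%E.
  apply: (@integral_stationary_cvg _ _ _ P _ _ (epochs_before t)).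
  - by move=> n w; rewrite addr_ge0 ?sqr_ge0// noise_upto_ge0.
  - by move=> n; apply: measurable_funD => //; exact: measurable_funX.
  - by move=> w n m nm; rewrite lerD ?noise_upto_nondecreasing// lerXn2r ?nnegrE ?noise_upto_ge0// noise_upto_nondecreasing.
  - by move=> w n nn; rewrite !(noise_uptoE hawkes).
rewrite (funext (fun n => present_upto_square_integral n t)) in c1.
have mP : measurable_fun setT (present_total t).
  apply: (@measurable_fun_cvg _ _ _ setT (fun n => present_upto n t)) => //.
    by move=> n; exact: measurable_present_upto.
  by move=> w _; apply: cvg_near_cst; exists (epochs_before t w) => // n /= nn; exact: present_uptoE.
have I0 s w : 0 <= noise s t w by exact: noise_ge0.
have := cvg_unique _ c1 c2.
have add (Y : T -> R) (s : shot R) : (forall w, 0 <= Y w) -> measurable_fun setT Y ->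
    (\int[P]_w (Y w ^+ 2 + noise s t w)%:E = \int[P]_w (Y w ^+ 2)%:E + \int[P]_w (noise s t w)%:E)%E.
  move=> Y0 mY; apply: ge0_integral_EFinD; [by move=> w; exact: sqr_ge0|exact: measurable_funX| |exact: mI].
  by move=> w; exact: noise_ge0.
have nu0 w : 0 <= present_total t w by exact: present_upto_ge0.
by rewrite (add _ _ nu0 mP) (add _ _ (I0 sK) (mI sK t)); apply; exact: ereal_hausdorff.
Qed.

End customers.

(** * The three expectations *)

Section hawkes_queue.
Context d (T : measurableType d) (R : realType) (P : probability T R) (lam r mu : R)
  (B : {RV P >-> R}) (tau mk srv : nat -> {RV P >-> R}) (b1 b2 : R).
Hypotheses (lam_gt0 : 0 < lam) (r_gt0 : 0 < r) (mu_gt0 : 0 < mu).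
Hypothesis queue : hawkes_infinite_server lam r mu B tau mk srv.
Hypothesis B_pos : P [set w | 0 < B w] = 1%E.
Hypothesis b1E : ('E_P[B] = b1%:E)%E.
Hypothesis b2E : ('E_P[fun w => (B w ^+ 2)%R] = b2%:E)%E.
Let hawkes := hawkes_arrivals queue.

Local Notation L := (intensity lam r tau mk).
Local Notation N := (customers tau srv).
Local Notation noise := (noise tau mk).
Local Notation pos_intensity := (pos_intensity lam tau mk r_gt0).
Local Notation present_total := (present_total tau srv).
Local Notation moment := (moment tau mk).
Local Notation sL := (mark_shot r_gt0).
Local Notation sK := (count_shot (ltW mu_gt0)).

Lemma ae_intensity t : {ae P, forall w, L t w = pos_intensity t w}.
Proof.
have := ae_mark_pos hawkes B_pos; apply: filterS => w m0.
have /(upcomingP (epochs_increasing hawkes)) E := epochs_beforeP hawkes t w.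
by rewrite (intensity_rate_after lam r m0 E) (rate_afterE _ _ _ r_gt0).
Qed.

(** [customers] counts an arrival at t and [present_total] does not; almost surely there is none. *)
Lemma ae_customers t : {ae P, forall w, (N t w)%:R = present_total t w}.
Proof.
have := ae_not_epoch lam_gt0 r_gt0 hawkes B_pos b1E t; apply: filterS => w nt.
have /(upcomingP (epochs_increasing hawkes)) E := epochs_beforeP hawkes t w.
have E' k : (tau k w <= t) = (k < epochs_before tau t w)%N by rewrite le_eqVlt (negbTE (nt k)) E.
rewrite (customers_eq srv E') natr_sum; apply: eq_bigr => i _.
by rewrite /present E ltn_ord mul1r.
Qed.

Lemma measurable_customers t : measurable_fun setT (fun w => (N t w)%:R : R).
Proof.
apply: (@measurable_fun_cvg _ _ _ setT
  (fun n w => \sum_(i < n) (tau i w <= t)%R%:R * (t < tau i w + srv i w)%R%:R)) => //.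
  move=> n; apply: measurable_sum => i; apply: measurable_funM; apply: measurable_boolR.
    exact: measurable_fun_ler.
  by apply: measurable_fun_ltr => //; exact: measurable_funD.
move=> w _; apply: cvg_near_cst.
have [n nE] := epoch_index (epochs_increasing hawkes) (epochs_unbounded hawkes) t w.
exists n => // m /= nm; rewrite (customers_eq srv nE) natr_sum.
pose F i : R := (tau i w <= t)%R%:R * (t < tau i w + srv i w)%R%:R.
rewrite -(big_mkord xpredT F) (big_cat_nat (leq0n n) nm)/= [X in _ + X]big_nat_cond.
rewrite [X in _ + X]big1 ?addr0.
  by rewrite big_mkord; apply: eq_bigr => i _; rewrite /F nE ltn_ord mul1r.
by move=> i /andP[/andP[ni _] _]; rewrite /F nE ltnNge ni mul0r.
Qed.

Let mlamI t : measurable_fun setT (pos_intensity t).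
Proof. exact: jointly_slice (jointly_pos_intensity lam_gt0 r_gt0 hawkes). Qed.

Lemma measurable_present_total t : measurable_fun setT (present_total t).
Proof.
apply: (@measurable_fun_cvg _ _ _ setT (fun n => present_upto tau srv n t)) => //.
  by move=> n; exact: (measurable_present_upto tau mk).
by move=> w _; apply: cvg_near_cst; exists (epochs_before tau t w) => // n /= nn; exact: (present_uptoE queue).
Qed.

Lemma Rintegral_fin (f : T -> R) : P.-integrable setT (EFin \o f) ->
  (\int[P]_w (f w)%:E = (\int[P]_w f w)%R%:E)%E.
Proof. by move=> i; rewrite /Rintegral fineK//; exact: integrable_fin_num i. Qed.

Hypothesis r0_neq0 : r - b1 != 0.

Lemma expectation_intensity_square D1 t : moment_LL lam r b1 b2 D1 0 = lam ^+ 2 -> 0 <= t ->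
  ('E_P[fun w => (L t w ^+ 2)%R] = (moment_LL lam r b1 b2 D1 t)%:E)%E.
Proof.
move=> D1E t0.
rewrite expectation.unlock (@ae_eq_integral _ _ _ _ _ (fun w => (pos_intensity t w ^+ 2)%:E))//; first last.
- by have := ae_intensity t; apply: filterS => w -> _.
- by apply/measurable_EFinP; exact: measurable_funX.
- by apply/measurable_EFinP; apply: measurable_funX; exact: (intensity_measurable hawkes).
have [i1 E1] := pos_intensity_noise_integral lam_gt0 r_gt0 hawkes B_pos b1E b2E (narrow_one R) t0.
have [i2 E2] := pos_intensity_noise_integral lam_gt0 r_gt0 hawkes B_pos b1E b2E (narrow_mark r_gt0) t0.
(* One factor of the square is split as lam plus noise, so that each term integrates the intensity
   against a noise. *)
transitivity (lam%:E * \int[P]_w (pos_intensity t w * noise (one_shot R) t w)%:E +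
   \int[P]_w (pos_intensity t w * noise sL t w)%:E)%E.
  rewrite -integralZl// -integralD//; last exact: integrableZl.
  by apply: eq_integral => w _; rewrite -EFinM -EFinD noise_one /pos_intensity; congr _%:E; ring.
rewrite !Rintegral_fin// E1 E2 -EFinM -EFinD moment_one.
rewrite (moment_L lam_gt0 r_gt0 hawkes B_pos b1E b2E r0_neq0 t0).
rewrite (moment_LLE lam_gt0 r_gt0 hawkes B_pos b1E b2E r0_neq0 t0 D1E).
by congr _%:E; rewrite -sol_LL_sum//; ring.
Qed.

Hypotheses (mur0 : mu - (r - b1) != 0) (mupr0 : mu + (r - b1) != 0).

Lemma expectation_intensity_customers D1 D2 t : moment_LL lam r b1 b2 D1 0 = lam ^+ 2 ->
  moment_LN lam r mu b1 b2 D1 D2 0 = 0 -> 0 <= t ->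
  ('E_P[fun w => (L t w * (N t w)%:R)%R] = (moment_LN lam r mu b1 b2 D1 D2 t)%:E)%E.
Proof.
move=> D1E D2E t0.
rewrite expectation.unlock.
rewrite (@ae_eq_integral _ _ _ _ _ (fun w => (pos_intensity t w * present_total t w)%:E))//; first last.
- by have := ae_customers t; have := ae_intensity t; apply: filterS2 => w -> -> _.
- by apply/measurable_EFinP; apply: measurable_funM => //; exact: measurable_present_total.
- apply/measurable_EFinP; apply: measurable_funM; first exact: (intensity_measurable hawkes).
  exact: measurable_customers.
rewrite (pos_intensity_present_integral lam_gt0 r_gt0 mu_gt0 queue).
have [i1 E1] := pos_intensity_noise_integral lam_gt0 r_gt0 hawkes B_pos b1E b2E (narrow_count (ltW mu_gt0)) t0.
rewrite Rintegral_fin// E1.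
rewrite (moment_K lam_gt0 r_gt0 hawkes B_pos b1E b2E r0_neq0 mu_gt0 mur0 t0).
rewrite (moment_LK lam_gt0 r_gt0 hawkes B_pos b1E b2E r0_neq0 mu_gt0 mur0 mupr0 D1E D2E t0).
by congr _%:E; rewrite sol_LN_sum.
Qed.

Hypothesis mu2r0 : 2 * mu - (r - b1) != 0.

Lemma expectation_customers_square D1 D2 D3 t : moment_LL lam r b1 b2 D1 0 = lam ^+ 2 ->
  moment_LN lam r mu b1 b2 D1 D2 0 = 0 -> moment_NN lam r mu b1 b2 D1 D2 D3 0 = 0 -> 0 <= t ->
  ('E_P[fun w => ((N t w)%:R ^+ 2)%R] = (moment_NN lam r mu b1 b2 D1 D2 D3 t)%:E)%E.
Proof.
move=> D1E D2E D3E t0.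
rewrite expectation.unlock.
rewrite (@ae_eq_integral _ _ _ _ _ (fun w => (present_total t w ^+ 2)%:E))//; first last.
- by have := ae_customers t; apply: filterS => w -> _.
- by apply/measurable_EFinP; apply: measurable_funX; exact: measurable_present_total.
- by apply/measurable_EFinP; apply: measurable_funX; exact: measurable_customers.
have mu2_gt0 : 0 < 2 * mu by rewrite mulr_gt0.
have one_int (c : R) (c0 : 0 < c) (nc := narrow_count (ltW c0)) :
    (\int[P]_w (noise (count_shot (ltW c0)) t w)%:E = (moment (count_shot (ltW c0)) (one_shot R) t)%:E)%E.
  rewrite -(momentE lam_gt0 r_gt0 hawkes B_pos b1E b2E nc (narrow_one R) t0).
  by apply: eq_integral => w _; rewrite noise_one mulr1.
have := present_total_square_integral mu_gt0 queue mu2_gt0 t; rewrite !one_int.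
have -> : (\int[P]_w (noise sK t w ^+ 2)%:E = (moment sK sK t)%:E)%E.
  by rewrite -(momentE lam_gt0 r_gt0 hawkes B_pos b1E b2E (narrow_count _) (narrow_count _) t0).
rewrite (moment_K lam_gt0 r_gt0 hawkes B_pos b1E b2E r0_neq0 mu_gt0 mur0 t0).
rewrite (moment_K lam_gt0 r_gt0 hawkes B_pos b1E b2E r0_neq0 mu2_gt0 mu2r0 t0).
rewrite (moment_KK lam_gt0 r_gt0 hawkes B_pos b1E b2E r0_neq0 mu_gt0 mur0 mupr0 D1E D2E mu2r0 D3E t0).
(* The other three terms of the identity are finite, which excludes an infinite second moment. *)
rewrite -sol_NN_sum; case: (integral _ _ _) => [x| |] //.
by rewrite -!EFinD => -[E]; congr _%:E; rewrite -E addrK.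
Qed.

End hawkes_queue.
(** The conditions on mu - r0, mu + r0 and 2 mu - r0 keep the denominators of the formulas nonzero;
    each is imposed only from the first formula on in which its denominator occurs. D1, D2 and D3
    enter through their initial conditions alone. *)
Theorem corollary3p5 (d : measure_display) (T : measurableType d) (R : realType)
    (P : probability T R) (lam r mu : R) (B : {RV P >-> R})
    (tau mk srv : nat -> {RV P >-> R}) (b1 b2 : R)
    (lam_gt0 : 0 < lam) (r_gt0 : 0 < r) (mu_gt0 : 0 < mu)
    (B_pos : P [set w | 0 < B w] = 1%E)
    (queue : hawkes_infinite_server lam r mu B tau mk srv)
    (b1E : ('E_P[B] = b1%:E)%E)
    (b2E : ('E_P[fun w => (B w ^+ 2)%R] = b2%:E)%E) :
  let r0 := r - b1 in
  let L := intensity lam r tau mk in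
  let N := customers tau srv in
  r0 != 0 ->
  forall D1 : R, moment_LL lam r b1 b2 D1 0 = lam ^+ 2 ->
  (forall t, 0 <= t ->
     ('E_P[fun w => (L t w ^+ 2)%R] = (moment_LL lam r b1 b2 D1 t)%:E)%E) /\
  (mu - r0 != 0 -> mu + r0 != 0 ->
   forall D2 : R, moment_LN lam r mu b1 b2 D1 D2 0 = 0 ->
   (forall t, 0 <= t ->
      ('E_P[fun w => (L t w * (N t w)%:R)%R]
       = (moment_LN lam r mu b1 b2 D1 D2 t)%:E)%E) /\
   (2 * mu - r0 != 0 ->
    forall D3 : R, moment_NN lam r mu b1 b2 D1 D2 D3 0 = 0 ->
    forall t, 0 <= t ->
      ('E_P[fun w => ((N t w)%:R ^+ 2)%R]
       = (moment_NN lam r mu b1 b2 D1 D2 D3 t)%:E)%E)).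
Proof.
move=> r0 L N r0_neq0 D1 D1E; split => [t|mur0 mupr0 D2 D2E].
  exact: (expectation_intensity_square lam_gt0 r_gt0 queue).
split => [t|mu2r0 D3 D3E t].
  exact: (expectation_intensity_customers lam_gt0 r_gt0 mu_gt0 queue).
exact: (expectation_customers_square lam_gt0 r_gt0 mu_gt0 queue).
Qed.
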